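(* The problem Barrier-Coverage can be solved in time $2^{2B^2(B+1)}\cdot n^{O(1)}$.
   Context: Barrier-Coverage: the input consists of sensors $(x_1,r_1),\dots,(x_n,r_n)$ with $x_i,r_i\in\mathbb{N}$ for all $i$, and $L\in\mathbb{N}$, $B\in\mathbb{N}$. The question is whether there exists $y\in\mathbb{R}^n$ with $[0,L]\subseteq\bigcup_i[y_i-r_i,y_i+r_i]$ and $\sum_i|y_i-x_i|\le B$.
   Formalization: The polynomial factor n^{O(1)} is taken in the bit length of the binary-encoded input (not the number n of sensors), up to a constant factor, on a single-tape Turing machine; in n alone no bit-cost bound can hold, as the numbers must be read even when n = 1, B = 0. *)

(* Defs.v *)
From Stdlib Require Import Reals List NArith.
Import ListNotations.
Open Scope R_scope.

Fixpoint sumR (f : nat -> R) (n : nat) : R :=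
  match n with
  | O => 0
  | S m => sumR f m + f m
  end.

(* sensors s = [(x_1,r_1); ...; (x_n,r_n)] (0-indexed in the list);
   y i is the new position of sensor i. *)
Definition sensor_x (s : list (nat * nat)) (i : nat) : R := INR (fst (nth i s (0%nat,0%nat))).
Definition sensor_r (s : list (nat * nat)) (i : nat) : R := INR (snd (nth i s (0%nat,0%nat))).

Definition BarrierCoverage (s : list (nat * nat)) (L B : nat) : Prop :=
  exists y : nat -> R,
    (forall t : R, 0 <= t <= INR L ->
       exists i : nat, (i < length s)%nat /\
         y i - sensor_r s i <= t <= y i + sensor_r s i) /\
    sumR (fun i => Rabs (y i - sensor_x s i)) (length s) <= INR B.

(* tape symbols are naturals; 0 is the blank. *)
Inductive move := MoveL | MoveR | Stay.

Record TM := mkTM {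
  tm_nstates : nat;             (* states are 0 .. tm_nstates - 1 *)
  tm_nsyms   : nat;             (* tape symbols are 0 .. tm_nsyms - 1 *)
  tm_start   : nat;
  tm_accept  : nat;
  tm_reject  : nat;
  tm_delta   : nat -> nat -> nat * nat * move
}.

Definition wf_TM (M : TM) : Prop :=
  (4 <= tm_nsyms M)%nat /\
  (tm_start M < tm_nstates M)%nat /\
  (tm_accept M < tm_nstates M)%nat /\
  (tm_reject M < tm_nstates M)%nat /\
  tm_accept M <> tm_reject M /\
  forall q a, (q < tm_nstates M)%nat -> (a < tm_nsyms M)%nat ->
    match tm_delta M q a with
    | (q', b, _) => (q' < tm_nstates M)%nat /\ (b < tm_nsyms M)%nat
    end.

(* configuration: state, tape left of head (nearest first), symbol under
   head, tape right of head (nearest first); the tape is two-way infinite,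
   blank outside the stored lists. *)
Record config := mkConfig {
  cf_state : nat;
  cf_left  : list nat;
  cf_head  : nat;
  cf_right : list nat
}.

Definition hd0 (l : list nat) : nat := match l with [] => 0%nat | a :: _ => a end.
Definition tl0 (l : list nat) : list nat := match l with [] => [] | _ :: t => t end.

Definition halted (M : TM) (c : config) : bool :=
  Nat.eqb (cf_state c) (tm_accept M) || Nat.eqb (cf_state c) (tm_reject M).

Definition step (M : TM) (c : config) : config :=
  if halted M c then c else
  match tm_delta M (cf_state c) (cf_head c) with
  | (q', b, MoveL) => mkConfig q' (tl0 (cf_left c)) (hd0 (cf_left c)) (b :: cf_right c)
  | (q', b, MoveR) => mkConfig q' (b :: cf_left c) (hd0 (cf_right c)) (tl0 (cf_right c))
  | (q', b, Stay)  => mkConfig q' (cf_left c) b (cf_right c)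
  end.

Fixpoint run (M : TM) (k : nat) (c : config) : config :=
  match k with
  | O => c
  | S k' => run M k' (step M c)
  end.

Definition init_config (M : TM) (w : list nat) : config :=
  mkConfig (tm_start M) [] (hd0 w) (tl0 w).

Definition decides_within (M : TM) (w : list nat) (T : nat) (P : Prop) : Prop :=
  let c := run M T (init_config M w) in
  halted M c = true /\ (cf_state c = tm_accept M <-> P).

(** * Encoding of instances over the input alphabet {1,2,3}
      (1 = bit '0', 2 = bit '1', 3 = separator '#') *)

Fixpoint pos_bits (p : positive) : list nat :=
  match p with
  | xH => [2%nat]
  | xO p' => pos_bits p' ++ [1%nat]
  | xI p' => pos_bits p' ++ [2%nat]
  end.

(* binary representation, most significant bit first *)
Definition bin (n : nat) : list nat :=
  match N.of_nat n with
  | N0 => [1%nat]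
  | Npos p => pos_bits p
  end.

Definition encode (s : list (nat * nat)) (L B : nat) : list nat :=
  bin L ++ [3%nat] ++ bin B ++
  flat_map (fun xr => [3%nat] ++ bin (fst xr) ++ [3%nat] ++ bin (snd xr)) s.

(* Main.v *)
Require Import Defs.
From Stdlib Require Import Reals List NArith ZArith Arith Lia Lra Bool Permutation
  FunctionalExtensionality.
Import ListNotations.
Open Scope nat_scope.

(** Positions may be taken integral: rounding all positions after a common random shift
    preserves coverage and, in expectation, the cost.  Then every moved sensor costs at
    least 1.  Let p be the first uncovered cell.  Some sensor has to move onto p; its near
    end lies at distance at most B from p.  Among the sensors with the same near end and
    radius at least B the shortest may be chosen, because exchanging displacements with a
    longer one loses no coverage; so a choice is described by a direction, a distance, a
    radius truncated at B and a displacement.  Hence a word of length B (3 B + 1) over six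
    elementary operations leads to a solution if there is one, and trying all words takes
    2^O(B^2) N^O(1) steps, which is below 2^(2 B^2 (B + 1)) N^O(1) up to a constant factor.
    The search is a tree program built from polynomial-time combinators; trees are written
    as words on four stacks, and the stacks are tracks of a single tape.  The quadratic
    overhead of the simulation is absorbed because B^2 = o(B^3). *)

(** Branching over the sensors would cost a factor n per moved sensor, and positions and radii are
    exponentially large numbers, so a branch may only use data bounded by B: that is why a sensor is
    addressed relative to the frontier. The small numbers of its description are counted up one
    letter at a time, which keeps the branching at six. Every letter applies to every state and none
    makes an unsolvable instance look solvable; completeness asks only that each chosen sensor moves
    by at least one unit in some solution, which uses up budget, not that it covers the frontier
    cell at once. The search is not polynomial in its input. Running times are therefore polynomial
    in a measure that may exceed the input size, and the final measure bounds the list of all states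
    up to a small factor. This leaves an unspecified exponent on 2^O(B^2), harmless for the same
    reason as the simulation overhead. The factor per round is 201 instead of 6, since it bounds the
    growth of encodings and not only the number of states. *)

Inductive idx := I0 | I1 | I2 | I3.
Inductive letter := Blank | LNil | LCons | LSep.

Definition idx_eq_dec (i j : idx) : {i = j} + {i <> j}.
Proof. decide equality. Defined.
Definition letter_eq_dec (a b : letter) : {a = b} + {a <> b}.
Proof. decide equality. Defined.

Definition upd {A : Type} (i : idx) (v : A) (f : idx -> A) : idx -> A :=
  fun j => if idx_eq_dec j i then v else f j.

Lemma upd_same {A : Type} i (v : A) f : upd i v f i = v.
Proof. unfold upd; destruct (idx_eq_dec i i); congruence. Qed.

Lemma upd_other {A : Type} i j (v : A) f : j <> i -> upd i v f j = f j.
Proof. unfold upd; destruct (idx_eq_dec j i); congruence. Qed.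

(** * Stack programs and their step relation *)

Definition store := idx -> list letter.
Definition top (l : list letter) : letter := hd Blank l.

Inductive instr :=
  | IPush (i : idx) (a : letter)
  | IPop (i : idx)
  | ITest (i : idx) (a : letter) (yes no : nat).

(** The addresses [length P] and [length P + 1] are the accepting and the rejecting exit, so jump
    targets range below [length P + 2]. *)
Inductive sstep (P : list instr) : nat * store -> nat * store -> Prop :=
  | sstep_push pc st i a : nth_error P pc = Some (IPush i a) -> a <> Blank ->
      sstep P (pc, st) (S pc, upd i (a :: st i) st)
  | sstep_pop pc st i : nth_error P pc = Some (IPop i) ->
      sstep P (pc, st) (S pc, upd i (tl (st i)) st)
  | sstep_test pc st i a yes no pc' : nth_error P pc = Some (ITest i a yes no) ->
      pc' = (if letter_eq_dec (top (st i)) a then yes else no) ->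
      pc' < length P + 2 ->
      sstep P (pc, st) (pc', st).

Inductive ssteps (P : list instr) : nat -> nat * store -> nat * store -> Prop :=
  | ssteps_refl t c : ssteps P t c c
  | ssteps_cons t c1 c2 c3 : sstep P c1 c2 -> ssteps P t c2 c3 -> ssteps P (S t) c1 c3.

Lemma ssteps_le P t t' c1 c2 : ssteps P t c1 c2 -> t <= t' -> ssteps P t' c1 c2.
Proof.
  intros H; revert t'; induction H; intros t' Ht; [constructor|].
  destruct t'; [lia|]. econstructor; eauto. apply IHssteps; lia.
Qed.

Lemma ssteps_trans P t1 t2 t c1 c2 c3 :
  ssteps P t1 c1 c2 -> ssteps P t2 c2 c3 -> t1 + t2 <= t -> ssteps P t c1 c3.
Proof.
  intros H; revert t; induction H; intros t' H2 Ht.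
  - eapply ssteps_le; eauto; lia.
  - destruct t'; [lia|]. econstructor; eauto. apply IHssteps; auto; lia.
Qed.

(** * Stack programs on a Turing machine *)

(* The j-th tape cell right of the home cell holds the j-th entry of each of the
   four stacks, so that all four tops are scanned at once; a push or a pop shifts
   one track by one cell and uses a mark on the home cell to find the way back. *)
Definition cell := idx -> letter.
Definition blank_cell : cell := fun _ => Blank.

Definition nat_of_letter (a : letter) : nat :=
  match a with Blank => 0 | LNil => 1 | LCons => 2 | LSep => 3 end.
Definition letter_of_nat (n : nat) : letter :=
  match n with 0 => Blank | 1 => LNil | 2 => LCons | _ => LSep end.

(** Base 4 digits, arranged so that 0 is the blank cell and the input symbols 1, 2, 3 already are
    unmarked cells with a letter on track [I0] only: the input tape needs no translation. *)
Definition sym (c : cell) (m : bool) : nat :=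
  nat_of_letter (c I0) + 4 * nat_of_letter (c I1) + 16 * nat_of_letter (c I2)
  + 64 * nat_of_letter (c I3) + (if m then 256 else 0).
Definition sym_cell (n : nat) : cell := fun i =>
  letter_of_nat (match i with
    | I0 => n mod 4 | I1 => n / 4 mod 4 | I2 => n / 16 mod 4 | I3 => n / 64 mod 4 end).
Definition sym_mark (n : nat) : bool := 256 <=? n.

Lemma sym_lt c m : sym c m < 512.
Proof.
  unfold sym; destruct (c I0), (c I1), (c I2), (c I3), m; simpl nat_of_letter; lia.
Qed.

Lemma sym_cellK c m : sym_cell (sym c m) = c.
Proof.
  apply functional_extensionality; intros i; unfold sym_cell, sym.
  destruct i, (c I0), (c I1), (c I2), (c I3), m; reflexivity.
Qed.

Lemma sym_markK c m : sym_mark (sym c m) = m.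
Proof.
  unfold sym_mark, sym; destruct (c I0), (c I1), (c I2), (c I3), m; reflexivity.
Qed.

(** [PushR] carries the displaced letter one cell to the right and [PushL] walks back to the mark;
    [PopR] runs to the end of the track and [PopL] brings every letter one cell to the left on the
    way back. *)
Inductive phase :=
  | Home | PushR (a : letter) | PushL | PopR | PopL (a : letter).

Definition nat_of_phase (p : phase) : nat :=
  match p with
  | Home => 0 | PushL => 1 | PopR => 2
  | PushR a => 4 + nat_of_letter a | PopL a => 8 + nat_of_letter a
  end.
Definition phase_of_nat (n : nat) : phase :=
  match n with
  | 0 => Home | 1 => PushL | 2 | 3 => PopR
  | 4 | 5 | 6 | 7 => PushR (letter_of_nat (n - 4))
  | _ => PopL (letter_of_nat (n - 8))
  end.

Definition qstate (pc : nat) (p : phase) : nat := 16 * pc + nat_of_phase p.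

Lemma nat_of_phase_lt p : nat_of_phase p < 16.
Proof. destruct p as [|[]| | |[]]; simpl; lia. Qed.

Lemma qstate_pc pc p : qstate pc p / 16 = pc.
Proof.
  unfold qstate. pose proof (nat_of_phase_lt p).
  symmetry; apply Nat.div_unique with (nat_of_phase p); lia.
Qed.

Lemma qstate_phase pc p : phase_of_nat (qstate pc p mod 16) = p.
Proof.
  unfold qstate. pose proof (nat_of_phase_lt p).
  replace (_ mod 16) with (nat_of_phase p) by (apply Nat.mod_unique with pc; lia).
  destruct p as [|[]| | |[]]; reflexivity.
Qed.

Definition letter_eqb (a b : letter) : bool := if letter_eq_dec a b then true else false.

Definition delta (P : list instr) (pc : nat) (p : phase) (c : cell) (m : bool)
  : nat * phase * cell * bool * move :=
  match nth_error P pc with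
  | None => (0, Home, c, m, Stay)
  | Some (ITest i a yes no) =>
      (if letter_eq_dec (c i) a then yes else no, Home, c, m, Stay)
  | Some (IPush i a) =>
      match p with
      | PushR x => if letter_eqb x Blank then (pc, PushL, c, m, MoveL)
                   else (pc, PushR (c i), upd i x c, m, MoveR)
      | PushL => if m then (S pc, Home, c, false, Stay) else (pc, PushL, c, m, MoveL)
      | _ => (pc, PushR (c i), upd i a c, true, MoveR)
      end
  | Some (IPop i) =>
      match p with
      | PopR => if letter_eqb (c i) Blank then (pc, PopL Blank, c, m, MoveL)
                else (pc, PopR, c, m, MoveR)
      | PopL x => if m then (S pc, Home, upd i x c, false, Stay)
                  else (pc, PopL (c i), upd i x c, m, MoveL)
      | _ => (pc, PopR, c, true, MoveR)
      end
  end.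

(** The halting states are phase [Home] at the two exit addresses. Jumps out of range are redirected
    to state 0 to keep the machine well formed; [sstep] never takes one. *)
Definition tm_of (P : list instr) : TM :=
  mkTM (16 * (length P + 2)) 512 0 (16 * length P) (16 * (length P + 1))
    (fun q a =>
       let '(pc', p', c', m', mv) :=
         delta P (q / 16) (phase_of_nat (q mod 16)) (sym_cell a) (sym_mark a) in
       (if qstate pc' p' <? 16 * (length P + 2) then qstate pc' p' else 0, sym c' m', mv)).

Lemma tm_of_wf P : wf_TM (tm_of P).
Proof.
  unfold wf_TM, tm_of;
    cbn [tm_nsyms tm_nstates tm_start tm_accept tm_reject tm_delta].
  split; [lia|]. split; [lia|]. split; [lia|]. split; [lia|]. split; [lia|].
  intros q a _ _.
  destruct (delta P _ _ _ _) as [[[[pc' p'] c'] m'] mv].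
  split; [|apply sym_lt].
  destruct (Nat.ltb_spec (qstate pc' p') (16 * (length P + 2))); lia.
Qed.

(* [R] starts with the scanned cell. *)
Definition at_tape (pc : nat) (p : phase) (L R : list nat) : config :=
  mkConfig (qstate pc p) L (hd0 R) (tl0 R).

Lemma step_at_tape P pc p L R c m pc' p' c' m' mv :
  pc < length P -> hd0 R = sym c m -> delta P pc p c m = (pc', p', c', m', mv) ->
  pc' < length P + 2 ->
  step (tm_of P) (at_tape pc p L R) =
    match mv with
    | MoveL => at_tape pc' p' (tl0 L) (hd0 L :: sym c' m' :: tl0 R)
    | MoveR => at_tape pc' p' (sym c' m' :: L) (tl0 R)
    | Stay => at_tape pc' p' L (sym c' m' :: tl0 R)
    end.
Proof.
  intros Hpc HR Hd Hpc'. unfold step.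
  replace (halted (tm_of P) (at_tape pc p L R)) with false.
  2:{ unfold halted, at_tape, qstate; cbn [tm_accept tm_reject tm_of cf_state].
      pose proof (nat_of_phase_lt p). symmetry; apply Bool.orb_false_iff; split;
      apply Nat.eqb_neq; lia. }
  unfold at_tape. cbn [tm_delta tm_of cf_state cf_head].
  rewrite HR, qstate_pc, qstate_phase, sym_cellK, sym_markK, Hd.
  replace (qstate pc' p' <? _) with true.
  2:{ symmetry; apply Nat.ltb_lt. unfold qstate; pose proof (nat_of_phase_lt p'). lia. }
  destruct mv; reflexivity.
Qed.

Lemma run_add M a b c : run M (a + b) c = run M b (run M a c).
Proof. revert c; induction a; intros c; simpl; auto. Qed.

Lemma run_1 M c : run M 1 c = step M c.
Proof. reflexivity. Qed.

(** * Sweeps that shift one track *)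

Definition syms (cs : list cell) : list nat := map (fun c => sym c false) cs.

Lemma hd0_syms cs : hd0 (syms cs) = sym (hd blank_cell cs) false.
Proof. destruct cs; reflexivity. Qed.

Lemma tl0_syms cs : tl0 (syms cs) = syms (tl cs).
Proof. destruct cs; reflexivity. Qed.

(** The right part of the tape after a push has swept over it carrying [x]. A visited blank cell
    stays as an explicit entry, because tapes are compared literally as lists. *)
Fixpoint shift (i : idx) (x : letter) (cs : list cell) : list cell :=
  if letter_eqb x Blank then hd blank_cell cs :: tl cs else
  match cs with
  | [] => [upd i x blank_cell; blank_cell]
  | c :: cs' => upd i x c :: shift i (c i) cs'
  end.

Fixpoint unshift (i : idx) (cs : list cell) : list cell :=
  match cs with
  | [] => [blank_cell]
  | c :: cs' => if letter_eqb (c i) Blank then c :: cs'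
                else upd i (hd blank_cell cs' i) c :: unshift i cs'
  end.

Lemma run_shift P pc i a : nth_error P pc = Some (IPush i a) -> forall cs x l L,
  exists k, k <= 2 * length cs + 3 /\
  run (tm_of P) k (at_tape pc (PushR x) (l :: L) (syms cs)) =
  at_tape pc PushL L (l :: syms (shift i x cs)).
Proof.
  intros HP.
  assert (Hpc : pc < length P) by (apply nth_error_Some; congruence).
  assert (base : forall cs l L,
    run (tm_of P) 1 (at_tape pc (PushR Blank) (l :: L) (syms cs)) =
    at_tape pc PushL L (l :: syms (hd blank_cell cs :: tl cs))).
  { intros cs l L. rewrite run_1. erewrite step_at_tape; try eassumption.
    2:apply hd0_syms. 2:{ unfold delta; rewrite HP; reflexivity. } 2:lia.
    simpl. rewrite tl0_syms. reflexivity. }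
  induction cs as [|c cs IH]; intros x l L; simpl shift;
    destruct (letter_eqb x Blank) eqn:Ex.
  - unfold letter_eqb in Ex; destruct (letter_eq_dec x Blank); [subst|discriminate].
    exists 1; split; [simpl; lia|apply base].
  - exists 3; split; [simpl; lia|]. change 3 with (1 + (1 + 1)). rewrite run_add.
    rewrite run_1.
    erewrite step_at_tape with (c := blank_cell) (m := false); try eassumption; [| reflexivity | | ].
    2:{ unfold delta; rewrite HP, Ex; reflexivity. } 2:lia.
    rewrite run_add. cbv iota. change (tl0 (syms [])) with (syms []).
    rewrite base. rewrite run_1.
    erewrite step_at_tape; try eassumption; [|reflexivity| |].
    2:{ unfold delta; rewrite HP; reflexivity. } 2:lia.
    reflexivity.
  - unfold letter_eqb in Ex; destruct (letter_eq_dec x Blank); [subst|discriminate].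
    exists 1; split; [simpl; lia|apply base].
  - destruct (IH (c i) (sym (upd i x c) false) (l :: L)) as (k & Hk & Hrun).
    exists (1 + (k + 1)); split; [simpl; lia|]. rewrite run_add.
    rewrite run_1.
    erewrite step_at_tape; try eassumption; [|reflexivity| |].
    2:{ unfold delta; rewrite HP, Ex; reflexivity. } 2:lia.
    rewrite run_add. cbv iota. rewrite tl0_syms; simpl tl. rewrite Hrun. rewrite run_1.
    erewrite step_at_tape; try eassumption; [|reflexivity| |].
    2:{ unfold delta; rewrite HP; reflexivity. } 2:lia.
    reflexivity.
Qed.

Lemma run_unshift P pc i : nth_error P pc = Some (IPop i) -> forall cs l L,
  exists k, k <= 2 * length cs + 1 /\
  run (tm_of P) k (at_tape pc PopR (l :: L) (syms cs)) =
  at_tape pc (PopL (hd blank_cell cs i)) L (l :: syms (unshift i cs)).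
Proof.
  intros HP.
  assert (Hpc : pc < length P) by (apply nth_error_Some; congruence).
  induction cs as [|c cs IH]; intros l L.
  - exists 1; split; [simpl; lia|]. rewrite run_1.
    erewrite step_at_tape with (c := blank_cell) (m := false); try eassumption; [|reflexivity| |].
    2:{ unfold delta; rewrite HP; reflexivity. } 2:lia.
    reflexivity.
  - simpl unshift. destruct (letter_eqb (c i) Blank) eqn:Ex.
    + exists 1; split; [simpl; lia|]. rewrite run_1.
      erewrite step_at_tape; try eassumption; [|reflexivity| |].
      2:{ unfold delta; rewrite HP, Ex; reflexivity. } 2:lia.
      unfold letter_eqb in Ex; destruct (letter_eq_dec (c i) Blank) as [e|]; [|discriminate].
      simpl. rewrite e. reflexivity.
    + destruct (IH (sym c false) (l :: L)) as (k & Hk & Hrun).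
      exists (1 + (k + 1)); split; [simpl; lia|]. rewrite run_add.
      rewrite run_1.
      erewrite step_at_tape; try eassumption; [|reflexivity| |].
      2:{ unfold delta; rewrite HP, Ex; reflexivity. } 2:lia.
      rewrite run_add. cbv iota. rewrite tl0_syms; simpl tl. rewrite Hrun. rewrite run_1.
      erewrite step_at_tape; try eassumption; [|reflexivity| |].
      2:{ unfold delta; rewrite HP; reflexivity. } 2:lia.
      reflexivity.
Qed.

(** Reading with a blank default lets the four stacks have different heights and tolerates trailing
    blank cells. *)
Definition track (i : idx) (cs : list cell) (st : list letter) : Prop :=
  forall j, nth j cs blank_cell i = nth j st Blank.

(** Stacks without blanks: the first blank on a track then marks the end of its stack, which is
    where the sweeps turn. *)
Definition represents (cs : list cell) (s : store) : Prop :=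
  forall i, track i cs (s i) /\ Forall (fun a => a <> Blank) (s i).

Lemma track_hd i cs st : track i cs st -> hd blank_cell cs i = top st.
Proof. intros H; specialize (H 0); destruct cs, st; exact H. Qed.

Lemma track_tl i cs st : track i cs st -> track i (tl cs) (tl st).
Proof.
  intros H j; specialize (H (S j)).
  destruct cs, st; simpl in *; auto; destruct j; auto.
Qed.

Lemma track_cons i c cs a st : c i = a -> track i cs st -> track i (c :: cs) (a :: st).
Proof. intros Hc H [|j]; simpl; auto. Qed.

Lemma shift_track_same i : forall cs x st, track i cs st ->
  Forall (fun a => a <> Blank) st -> (x = Blank -> st = []) ->
  track i (shift i x cs) (if letter_eqb x Blank then [] else x :: st).
Proof.
  induction cs as [|c cs IH]; intros x st H Hf Hx; simpl;
    unfold letter_eqb at 1; destruct (letter_eq_dec x Blank) as [e|n]; simpl;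
    unfold letter_eqb; destruct (letter_eq_dec x Blank); try congruence.
  - intros [|[|j]]; reflexivity.
  - apply track_cons; [apply upd_same|].
    destruct st as [|a st]; [intros [|[|]]; reflexivity|].
    inversion Hf; subst. specialize (H 0). simpl in H. unfold blank_cell in H. congruence.
  - rewrite (Hx e) in H; exact H.
  - apply track_cons; [apply upd_same|].
    pose proof (track_hd _ _ _ H) as Hh; pose proof (track_tl _ _ _ H) as Ht; simpl in *.
    assert (Htf : Forall (fun a => a <> Blank) (tl st)) by (destruct st; inversion Hf; auto).
    specialize (IH (c i) (tl st) Ht Htf).
    assert (c i = Blank -> tl st = []) as Hb.
    { destruct st; auto. simpl in Hh. inversion Hf; subst. congruence. }
    specialize (IH Hb). destruct st as [|a st]; simpl in *.
    + rewrite Hh in IH |- *. exact IH.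
    + inversion Hf; subst. unfold letter_eqb in IH.
      destruct (letter_eq_dec (c i) Blank); congruence.
Qed.

Lemma nth_shift_other i i' : i' <> i -> forall cs x j,
  nth j (shift i x cs) blank_cell i' = nth j cs blank_cell i'.
Proof.
  intros Hi; induction cs as [|c cs IH]; intros x j; simpl;
    destruct (letter_eqb x Blank); destruct j as [|[|j]]; simpl; rewrite ?upd_other; auto;
    destruct j; auto.
Qed.

Lemma nth_unshift_other i i' : i' <> i -> forall cs j,
  nth j (unshift i cs) blank_cell i' = nth j cs blank_cell i'.
Proof.
  intros Hi; induction cs as [|c cs IH]; intros j; simpl.
  - destruct j as [|[|j]]; reflexivity.
  - destruct (letter_eqb (c i) Blank); destruct j; simpl; rewrite ?upd_other; auto.
Qed.

Lemma unshift_track_same i : forall cs st, track i cs st ->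
  Forall (fun a => a <> Blank) st -> track i (unshift i cs) (tl st).
Proof.
  induction cs as [|c cs IH]; intros st H Hf.
  - destruct st as [|a st]; [intros [|[|j]]; reflexivity|].
    inversion Hf; subst. specialize (H 0). unfold blank_cell in H; simpl in H. congruence.
  - pose proof (track_hd _ _ _ H) as Hh; pose proof (track_tl _ _ _ H) as Ht; simpl in *.
    unfold letter_eqb; destruct (letter_eq_dec (c i) Blank) as [e|n].
    + destruct st as [|a st]; [exact H|]. inversion Hf; subst. simpl in Hh. congruence.
    + destruct st as [|a st]; [simpl in Hh; congruence|]. inversion Hf; subst. simpl in *.
      specialize (IH st Ht H3). intros [|j]; simpl.
      * rewrite upd_same. rewrite (track_hd _ _ _ Ht). destruct st; reflexivity.
      * rewrite IH. destruct st; [destruct j|]; reflexivity.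
Qed.

Lemma length_shift i : forall cs x, length (shift i x cs) <= length cs + 2.
Proof.
  induction cs as [|c cs IH]; intros x; simpl; destruct (letter_eqb x Blank); simpl; try lia.
  specialize (IH (c i)); lia.
Qed.

Lemma length_unshift i : forall cs, length (unshift i cs) <= length cs + 1.
Proof.
  induction cs as [|c cs IH]; simpl; try lia.
  destruct (letter_eqb (c i) Blank); simpl; lia.
Qed.

Lemma represents_hd cs s i : represents cs s -> hd blank_cell cs i = top (s i).
Proof. intros H; apply track_hd, H. Qed.

Lemma sstep_tm P pc s pc' s' cs : sstep P (pc, s) (pc', s') -> represents cs s ->
  exists k cs', k <= 2 * length cs + 6 /\ length cs' <= length cs + 3 /\
    represents cs' s' /\
    run (tm_of P) k (at_tape pc Home [] (syms cs)) = at_tape pc' Home [] (syms cs').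
Proof.
  intros H Hr. set (h := hd blank_cell cs).
  assert (Hpc : forall ins, nth_error P pc = Some ins -> pc < length P)
    by (intros ins E; apply nth_error_Some; congruence).
  assert (Hnth : forall i j, nth j (tl cs) blank_cell i = nth (S j) cs blank_cell i)
    by (intros i [|j]; destruct cs; reflexivity).
  inversion H as [pc0 s0 i a HP Ha | pc0 s0 i HP | pc0 s0 i a yes no pc0' HP Hpc' Hlt]; subst.
  - destruct (run_shift P pc i a HP (tl cs) (h i) (sym (upd i a h) true) []) as (k & Hk & Hrun).
    exists (1 + (k + 1)), (upd i a h :: shift i (h i) (tl cs)).
    assert (length (tl cs) <= length cs) by (destruct cs; simpl; lia).
    split; [lia|]. split; [pose proof (length_shift i (tl cs) (h i)); simpl; lia|]. split.
    + intros i'. destruct (Hr i') as [Ht Hf]. destruct (idx_eq_dec i' i) as [->|ne].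
      * rewrite upd_same. split; [|constructor; auto].
        apply track_cons; [apply upd_same|].
        unfold h. rewrite (track_hd _ _ _ Ht).
        pose proof (track_tl _ _ _ Ht) as Ht'.
        destruct (s i) as [|b st] eqn:E; simpl in *.
        -- apply (shift_track_same i (tl cs) Blank [] Ht'); auto.
        -- inversion Hf; subst.
           pose proof (shift_track_same i (tl cs) b st Ht' H4 ltac:(congruence)) as G.
           unfold letter_eqb in G; destruct (letter_eq_dec b Blank); congruence.
      * rewrite upd_other by auto. split; auto. intros [|j]; simpl.
        -- rewrite upd_other by auto. unfold h. rewrite (track_hd _ _ _ Ht). destruct (s i'); reflexivity.
        -- rewrite nth_shift_other by auto. rewrite Hnth. apply Ht.
    + rewrite run_add. rewrite run_1.
      erewrite step_at_tape; eauto; [|apply hd0_syms| |].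
      2:{ unfold delta; rewrite HP; reflexivity. } 2:{ specialize (Hpc _ HP); lia. }
      fold h. rewrite run_add, tl0_syms, Hrun. rewrite run_1.
      erewrite step_at_tape; eauto; [|reflexivity| |].
      2:{ unfold delta; rewrite HP; reflexivity. } 2:{ specialize (Hpc _ HP); lia. }
      reflexivity.
  - destruct (run_unshift P pc i HP (tl cs) (sym h true) []) as (k & Hk & Hrun).
    exists (1 + (k + 1)), (upd i (hd blank_cell (tl cs) i) h :: unshift i (tl cs)).
    assert (length (tl cs) <= length cs) by (destruct cs; simpl; lia).
    split; [lia|]. split; [pose proof (length_unshift i (tl cs)); simpl; lia|]. split.
    + intros i'. destruct (Hr i') as [Ht Hf]. destruct (idx_eq_dec i' i) as [->|ne].
      * rewrite upd_same. pose proof (track_tl _ _ _ Ht) as Ht'.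
        assert (Hf' : Forall (fun a => a <> Blank) (tl (s i))) by (destruct (s i); inversion Hf; auto).
        split; auto. pose proof (unshift_track_same i (tl cs) _ Ht' Hf') as G.
        intros [|j]; simpl.
        -- rewrite upd_same, (track_hd _ _ _ Ht'). destruct (tl (s i)); reflexivity.
        -- rewrite G. destruct (tl (s i)); [destruct j|]; reflexivity.
      * rewrite upd_other by auto. split; auto. intros [|j]; simpl.
        -- rewrite upd_other by auto. unfold h. rewrite (track_hd _ _ _ Ht). destruct (s i'); reflexivity.
        -- rewrite nth_unshift_other by auto. rewrite Hnth. apply Ht.
    + rewrite run_add. rewrite run_1.
      erewrite step_at_tape; eauto; [|apply hd0_syms| |].
      2:{ unfold delta; rewrite HP; reflexivity. } 2:{ specialize (Hpc _ HP); lia. }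
      fold h. rewrite run_add, tl0_syms, Hrun. rewrite run_1.
      erewrite step_at_tape; eauto; [|reflexivity| |].
      2:{ unfold delta; rewrite HP; reflexivity. } 2:{ specialize (Hpc _ HP); lia. }
      reflexivity.
  - exists 1, (h :: tl cs).
    assert (length (tl cs) <= length cs) by (destruct cs; simpl; lia).
    split; [lia|]. split; [simpl; lia|]. split.
    + intros i'; destruct (Hr i') as [Ht Hf]; split; auto. intros [|j]; simpl.
      * unfold h. rewrite (track_hd _ _ _ Ht). destruct (s' i'); reflexivity.
      * rewrite Hnth. apply Ht.
    + rewrite run_1. erewrite step_at_tape; [|exact (Hpc _ HP)|apply hd0_syms| |].
      2:{ unfold delta; rewrite HP, represents_hd with (s := s') by auto. reflexivity. }
      2:{ auto. }
      cbv iota beta. rewrite tl0_syms. reflexivity.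
Qed.

(** The tape never exceeds [length cs + 3 * t] cells and each instruction sweeps it at most once in
    each direction: this is the quadratic overhead. *)
Lemma ssteps_tm P t : forall pc s pc' s' cs, ssteps P t (pc, s) (pc', s') -> represents cs s ->
  exists k cs', k <= t * (2 * (length cs + 3 * t) + 6) /\ represents cs' s' /\
    run (tm_of P) k (at_tape pc Home [] (syms cs)) = at_tape pc' Home [] (syms cs').
Proof.
  induction t as [|t IH]; intros pc s pc' s' cs H Hr; inversion H; subst;
    try (exists 0, cs; split; [lia|split; [assumption|reflexivity]]).
  destruct c2 as [pc2 s2].
  destruct (sstep_tm _ _ _ _ _ _ H1 Hr) as (k1 & cs1 & Hk1 & Hl & Hr1 & Hrun1).
  destruct (IH _ _ _ _ _ H2 Hr1) as (k2 & cs2 & Hk2 & Hr2 & Hrun2).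
  exists (k1 + k2), cs2. split; [|split; auto; rewrite run_add, Hrun1; auto].
  assert (t * (2 * (length cs1 + 3 * t) + 6) <= t * (2 * (length cs + 3 * S t) + 6))
    by (apply Nat.mul_le_mono_l; lia). lia.
Qed.

Lemma run_halted M k c : halted M c = true -> run M k c = c.
Proof.
  intros H; induction k; simpl; auto. unfold step; rewrite H; auto.
Qed.

Definition input_store (w : list nat) : store :=
  fun i => match i with I0 => map letter_of_nat w | I1 => [] | I2 => [] | I3 => [] end.

Lemma represents_input w : Forall (fun a => 1 <= a <= 3) w ->
  exists cs, represents cs (input_store w) /\ syms cs = w /\ length cs = length w.
Proof.
  intros H. exists (map (fun a => upd I0 (letter_of_nat a) blank_cell) w).
  split; [|split; [|apply length_map]].
  - intros i. destruct i; simpl; split; auto.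
    + intros j. revert j. induction w as [|a w IH]; intros [|j]; simpl; auto.
      apply IH. inversion H; auto.
    + apply Forall_map. eapply Forall_impl; [|apply H].
      intros [|[|[|[|]]]] Ha; simpl; try discriminate; lia.
    + intros j; revert j; induction w; intros [|j]; simpl; auto; inversion H; auto.
      rewrite IHw by auto. destruct j; auto.
    + intros j; revert j; induction w; intros [|j]; simpl; auto; inversion H; auto.
      rewrite IHw by auto. destruct j; auto.
    + intros j; revert j; induction w; intros [|j]; simpl; auto; inversion H; auto.
      rewrite IHw by auto. destruct j; auto.
  - unfold syms. rewrite map_map. rewrite <- (map_id w) at 2. apply map_ext_in.
    intros a Ha. rewrite Forall_forall in H. specialize (H a Ha).
    destruct a as [|[|[|[|]]]]; try lia; reflexivity.
Qed.

Lemma ssteps_decides P w t (b : bool) s' (Q : Prop) T :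
  Forall (fun a => 1 <= a <= 3) w ->
  ssteps P t (0, input_store w) (if b then length P else length P + 1, s') ->
  (b = true <-> Q) -> t * (2 * (length w + 3 * t) + 6) <= T ->
  decides_within (tm_of P) w T Q.
Proof.
  intros Hw Hs HQ HT.
  destruct (represents_input w Hw) as (cs & Hr & Hcs & Hl).
  destruct (ssteps_tm _ _ _ _ _ _ _ Hs Hr) as (k & cs' & Hk & _ & Hrun).
  unfold decides_within.
  change (init_config (tm_of P) w) with (at_tape 0 Home [] w).
  replace T with (k + (T - k)) by lia. rewrite run_add, <- Hcs, Hrun.
  assert (Hh : halted (tm_of P) (at_tape (if b then length P else length P + 1) Home [] (syms cs')) = true).
  { unfold halted, at_tape, qstate. cbn [cf_state tm_accept tm_reject tm_of nat_of_phase].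
    rewrite Nat.add_0_r. destruct b; rewrite Nat.eqb_refl; auto using Bool.orb_true_r. }
  rewrite run_halted by exact Hh. split; [exact Hh|].
  rewrite <- HQ. unfold at_tape, qstate. cbn [cf_state tm_accept tm_of nat_of_phase].
  destruct b; split; intros; auto; try lia; discriminate.
Qed.

(** * Structured stack programs *)

Inductive com :=
  | CSkip
  | CPush (i : idx) (a : letter)
  | CPop (i : idx)
  | CSeq (c1 c2 : com)
  | CIf (i : idx) (a : letter) (c1 c2 : com)
  | CUntil (i : idx) (a : letter) (c : com).

(* The last argument is an upper bound on the number of executed instructions. *)
Inductive exec : com -> store -> store -> nat -> Prop :=
  | exec_skip s t : exec CSkip s s t
  | exec_push i a s t : a <> Blank -> 1 <= t -> exec (CPush i a) s (upd i (a :: s i) s) t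
  | exec_pop i s t : 1 <= t -> exec (CPop i) s (upd i (tl (s i)) s) t
  | exec_seq c1 c2 s1 s2 s3 t1 t2 t : exec c1 s1 s2 t1 -> exec c2 s2 s3 t2 ->
      t1 + t2 <= t -> exec (CSeq c1 c2) s1 s3 t
  | exec_if_yes i a c1 c2 s s' t1 t : top (s i) = a -> exec c1 s s' t1 -> t1 + 2 <= t ->
      exec (CIf i a c1 c2) s s' t
  | exec_if_no i a c1 c2 s s' t1 t : top (s i) <> a -> exec c2 s s' t1 -> t1 + 2 <= t ->
      exec (CIf i a c1 c2) s s' t
  | exec_until_stop i a c s t : top (s i) = a -> 1 <= t -> exec (CUntil i a c) s s t
  | exec_until_loop i a c s1 s2 s3 t1 t2 t : top (s1 i) <> a -> exec c s1 s2 t1 ->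
      exec (CUntil i a c) s2 s3 t2 -> t1 + t2 + 2 <= t -> exec (CUntil i a c) s1 s3 t.

Fixpoint csize (c : com) : nat :=
  match c with
  | CSkip => 0
  | CPush _ _ | CPop _ => 1
  | CSeq c1 c2 => csize c1 + csize c2
  | CIf _ _ c1 c2 => 2 + csize c1 + csize c2
  | CUntil _ _ c => 2 + csize c
  end.

Definition jump (pc : nat) : instr := ITest I0 Blank pc pc.

Fixpoint compile (c : com) (pc : nat) : list instr :=
  match c with
  | CSkip => []
  | CPush i a => [IPush i a]
  | CPop i => [IPop i]
  | CSeq c1 c2 => compile c1 pc ++ compile c2 (pc + csize c1)
  | CIf i a c1 c2 =>
      ITest i a (pc + 1) (pc + 2 + csize c1) :: compile c1 (pc + 1)
      ++ jump (pc + 2 + csize c1 + csize c2) :: compile c2 (pc + 2 + csize c1)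
  | CUntil i a c =>
      ITest i a (pc + 2 + csize c) (pc + 1) :: compile c (pc + 1) ++ [jump pc]
  end.

Lemma length_compile c : forall pc, length (compile c pc) = csize c.
Proof.
  induction c; intros pc; simpl; rewrite ?length_app; simpl; rewrite ?IHc1, ?IHc2, ?IHc; lia.
Qed.

Lemma nth_error_mid {A : Type} (l1 l2 : list A) x n : n = length l1 ->
  nth_error (l1 ++ x :: l2) n = Some x.
Proof. intros ->. rewrite nth_error_app2, Nat.sub_diag; auto. Qed.

Lemma ssteps_jump P pc pc' s : nth_error P pc = Some (jump pc') -> pc' < length P + 2 ->
  ssteps P 1 (pc, s) (pc', s).
Proof.
  intros H Hl. econstructor; [|apply ssteps_refl].
  eapply sstep_test; eauto. destruct (letter_eq_dec _ _); auto.
Qed.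

(** Jump addresses are absolute, so the code is considered behind an arbitrary prefix [P1], whose
    length is its start address, and in front of an arbitrary [P2]. *)
Lemma compile_correct c s s' t : exec c s s' t -> forall P1 P2,
  ssteps (P1 ++ compile c (length P1) ++ P2) t (length P1, s) (length P1 + csize c, s').
Proof.
  induction 1 as [s t | i a s t Ha Ht | i s t Ht | c1 c2 s1 s2 s3 t1 t2 t _ IH1 _ IH2 Ht
    | i a c1 c2 s s' t1 t Htop _ IH Ht | i a c1 c2 s s' t1 t Htop _ IH Ht
    | i a c s t Htop Ht | i a c s1 s2 s3 t1 t2 t Htop _ IH1 _ IH2 Ht ]; intros P1 P2; simpl csize.
  - rewrite Nat.add_0_r. constructor.
  - eapply ssteps_le; [|exact Ht]. rewrite Nat.add_1_r.
    econstructor; [|apply ssteps_refl]. apply sstep_push; auto. simpl. apply nth_error_mid; auto.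
  - eapply ssteps_le; [|exact Ht]. rewrite Nat.add_1_r.
    econstructor; [|apply ssteps_refl]. apply sstep_pop; auto. simpl. apply nth_error_mid; auto.
  - simpl compile. rewrite <- !app_assoc.
    eapply ssteps_trans; [apply IH1| |exact Ht].
    specialize (IH2 (P1 ++ compile c1 (length P1)) P2).
    rewrite length_app, length_compile, <- app_assoc in IH2. rewrite Nat.add_assoc. exact IH2.
  - simpl compile. set (cc1 := compile c1 _). set (cc2 := compile c2 _). set (j := jump _).
    set (tst := ITest _ _ _ _).
    set (P := P1 ++ _).
    assert (HP1 : P = (P1 ++ [tst]) ++ cc1 ++ (j :: cc2 ++ P2))
      by (unfold P; rewrite <- !app_assoc; simpl; rewrite <- !app_assoc; reflexivity).
    assert (HP2 : P = (P1 ++ tst :: cc1) ++ j :: cc2 ++ P2)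
      by (rewrite HP1, <- !app_assoc; reflexivity).
    assert (Hlen : length P = length P1 + 2 + csize c1 + csize c2 + length P2).
    { rewrite HP2, !length_app; simpl; rewrite length_app. unfold cc1, cc2. rewrite !length_compile. lia. }
    specialize (IH (P1 ++ [tst]) (j :: cc2 ++ P2)).
    rewrite length_app in IH. simpl length in IH. fold cc1 in IH. rewrite <- HP1 in IH.
    eapply ssteps_trans with (t1 := 1) (t2 := t1 + 1); [| |lia].
    + econstructor; [|apply ssteps_refl]. eapply sstep_test.
      * unfold P. apply nth_error_mid; auto.
      * destruct (letter_eq_dec (top (s i)) a); [reflexivity|contradiction].
      * lia.
    + eapply ssteps_trans; [exact IH| |apply le_n].
      replace (length P1 + S (S (csize c1 + csize c2))) with (length P1 + 2 + csize c1 + csize c2) by lia.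
      apply ssteps_jump; [|lia].
      rewrite HP2. apply nth_error_mid. rewrite length_app; simpl. unfold cc1; rewrite length_compile; lia.
  - simpl compile. set (cc1 := compile c1 _). set (cc2 := compile c2 _). set (j := jump _).
    set (tst := ITest _ _ _ _).
    set (P := P1 ++ _).
    assert (HP1 : P = (P1 ++ tst :: cc1 ++ [j]) ++ cc2 ++ P2)
      by (unfold P; simpl; rewrite <- !app_assoc; simpl; rewrite <- !app_assoc; reflexivity).
    assert (Hlen : length P = length P1 + 2 + csize c1 + csize c2 + length P2).
    { rewrite HP1, !length_app; simpl; rewrite !length_app. unfold cc1, cc2.
      rewrite !length_compile. simpl; lia. }
    specialize (IH (P1 ++ tst :: cc1 ++ [j]) P2).
    replace (length (P1 ++ tst :: cc1 ++ [j])) with (length P1 + 2 + csize c1) in IH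
      by (rewrite length_app; simpl; rewrite length_app; unfold cc1; rewrite length_compile; simpl; lia).
    fold cc2 in IH. rewrite <- HP1 in IH.
    eapply ssteps_trans with (t1 := 1) (t2 := t1); [| |lia].
    + econstructor; [|apply ssteps_refl]. eapply sstep_test.
      * unfold P. apply nth_error_mid; auto.
      * destruct (letter_eq_dec (top (s i)) a); [contradiction|reflexivity].
      * lia.
    + replace (length P1 + S (S (csize c1 + csize c2))) with (length P1 + 2 + csize c1 + csize c2) by lia.
      exact IH.
  - eapply ssteps_le; [|exact Ht]. econstructor; [|apply ssteps_refl].
    simpl compile. eapply sstep_test.
    + apply nth_error_mid; auto.
    + destruct (letter_eq_dec (top (s i)) a); [|contradiction]. lia.
    + rewrite !length_app; simpl. rewrite !length_app, length_compile. simpl. lia.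
  - specialize (IH2 P1 P2). simpl compile in *. simpl csize in IH2.
    set (cc := compile c _) in *. set (j := jump _) in *.
    set (tst := ITest _ _ _ _) in *. set (P := P1 ++ _) in *.
    assert (HP1 : P = (P1 ++ [tst]) ++ cc ++ (j :: P2))
      by (unfold P; rewrite <- !app_assoc; simpl; rewrite <- !app_assoc; reflexivity).
    assert (HP2 : P = (P1 ++ tst :: cc) ++ j :: P2)
      by (rewrite HP1, <- !app_assoc; reflexivity).
    assert (Hlen : length P = length P1 + 2 + csize c + length P2).
    { rewrite HP2, !length_app; simpl. unfold cc. rewrite !length_compile. lia. }
    specialize (IH1 (P1 ++ [tst]) (j :: P2)).
    rewrite length_app in IH1. simpl length in IH1. fold cc in IH1. rewrite <- HP1 in IH1.
    eapply ssteps_trans with (t1 := 1) (t2 := t1 + (1 + t2)); [| |lia].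
    + econstructor; [|apply ssteps_refl]. eapply sstep_test.
      * unfold P. apply nth_error_mid; auto.
      * destruct (letter_eq_dec (top (s1 i)) a); [contradiction|reflexivity].
      * lia.
    + eapply ssteps_trans; [exact IH1| |apply le_n].
      eapply ssteps_trans; [|exact IH2|apply le_n].
      apply ssteps_jump; [|lia].
      rewrite HP2. apply nth_error_mid. rewrite length_app; simpl. unfold cc; rewrite length_compile; lia.
Qed.

(** * Binary trees on the stacks *)

Inductive tree := TNil | TCons (a b : tree).

Fixpoint size (d : tree) : nat :=
  match d with TNil => 1 | TCons a b => 1 + size a + size b end.

(** Prefix notation is self-delimiting, so trees lie on a stack without separators and the topmost
    one can be read off by counting. *)
Fixpoint word (d : tree) : list letter :=
  match d with TNil => [LNil] | TCons a b => LCons :: word a ++ word b end.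

Lemma length_word d : length (word d) = size d.
Proof. induction d; simpl; rewrite ?length_app; lia. Qed.

Lemma size_pos d : 1 <= size d.
Proof. destruct d; simpl; lia. Qed.

Definition stacks (a b c d : list letter) : store :=
  fun i => match i with I0 => a | I1 => b | I2 => c | I3 => d end.

Ltac eq_store := apply functional_extensionality; intros []; reflexivity.

Lemma exec_push_stacks i x a b c d a' b' c' d' :
  x <> Blank -> upd i (x :: stacks a b c d i) (stacks a b c d) = stacks a' b' c' d' ->
  exec (CPush i x) (stacks a b c d) (stacks a' b' c' d') 1.
Proof. intros Hx <-. constructor; auto. Qed.

Lemma exec_pop_stacks i a b c d a' b' c' d' :
  upd i (tl (stacks a b c d i)) (stacks a b c d) = stacks a' b' c' d' ->
  exec (CPop i) (stacks a b c d) (stacks a' b' c' d') 1.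
Proof. intros <-. constructor; auto. Qed.

Ltac push := apply exec_push_stacks; [discriminate | eq_store].
Ltac pop := apply exec_pop_stacks; eq_store.

Lemma upd_upd {A : Type} i (v v' : A) f : upd i v (upd i v' f) = upd i v f.
Proof.
  apply functional_extensionality; intros j; unfold upd; destruct (idx_eq_dec j i); auto.
Qed.

Lemma upd_comm {A : Type} i j (v v' : A) f : i <> j -> upd i v (upd j v' f) = upd j v' (upd i v f).
Proof.
  intros H; apply functional_extensionality; intros k; unfold upd.
  destruct (idx_eq_dec k i), (idx_eq_dec k j); congruence.
Qed.

Lemma upd_id {A : Type} i (f : idx -> A) : upd i (f i) f = f.
Proof.
  apply functional_extensionality; intros j; unfold upd; destruct (idx_eq_dec j i); congruence.
Qed.

Definition CPour (i j : idx) : com :=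
  CUntil i Blank
    (CIf i LCons (CSeq (CPop i) (CPush j LCons))
      (CIf i LNil (CSeq (CPop i) (CPush j LNil)) (CSeq (CPop i) (CPush j LSep)))).

Lemma exec_pour i j : i <> j -> forall l s, s i = l -> Forall (fun a => a <> Blank) l ->
  exec (CPour i j) s (upd j (rev l ++ s j) (upd i [] s)) (8 * length l + 1).
Proof.
  intros Hij; induction l as [|a l IH]; intros s Hs Hf.
  - simpl. rewrite upd_comm, upd_id, <- Hs, upd_id by auto.
    apply exec_until_stop; [rewrite Hs; reflexivity|lia].
  - inversion Hf as [|? ? Ha Hl]; subst.
    set (s2 := upd j (a :: s j) (upd i l s)).
    replace (upd j (rev (a :: l) ++ s j) (upd i [] s))
      with (upd j (rev l ++ s2 j) (upd i [] s2)).
    2:{ unfold s2. rewrite upd_same. rewrite (upd_comm i j), !upd_upd by auto.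
        simpl. rewrite <- app_assoc. reflexivity. }
    assert (Hstep : exec (CSeq (CPop i) (CPush j a)) s s2 2).
    { eapply exec_seq with (t1 := 1) (t2 := 1); [constructor; lia| |lia].
      unfold s2. rewrite Hs. simpl tl. rewrite <- (upd_other i j l s) at 1 by auto.
      constructor; auto. }
    eapply exec_until_loop with (t1 := 6) (t2 := 8 * length l + 1);
      [rewrite Hs; exact Ha | | apply IH; [|exact Hl] | simpl; lia].
    2:{ unfold s2. rewrite upd_other, upd_same by auto. reflexivity. }
    destruct a; [congruence| | |].
    + eapply exec_if_no with (t1 := 4); [rewrite Hs; discriminate| |lia].
      eapply exec_if_yes; [rewrite Hs; reflexivity|exact Hstep|lia].
    + eapply exec_if_yes; [rewrite Hs; reflexivity|exact Hstep|lia].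
    + eapply exec_if_no with (t1 := 4); [rewrite Hs; discriminate| |lia].
      eapply exec_if_no; [rewrite Hs; discriminate|exact Hstep|lia].
Qed.

(* The unary counter on [I3] is the number of subtrees still to be read. *)
Definition CMoveLoop : com :=
  CUntil I3 Blank
    (CIf I0 LCons
      (CSeq (CPop I0) (CSeq (CPush I1 LCons) (CPush I3 LNil)))
      (CSeq (CPop I0) (CSeq (CPush I1 LNil) (CPop I3)))).
Definition CMove : com := CSeq (CPush I3 LNil) CMoveLoop.

(** The remaining run is a hypothesis, so that for a cons the two induction hypotheses chain inside
    one and the same loop. *)
Lemma exec_move_loop d : forall a b c k s t,
  exec CMoveLoop (stacks a (rev (word d) ++ b) c k) s t ->
  exec CMoveLoop (stacks (word d ++ a) b c (LNil :: k)) s (7 * size d + t).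
Proof.
  induction d as [|d1 IH1 d2 IH2]; intros a b c k s t H.
  - eapply exec_until_loop with (t1 := 5); [discriminate| |exact H|simpl; lia].
    eapply exec_if_no with (t1 := 3); [discriminate| |lia].
    eapply exec_seq with (t1 := 1) (t2 := 2) (s2 := stacks a b c (LNil :: k)); [pop| |lia].
    eapply exec_seq with (t1 := 1) (t2 := 1) (s2 := stacks a (LNil :: b) c (LNil :: k));
      [push|pop|lia].
  - eapply exec_until_loop with (t1 := 5) (t2 := 7 * size d1 + (7 * size d2 + t))
      (s2 := stacks (word d1 ++ word d2 ++ a) (LCons :: b) c (LNil :: LNil :: k));
      [discriminate| | |simpl; lia].
    + eapply exec_if_yes with (t1 := 3); [reflexivity| |lia].
      eapply exec_seq with (t1 := 1) (t2 := 2)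
        (s2 := stacks (word d1 ++ word d2 ++ a) b c (LNil :: k)); [| |lia].
      { apply exec_pop_stacks. simpl. rewrite <- app_assoc. eq_store. }
      eapply exec_seq with (t1 := 1) (t2 := 1)
        (s2 := stacks (word d1 ++ word d2 ++ a) (LCons :: b) c (LNil :: k));
        [push|push|lia].
    + apply IH1, IH2.
      simpl in H. rewrite rev_app_distr, <- !app_assoc in H. exact H.
Qed.

Lemma exec_move d a b c :
  exec CMove (stacks (word d ++ a) b c []) (stacks a (rev (word d) ++ b) c []) (7 * size d + 2).
Proof.
  eapply exec_seq with (t1 := 1) (t2 := 7 * size d + 1)
    (s2 := stacks (word d ++ a) b c [LNil]); [push| |lia].
  apply exec_move_loop. apply exec_until_stop; auto.
Qed.

Lemma word_nonblank d : Forall (fun a => a <> Blank) (word d).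
Proof.
  induction d; simpl; repeat constructor; try discriminate. apply Forall_app; auto.
Qed.

Ltac nonblank := rewrite ?app_nil_r; repeat (apply Forall_app; split);
  try apply Forall_rev; try apply word_nonblank; auto.

Lemma exec_pour_stacks i j a b c d a' b' c' d' n : i <> j ->
  Forall (fun x => x <> Blank) (stacks a b c d i) -> length (stacks a b c d i) = n ->
  upd j (rev (stacks a b c d i) ++ stacks a b c d j) (upd i [] (stacks a b c d))
    = stacks a' b' c' d' ->
  exec (CPour i j) (stacks a b c d) (stacks a' b' c' d') (8 * n + 1).
Proof. intros Hij Hf <- <-. apply exec_pour; auto. Qed.

Lemma stacks_ext a b c d a' b' c' d' : a = a' -> b = b' -> c = c' -> d = d' ->
  stacks a b c d = stacks a' b' c' d'.
Proof. congruence. Qed.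

Lemma stacks_eta s : s = stacks (s I0) (s I1) (s I2) (s I3).
Proof. eq_store. Qed.

Ltac eq_stacks := match goal with |- ?s = _ => rewrite (stacks_eta s) end; apply stacks_ext; simpl;
  unfold upd; simpl;
  rewrite ?rev_app_distr, ?rev_involutive, ?app_nil_r, ?app_assoc; reflexivity.

(** [x] waits on [I2] while [y] is read, then goes above it on [I1]; the final reversal onto [I0]
    puts [y] on top. *)
Definition CSwap : com :=
  CSeq CMove (CSeq (CPour I1 I2) (CSeq CMove (CSeq (CPour I2 I1) (CPour I1 I0)))).

Lemma exec_swap x y a :
  exec CSwap (stacks (word x ++ word y ++ a) [] [] []) (stacks (word y ++ word x ++ a) [] [] [])
    (40 * (size x + size y)).
Proof.
  pose proof (size_pos x); pose proof (size_pos y).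
  eapply exec_seq; [apply exec_move| |].
  eapply exec_seq.
  { apply exec_pour_stacks with (n := size x) (a' := word y ++ a) (b' := []) (c' := word x) (d' := []);
      [discriminate|nonblank| |eq_stacks].
    simpl. rewrite app_nil_r, length_rev, length_word; auto. }
  eapply exec_seq; [apply exec_move| |].
  eapply exec_seq.
  { apply exec_pour_stacks with (n := size x) (a' := a) (b' := rev (word x) ++ rev (word y))
      (c' := []) (d' := []); [discriminate|nonblank|apply length_word|eq_stacks]. }
  apply exec_pour_stacks with (n := size x + size y);
    [discriminate|simpl; nonblank| |eq_stacks].
  simpl. rewrite length_app, !length_rev, !length_word; auto.
  all: try apply le_n. lia.
Qed.

Definition CDrop : com := CSeq CMove (CUntil I1 Blank (CPop I1)).

Lemma exec_clear l : forall a c d, Forall (fun x => x <> Blank) l ->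
  exec (CUntil I1 Blank (CPop I1)) (stacks a l c d) (stacks a [] c d) (3 * length l + 1).
Proof.
  induction l as [|x l IH]; intros a c d Hf.
  - apply exec_until_stop; auto.
  - inversion Hf; subst. eapply exec_until_loop with (t1 := 1) (s2 := stacks a l c d);
      [auto|pop|apply IH; auto|simpl; lia].
Qed.

Lemma exec_drop x a :
  exec CDrop (stacks (word x ++ a) [] [] []) (stacks a [] [] []) (20 * size x).
Proof.
  pose proof (size_pos x).
  eapply exec_seq; [apply exec_move|apply exec_clear; nonblank|].
  rewrite app_nil_r, length_rev, length_word. lia.
Qed.

Definition CCopyBack : com :=
  CUntil I1 Blank
    (CIf I1 LCons (CSeq (CPop I1) (CSeq (CPush I0 LCons) (CPush I2 LCons)))
      (CSeq (CPop I1) (CSeq (CPush I0 LNil) (CPush I2 LNil)))).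

Lemma exec_copy_back l : forall a c d, Forall (fun x => x = LCons \/ x = LNil) l ->
  exec CCopyBack (stacks a l c d) (stacks (rev l ++ a) [] (rev l ++ c) d) (7 * length l + 1).
Proof.
  induction l as [|x l IH]; intros a c d Hf.
  - apply exec_until_stop; auto.
  - inversion Hf as [|? ? Hx Hl]; subst.
    assert (exec (CSeq (CPop I1) (CSeq (CPush I0 x) (CPush I2 x))) (stacks a (x :: l) c d)
      (stacks (x :: a) l (x :: c) d) 3).
    { eapply exec_seq with (t1 := 1) (t2 := 2) (s2 := stacks a l c d); [pop| |lia].
      eapply exec_seq with (t1 := 1) (t2 := 1) (s2 := stacks (x :: a) l c d); [| |lia];
      destruct Hx; subst; push. }
    eapply exec_until_loop with (t1 := 5) (t2 := 7 * length l + 1) (s2 := stacks (x :: a) l (x :: c) d);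
      [simpl; destruct Hx; congruence | | |simpl; lia].
    + destruct Hx; subst; [eapply exec_if_yes|eapply exec_if_no]; eauto; discriminate.
    + simpl. rewrite <- !app_assoc. simpl. apply IH; auto.
Qed.

Lemma word_letters d : Forall (fun x => x = LCons \/ x = LNil) (word d).
Proof. induction d; simpl; constructor; auto. apply Forall_app; auto. Qed.

Definition CDup : com := CSeq CMove (CSeq CCopyBack (CSeq (CPour I2 I1) (CPour I1 I0))).

Lemma exec_dup x a :
  exec CDup (stacks (word x ++ a) [] [] []) (stacks (word x ++ word x ++ a) [] [] []) (40 * size x).
Proof.
  pose proof (size_pos x).
  eapply exec_seq; [apply exec_move| |].
  eapply exec_seq; [apply exec_copy_back; rewrite app_nil_r; apply Forall_rev, word_letters| |].
  rewrite app_nil_r, rev_involutive, app_nil_r.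
  eapply exec_seq.
  { apply exec_pour_stacks with (n := size x) (a' := word x ++ a) (b' := rev (word x)) (c' := []) (d' := []);
      [discriminate|nonblank|apply length_word|eq_stacks]. }
  apply exec_pour_stacks with (n := size x); [discriminate|simpl; nonblank| |eq_stacks].
  simpl. rewrite length_rev, length_word; auto.
  all: try apply le_n. rewrite app_nil_r, length_rev, length_word. lia.
Qed.

(** * A combinator language on trees *)

Inductive prog :=
  | PId | PHd | PTl
  | PConst (d : tree)
  | PComp (p q : prog)
  | PPair (p q : prog)
  | PIf (p q : prog)
  | PWhile (p : prog).

(* The last argument bounds the running time on the stacks up to a constant factor. *)
Inductive eval : prog -> tree -> tree -> nat -> Prop :=
  | eval_id x t : eval PId x x t
  | eval_hd a b t : size a + size b <= t -> eval PHd (TCons a b) a t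
  | eval_tl a b t : size a <= t -> eval PTl (TCons a b) b t
  | eval_const d x t : size d + size x <= t -> eval (PConst d) x d t
  | eval_comp p q x y z t1 t2 t : eval p x y t1 -> eval q y z t2 -> t1 + t2 <= t ->
      eval (PComp p q) x z t
  | eval_pair p q x y z t1 t2 t : eval p x y t1 -> eval q x z t2 ->
      t1 + t2 + 2 * size x + size z <= t -> eval (PPair p q) x (TCons y z) t
  | eval_if_true p q a b x y t1 t : eval p x y t1 -> t1 + size a + size b + 2 <= t ->
      eval (PIf p q) (TCons (TCons a b) x) y t
  | eval_if_false p q x y t1 t : eval q x y t1 -> t1 + 2 <= t ->
      eval (PIf p q) (TCons TNil x) y t
  | eval_while_stop p x t : 1 <= t -> eval (PWhile p) (TCons TNil x) (TCons TNil x) t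
  | eval_while_loop p a b x y z t1 t2 t : eval p (TCons (TCons a b) x) y t1 ->
      eval (PWhile p) y z t2 -> t1 + t2 + 1 <= t ->
      eval (PWhile p) (TCons (TCons a b) x) z t.

Lemma eval_le p x y t t' : eval p x y t -> t <= t' -> eval p x y t'.
Proof.
  intros H Ht; destruct H;
    [ constructor | constructor; lia | constructor; lia | constructor; lia
    | eapply eval_comp; eauto; lia | eapply eval_pair; eauto; lia
    | eapply eval_if_true; eauto; lia | eapply eval_if_false; eauto; lia
    | constructor; lia | eapply eval_while_loop; eauto; lia ].
Qed.

(** Time bounds the growth of the output, which makes polynomially timed functions composable. *)
Lemma eval_size p x y t : eval p x y t -> size y <= size x + t.
Proof.
  induction 1; simpl in *; try lia. pose proof (size_pos x); lia.
Qed.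

Definition CPushes (l : list letter) : com := fold_right (fun a c => CSeq c (CPush I0 a)) CSkip l.

Lemma exec_pushes l a b : Forall (fun x => x <> Blank) l ->
  exec (CPushes l) (stacks a b [] []) (stacks (l ++ a) b [] []) (length l).
Proof.
  induction l as [|x l IH]; intros Hf; [constructor|]. inversion Hf; subst.
  eapply exec_seq with (t2 := 1); [apply IH; auto| |simpl; lia].
  apply exec_push_stacks; auto. eq_store.
Qed.

(** In a pair [q] is computed first, so that the result of [p] ends on top and one [LCons] completes
    the pair. A loop runs with the leading [LCons] of its state removed, which exposes the first
    letter of the condition to the test. *)
Fixpoint com_of (p : prog) : com :=
  match p with
  | PId => CSkip
  | PHd => CSeq (CPop I0) (CSeq CSwap CDrop)
  | PTl => CSeq (CPop I0) CDrop
  | PConst d => CSeq CDrop (CPushes (word d))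
  | PComp p q => CSeq (com_of p) (com_of q)
  | PPair p q =>
      CSeq CDup (CSeq (com_of q) (CSeq CSwap (CSeq (com_of p) (CPush I0 LCons))))
  | PIf p q =>
      CSeq (CPop I0) (CIf I0 LNil (CSeq CDrop (com_of q)) (CSeq CDrop (com_of p)))
  | PWhile p =>
      CSeq (CPop I0)
        (CSeq (CUntil I0 LNil (CSeq (CPush I0 LCons) (CSeq (com_of p) (CPop I0))))
          (CPush I0 LCons))
  end.

Lemma exec_pop_cons x y a :
  exec (CPop I0) (stacks (word (TCons x y) ++ a) [] [] []) (stacks (word x ++ word y ++ a) [] [] []) 1.
Proof. apply exec_pop_stacks. simpl. rewrite <- app_assoc. eq_store. Qed.

Lemma exec_push_cons x y a :
  exec (CPush I0 LCons) (stacks (word x ++ word y ++ a) [] [] [])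
    (stacks (word (TCons x y) ++ a) [] [] []) 1.
Proof. apply exec_push_stacks; [discriminate|]. simpl. rewrite <- app_assoc. eq_store. Qed.

Lemma eval_exec p x y t : eval p x y t -> forall a,
  exec (com_of p) (stacks (word x ++ a) [] [] []) (stacks (word y ++ a) [] [] []) (100 * t).
Proof.
  intros H; induction H as [ | b c t Ht | b c t Ht | d x t Ht
    | p q x y z t1 t2 t _ IH1 _ IH2 Ht | p q x y z t1 t2 t Hp IH1 Hq IH2 Ht
    | p q b c x y t1 t _ IH Ht | p q x y t1 t _ IH Ht | p x t Ht
    | p b c x y z t1 t2 t Hp IH1 Hl IH2 Ht ]; intros s; simpl com_of.
  - constructor.
  - pose proof (size_pos b); pose proof (size_pos c).
    eapply exec_seq; [apply exec_pop_cons| |].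
    eapply exec_seq; [apply exec_swap|apply exec_drop|apply le_n]. lia.
  - pose proof (size_pos b).
    eapply exec_seq; [apply exec_pop_cons|apply exec_drop|]. lia.
  - pose proof (size_pos x).
    eapply exec_seq; [apply exec_drop|apply exec_pushes, word_nonblank|].
    rewrite length_word. lia.
  - eapply exec_seq; [apply IH1|apply IH2|lia].
  - pose proof (size_pos x).
    eapply exec_seq; [apply exec_dup| |].
    eapply exec_seq; [apply IH2| |].
    eapply exec_seq; [apply exec_swap| |].
    eapply exec_seq; [apply IH1|apply exec_push_cons|].
    all: try apply le_n. lia.
  - eapply exec_seq; [apply exec_pop_cons| |].
    eapply exec_if_no; [discriminate| |].
    eapply exec_seq; [apply exec_drop|apply IH|].
    all: try apply le_n. simpl size. lia.
  - eapply exec_seq; [apply exec_pop_cons| |].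
    eapply exec_if_yes; [reflexivity| |].
    eapply exec_seq; [apply exec_drop|apply IH|].
    all: try apply le_n. simpl size. lia.
  - eapply exec_seq; [apply exec_pop_cons| |].
    eapply exec_seq; [apply exec_until_stop with (t := 1); auto|apply exec_push_cons|].
    all: try apply le_n. lia.
  (* The hypothesis concerns a whole loop command. Inverting it exposes the inner [CUntil], and its
     initial pop becomes the closing pop of the present iteration. *)
  - specialize (IH2 s). simpl com_of in IH2.
    inversion IH2 as [| | |? ? ? s2 ? ta tb ? Hpop Hrest Hle| | | |]; subst.
    inversion Hrest as [| | |? ? ? s3 ? tc td ? Huntil Hpush Hle'| | | |]; subst.
    eapply exec_seq with (t1 := 1) (t2 := 100 * t1 + 100 * t2 + 10); [apply exec_pop_cons| |lia].
    eapply exec_seq with (t2 := td) (t1 := 100 * t1 + ta + tc + 3); [|exact Hpush|lia].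
    eapply exec_until_loop with (t1 := 100 * t1 + ta + 1); [discriminate| |exact Huntil|lia].
    eapply exec_seq with (t1 := 1); [apply exec_push_cons| |apply Nat.eq_le_incl; rewrite Nat.add_comm; reflexivity].
    eapply exec_seq; [apply IH1|exact Hpop|lia].
Qed.

(** * Deciders given by tree programs *)

Definition tree_of_bool (b : bool) : tree := if b then TCons TNil TNil else TNil.

(* Input symbols 1, 2, 3 become the pairs (separator?, bit). *)
Definition symbol (a : nat) : bool * bool :=
  match a with 3 => (true, false) | 2 => (false, true) | _ => (false, false) end.
Definition tree_of_symbol (s : bool * bool) : tree :=
  TCons (tree_of_bool (fst s)) (tree_of_bool (snd s)).
Fixpoint tree_of_symbols (l : list (bool * bool)) : tree :=
  match l with [] => TNil | s :: l' => TCons (tree_of_symbol s) (tree_of_symbols l') end.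

(** A list tree grows at its front, so the input is first reversed onto [I1]; pushing [LCons] and
    the word of a symbol is then a cons. *)
Definition CParse : com :=
  CSeq (CPour I0 I1)
    (CSeq (CPush I0 LNil)
      (CUntil I1 Blank
        (CIf I1 LNil
          (CSeq (CPop I1) (CPushes (LCons :: word (tree_of_symbol (symbol 1)))))
          (CIf I1 LCons
            (CSeq (CPop I1) (CPushes (LCons :: word (tree_of_symbol (symbol 2)))))
            (CSeq (CPop I1) (CPushes (LCons :: word (tree_of_symbol (symbol 3))))))))).

Lemma exec_parse w : Forall (fun a => 1 <= a <= 3) w ->
  exec CParse (input_store w) (stacks (word (tree_of_symbols (map symbol w))) [] [] [])
    (30 * length w + 3).
Proof.
  intros Hw.
  assert (Hloop : forall u l, Forall (fun a => 1 <= a <= 3) u ->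
    exec (CUntil I1 Blank
        (CIf I1 LNil
          (CSeq (CPop I1) (CPushes (LCons :: word (tree_of_symbol (symbol 1)))))
          (CIf I1 LCons
            (CSeq (CPop I1) (CPushes (LCons :: word (tree_of_symbol (symbol 2)))))
            (CSeq (CPop I1) (CPushes (LCons :: word (tree_of_symbol (symbol 3))))))))
      (stacks (word (tree_of_symbols l)) (map letter_of_nat u) [] [])
      (stacks (word (tree_of_symbols (map symbol (rev u) ++ l))) [] [] []) (20 * length u + 1)).
  { induction u as [|x u IH]; intros l Hu; [apply exec_until_stop; auto|].
    inversion Hu as [|? ? Hx Hu']; subst.
    eapply exec_until_loop with (t1 := 12) (t2 := 20 * length u + 1)
      (s2 := stacks (word (tree_of_symbols (symbol x :: l))) (map letter_of_nat u) [] []);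
      [destruct x as [|[|[|[|]]]]; try lia; discriminate| | |simpl; lia].
    - assert (exec (CSeq (CPop I1) (CPushes (LCons :: word (tree_of_symbol (symbol x)))))
        (stacks (word (tree_of_symbols l)) (map letter_of_nat (x :: u)) [] [])
        (stacks (word (tree_of_symbols (symbol x :: l))) (map letter_of_nat u) [] []) 8).
      { eapply exec_seq with (t1 := 1);
          [apply exec_pop_stacks with (a' := word (tree_of_symbols l)) (b' := map letter_of_nat u) (c' := []) (d' := []); eq_store| |].
        - apply exec_pushes. constructor; [discriminate|apply word_nonblank].
        - cbn [length]. rewrite length_word. destruct x as [|[|[|[|]]]]; simpl; lia. }
      destruct x as [|[|[|[|]]]]; try lia.
      + eapply exec_if_yes; [reflexivity|eassumption|lia].
      + eapply exec_if_no with (t1 := 10); [discriminate| |lia].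
        eapply exec_if_yes; [reflexivity|eassumption|lia].
      + eapply exec_if_no with (t1 := 10); [discriminate| |lia].
        eapply exec_if_no; [discriminate|eassumption|lia].
    - simpl rev. rewrite map_app, <- app_assoc. apply IH; auto. }
  assert (Hnb : Forall (fun a => a <> Blank) (map letter_of_nat w)).
  { apply Forall_map. eapply Forall_impl; [|exact Hw].
    intros [|[|[|[|]]]] Ha; simpl; try discriminate; lia. }
  change (input_store w) with (stacks (map letter_of_nat w) [] [] []).
  eapply exec_seq with (t1 := 8 * length w + 1) (t2 := 20 * length w + 2).
  { eapply exec_pour_stacks with (a' := []) (b' := map letter_of_nat (rev w)) (c' := []) (d' := []);
      [discriminate|exact Hnb|apply length_map|].
    rewrite map_rev. eq_stacks. }
  { eapply exec_seq with (t1 := 1) (t2 := 20 * length w + 1)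
      (s2 := stacks (word (tree_of_symbols [])) (map letter_of_nat (rev w)) [] []); [push| |lia].
    specialize (Hloop (rev w) [] (Forall_rev Hw)).
    rewrite rev_involutive, app_nil_r, length_rev in Hloop. exact Hloop. }
  lia.
Qed.

(** The last instruction has address [length P], so its targets are the accepting and the rejecting
    exit of the whole program. *)
Definition decider (p : prog) : list instr :=
  let P := compile (CSeq CParse (com_of p)) 0 in
  P ++ [ITest I0 LCons (S (length P)) (S (length P) + 1)].

Lemma decider_decides p w t (b : bool) (Q : Prop) T :
  Forall (fun a => 1 <= a <= 3) w ->
  eval p (tree_of_symbols (map symbol w)) (tree_of_bool b) t -> (b = true <-> Q) ->
  (300 * (length w + t + 1)) ^ 2 <= T ->
  decides_within (tm_of (decider p)) w T Q.
Proof.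
  intros Hw Hp HQ HT.
  pose proof (eval_exec _ _ _ _ Hp []) as He. rewrite !app_nil_r in He.
  assert (Hall : exec (CSeq CParse (com_of p)) (input_store w)
    (stacks (word (tree_of_bool b)) [] [] []) (30 * length w + 3 + 100 * t))
    by (eapply exec_seq; [apply exec_parse; auto|exact He|lia]).
  set (c := CSeq CParse (com_of p)) in *.
  pose proof (compile_correct _ _ _ _ Hall [] [ITest I0 LCons (S (csize c)) (S (csize c) + 1)]) as Hc.
  simpl app in Hc. simpl length in Hc. rewrite Nat.add_0_l in Hc.
  eapply ssteps_decides with (t := 30 * length w + 3 + 100 * t + 1)
    (s' := stacks (word (tree_of_bool b)) [] [] []); eauto.
  - unfold decider. fold c. cbv zeta. rewrite length_compile.
    eapply ssteps_trans; [exact Hc| |apply le_n].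
    econstructor; [|apply ssteps_refl].
    eapply sstep_test.
    + apply nth_error_mid. symmetry; apply length_compile.
    + rewrite length_app, length_compile. simpl length.
      destruct b; simpl; lia.
    + rewrite length_app, length_compile. simpl length. destruct b; lia.
  - eapply Nat.le_trans; [|exact HT]. simpl Nat.pow. nia.
Qed.

(** * Polynomial domination *)

(** The base is at least 2, so a single exponent absorbs constants, sums and products. *)
Definition dom {A : Type} (f g : A -> nat) : Prop := exists c, forall a, f a <= (g a + 2) ^ c.

Lemma le_pow_add2 x n : n <= (x + 2) ^ n.
Proof.
  apply Nat.le_trans with (2 ^ n); [|apply Nat.pow_le_mono_l; lia].
  apply Nat.lt_le_incl, Nat.pow_gt_lin_r; lia.
Qed.

Lemma pow_add2_mono x c d : c <= d -> (x + 2) ^ c <= (x + 2) ^ d.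
Proof. intros; apply Nat.pow_le_mono_r; lia. Qed.

Lemma pow_add2_sum x c d : (x + 2) ^ c + (x + 2) ^ d <= (x + 2) ^ S (c + d).
Proof.
  rewrite Nat.pow_succ_r'.
  pose proof (pow_add2_mono x c (c + d) ltac:(lia)).
  pose proof (pow_add2_mono x d (c + d) ltac:(lia)). nia.
Qed.

Lemma dom_const {A : Type} n (g : A -> nat) : dom (fun _ => n) g.
Proof. exists n; intros; apply le_pow_add2. Qed.

Lemma dom_refl {A : Type} (g : A -> nat) : dom g g.
Proof. exists 1; intros; rewrite Nat.pow_1_r; lia. Qed.

Lemma dom_le {A : Type} (f f' g : A -> nat) : (forall a, f a <= f' a) -> dom f' g -> dom f g.
Proof. intros H [c Hc]; exists c; intros a. specialize (H a); specialize (Hc a); lia. Qed.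

Lemma dom_add {A : Type} (f f' g : A -> nat) : dom f g -> dom f' g -> dom (fun a => f a + f' a) g.
Proof.
  intros [c Hc] [d Hd]; exists (S (c + d)); intros a.
  pose proof (pow_add2_sum (g a) c d). specialize (Hc a); specialize (Hd a); lia.
Qed.

Lemma dom_mul {A : Type} (f f' g : A -> nat) : dom f g -> dom f' g -> dom (fun a => f a * f' a) g.
Proof.
  intros [c Hc] [d Hd]; exists (c + d); intros a.
  rewrite Nat.pow_add_r. apply Nat.mul_le_mono; auto.
Qed.

Lemma dom_pow {A : Type} (f g : A -> nat) n : dom f g -> dom (fun a => f a ^ n) g.
Proof.
  intros Hf; induction n as [|n IH]; simpl; [apply dom_const|].
  apply dom_mul; auto.
Qed.

Lemma dom_trans {A : Type} (f g h : A -> nat) : dom f g -> dom g h -> dom f h.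
Proof.
  intros [c Hc] Hg. apply dom_le with (fun a => (g a + 2) ^ c); auto.
  apply dom_pow, dom_add; auto using dom_const.
Qed.

Lemma dom_comp {A B : Type} (f g : B -> nat) (h : A -> B) :
  dom f g -> dom (fun a => f (h a)) (fun a => g (h a)).
Proof. intros [c Hc]; exists c; auto. Qed.

Create HintDb dom.
#[export] Hint Resolve dom_const dom_refl dom_add dom_mul dom_pow : dom.

(** * Functions computed in polynomial time relative to a measure *)

Class Enc (A : Type) := enc : A -> tree.
Definition sz {A : Type} `{Enc A} (a : A) : nat := size (enc a).

#[export] Instance enc_bool : Enc bool := tree_of_bool.
#[export] Instance enc_unit : Enc unit := fun _ => TNil.
#[export] Instance enc_prod {A B : Type} `{Enc A} `{Enc B} : Enc (A * B) :=
  fun p => TCons (enc (fst p)) (enc (snd p)).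
#[export] Instance enc_list {A : Type} `{Enc A} : Enc (list A) :=
  fix enc_list l := match l with [] => TNil | a :: l' => TCons (enc a) (enc_list l') end.

Lemma sz_pos {A : Type} `{Enc A} (a : A) : 1 <= sz a.
Proof. apply size_pos. Qed.

Lemma sz_pair {A B : Type} `{Enc A} `{Enc B} (p : A * B) : sz p = 1 + sz (fst p) + sz (snd p).
Proof. reflexivity. Qed.

Lemma sz_mkpair {A B : Type} `{Enc A} `{Enc B} (a : A) (b : B) : sz (a, b) = 1 + sz a + sz b.
Proof. reflexivity. Qed.

Lemma sz_cons {A : Type} `{Enc A} (a : A) l : sz (a :: l) = 1 + sz a + sz l.
Proof. reflexivity. Qed.

Lemma sz_bool (b : bool) : sz b <= 3.
Proof. destruct b; cbv; lia. Qed.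

Lemma sz_app {A : Type} `{Enc A} (l1 l2 : list A) : sz (l1 ++ l2) + 1 = sz l1 + sz l2.
Proof.
  induction l1 as [|a l1 IH]; simpl app; [change (sz (@nil A)) with 1; lia|].
  rewrite !sz_cons; lia.
Qed.

Lemma sz_in {A : Type} `{Enc A} (a : A) l : In a l -> sz a <= sz l.
Proof. induction l; simpl; [tauto|]. rewrite sz_cons. intros [->|?]; [lia|]. specialize (IHl H0); lia. Qed.

Lemma length_sz {A : Type} `{Enc A} (l : list A) : length l <= sz l.
Proof. induction l; simpl length; [lia|]. rewrite sz_cons; lia. Qed.

(* Bounding the input size by [mu] as well keeps outputs polynomially bounded in [mu],
   so that polynomial-time functions can be applied to them. *)
Definition CT {A B : Type} `{Enc A} `{Enc B} (mu : A -> nat) (f : A -> B) : Prop :=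
  dom sz mu /\ exists p T, dom T mu /\ forall a, eval p (enc a) (enc (f a)) (T a).
Notation PT f := (CT sz f).

Lemma CT_measure {A B : Type} `{Enc A} `{Enc B} mu (f : A -> B) : CT mu f -> dom sz mu.
Proof. intros [H1 _]; exact H1. Qed.

Lemma CT_size {A B : Type} `{Enc A} `{Enc B} mu (f : A -> B) : CT mu f -> dom (fun a => sz (f a)) mu.
Proof.
  intros [H1 (p & T & HT & Hp)].
  apply dom_le with (fun a => sz a + T a); auto with dom.
  intros a; apply (eval_size _ _ _ _ (Hp a)).
Qed.

Lemma CT_ext {A B : Type} `{Enc A} `{Enc B} mu (f g : A -> B) :
  (forall a, f a = g a) -> CT mu f -> CT mu g.
Proof.
  intros E [H1 (p & T & HT & Hp)]. split; auto. exists p, T; split; auto.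
  intros a; rewrite <- E; auto.
Qed.

Lemma CT_id {A : Type} `{Enc A} mu : dom sz mu -> CT mu (fun a : A => a).
Proof.
  intros Hm; split; auto. exists PId, (fun _ => 0); split; auto with dom. intros; constructor.
Qed.

Lemma CT_const {A B : Type} `{Enc A} `{Enc B} mu (b : B) : dom sz mu -> CT mu (fun _ : A => b).
Proof.
  intros Hm; split; auto. exists (PConst (enc b)), (fun a => sz b + sz a); split; auto with dom.
  intros; constructor; unfold sz; lia.
Qed.

Lemma CT_comp {A B C : Type} `{Enc A} `{Enc B} `{Enc C} mu (f : A -> B) (g : B -> C) :
  CT mu f -> PT g -> CT mu (fun a => g (f a)).
Proof.
  intros Hf Hg. pose proof (CT_size _ _ Hf) as Hs.
  destruct Hf as [Hm (p & T & HT & Hp)], Hg as [_ (q & U & HU & Hq)].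
  split; auto. exists (PComp p q), (fun a => T a + U (f a)); split.
  - apply dom_add; auto. apply dom_trans with (fun a => sz (f a)); auto.
    apply (dom_comp _ _ f HU).
  - intros a; econstructor; eauto.
Qed.

Lemma CT_pair {A B C : Type} `{Enc A} `{Enc B} `{Enc C} mu (f : A -> B) (g : A -> C) :
  CT mu f -> CT mu g -> CT mu (fun a => (f a, g a)).
Proof.
  intros Hf Hg. pose proof (CT_size _ _ Hg) as Hs.
  destruct Hf as [Hm (p & T & HT & Hp)], Hg as [_ (q & U & HU & Hq)].
  split; auto. exists (PPair p q), (fun a => T a + U a + 2 * sz a + sz (g a)); split.
  - auto with dom.
  - intros a; econstructor; eauto.
Qed.

Lemma PT_of_prog {A B : Type} `{Enc A} `{Enc B} (f : A -> B) p n :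
  (forall a, eval p (enc a) (enc (f a)) (n * sz a)) -> PT f.
Proof.
  intros Hp; split; auto with dom. exists p, (fun a => n * sz a); split; auto with dom.
Qed.

Lemma CT_fst {A B C : Type} `{Enc A} `{Enc B} `{Enc C} mu (f : A -> B * C) :
  CT mu f -> CT mu (fun a => fst (f a)).
Proof.
  intros Hf; apply (CT_comp mu f fst Hf). apply PT_of_prog with PHd 1.
  intros a; constructor. rewrite sz_pair. unfold sz; lia.
Qed.

Lemma CT_snd {A B C : Type} `{Enc A} `{Enc B} `{Enc C} mu (f : A -> B * C) :
  CT mu f -> CT mu (fun a => snd (f a)).
Proof.
  intros Hf; apply (CT_comp mu f snd Hf). apply PT_of_prog with PTl 1.
  intros a; constructor. rewrite sz_pair. unfold sz; lia.
Qed.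

Lemma CT_cons {A B : Type} `{Enc A} `{Enc B} mu (f : A -> B) (g : A -> list B) :
  CT mu f -> CT mu g -> CT mu (fun a => f a :: g a).
Proof.
  intros Hf Hg. apply (CT_comp mu (fun a => (f a, g a)) (fun p => fst p :: snd p)).
  - apply CT_pair; auto.
  - apply PT_of_prog with PId 1. intros a; constructor.
Qed.

Lemma CT_if {A B : Type} `{Enc A} `{Enc B} mu (c : A -> bool) (f g : A -> B) :
  CT mu c -> CT mu f -> CT mu g -> CT mu (fun a => if c a then f a else g a).
Proof.
  intros [Hm (r & R & HR & Hr)] [_ (p & T & HT & Hp)] [_ (q & U & HU & Hq)].
  split; auto. exists (PComp (PPair r PId) (PIf p q)), (fun a => R a + 3 * sz a + T a + U a + 8); split.
  - auto 10 with dom.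
  - intros a. specialize (Hr a).
    eapply eval_comp with (t1 := R a + 3 * sz a) (t2 := T a + U a + 8).
    + eapply eval_pair with (t2 := 0); [exact Hr|apply eval_id|unfold sz; lia].
    + destruct (c a); simpl.
      * eapply eval_if_true; [apply Hp|simpl; lia].
      * eapply eval_if_false; [apply Hq|lia].
    + lia.
Qed.

(** A nonempty list is encoded like the pair of its head and tail. Hence in [(l a, (a, l a))] the
    first component serves as the test and the second one already is the argument of [G]. *)
Lemma CT_case {A B X : Type} `{Enc A} `{Enc B} `{Enc X} mu (l : A -> list X) (f : A -> B)
    (G : A -> X -> list X -> B) :
  CT mu l -> CT mu f -> PT (fun z : A * (X * list X) => G (fst z) (fst (snd z)) (snd (snd z))) ->
  CT mu (fun a => match l a with [] => f a | x :: t => G a x t end).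
Proof.
  intros Hl Hf HG. pose proof (CT_size _ _ Hl) as Hs.
  destruct Hl as [Hm (r & R & HR & Hr)], Hf as [_ (p & T & HT & Hp)], HG as [_ (q & U & [c HU] & Hq)].
  split; auto.
  exists (PComp (PPair r (PPair PId r)) (PIf q (PComp PHd p))),
    (fun a => 10 * (R a + sz a + sz (l a) + 5) + T a + (sz a + sz (l a) + 1 + 2) ^ c); split.
  - auto 12 with dom.
  - intros a. specialize (Hr a). specialize (Hp a).
    eapply eval_comp with (t1 := 2 * R a + 6 * sz a + 3 * sz (l a))
      (y := TCons (enc (l a)) (TCons (enc a) (enc (l a))))
      (t2 := 2 * (sz a + sz (l a) + 5) + T a + (sz a + sz (l a) + 1 + 2) ^ c); [| |lia].
    + pose proof (sz_pos (l a)). eapply eval_pair with (t1 := R a) (t2 := R a + 3 * sz a + sz (l a));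
        [exact Hr| |unfold sz in *; simpl; lia].
      eapply eval_pair with (t1 := 0) (t2 := R a); [constructor|exact Hr|unfold sz; lia].
    + destruct (l a) as [|x t] eqn:E.
      * eapply eval_if_false with (t1 := sz a + 1 + T a); [|unfold sz; lia].
        eapply eval_comp with (t1 := sz a + 1); [constructor; unfold sz; simpl; lia|exact Hp|lia].
      * specialize (Hq (a, (x, t))). specialize (HU (a, (x, t))).
        rewrite sz_pair in HU. simpl fst in HU. simpl snd in HU. rewrite sz_pair in HU. simpl fst in HU; simpl snd in HU.
        change (enc (x :: t)) with (TCons (enc x) (enc t)).
        eapply eval_if_true; [exact Hq|].
        rewrite !sz_cons in *.
        replace (sz a + (1 + sz x + sz t) + 1 + 2) with (1 + sz a + (1 + sz x + sz t) + 2) by lia.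
        unfold sz in *. lia.
Qed.

(** The loop state is (remaining list, (parameter, accumulator)): the list comes first because its
    constructor is the loop test. *)
Definition fold_body (pF : prog) : prog :=
  PPair (PComp PHd PTl)
    (PPair (PComp PTl PHd)
      (PComp (PPair (PComp PTl PHd) (PPair (PComp PTl PTl) (PComp PHd PHd))) pF)).

Lemma eval_fold_body pF a s h t s' tF : eval pF (TCons a (TCons s h)) s' tF ->
  eval (fold_body pF) (TCons (TCons h t) (TCons a s)) (TCons t (TCons a s'))
    (50 * (size h + size t + size a + size s + size s' + 1) + tF).
Proof.
  intros H. set (x := TCons (TCons h t) (TCons a s)).
  set (W := size h + size t + size a + size s + size s' + 1).
  assert (Hhd : eval PHd x (TCons h t) (2 * W)) by (constructor; simpl; lia).
  assert (Htl : eval PTl x (TCons a s) (2 * W)) by (constructor; simpl; lia).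
  assert (H1 : eval (PComp PHd PTl) x t (3 * W)) by (eapply eval_comp with (t2 := W); [exact Hhd|constructor; lia|lia]).
  assert (H2 : eval (PComp PTl PHd) x a (3 * W)) by (eapply eval_comp with (t2 := W); [exact Htl|constructor; lia|lia]).
  assert (H3 : eval (PComp PTl PTl) x s (3 * W)) by (eapply eval_comp with (t2 := W); [exact Htl|constructor; lia|lia]).
  assert (H4 : eval (PComp PHd PHd) x h (3 * W)) by (eapply eval_comp with (t2 := W); [exact Hhd|constructor; lia|lia]).
  assert (Hx : size x <= 3 * W) by (simpl; lia).
  assert (H5 : eval (PPair (PComp PTl PTl) (PComp PHd PHd)) x (TCons s h) (13 * W))
    by (eapply eval_pair; [exact H3|exact H4|lia]).
  assert (H6 : eval (PPair (PComp PTl PHd) (PPair (PComp PTl PTl) (PComp PHd PHd))) x (TCons a (TCons s h)) (24 * W))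
    by (eapply eval_pair; [exact H2|exact H5|simpl; lia]).
  eapply eval_pair with (t1 := 3 * W) (t2 := 34 * W + tF); [exact H1| |simpl; simpl in Hx; lia].
  eapply eval_pair with (t2 := 24 * W + tF); [exact H2| |simpl; simpl in Hx; lia].
  eapply eval_comp; [exact H6|exact H|lia].
Qed.

Lemma eval_fold {A X S : Type} `{Enc A} `{Enc X} `{Enc S} (G : A -> S -> X -> S) pF T W a :
  (forall s x, eval pF (enc (a, (s, x))) (enc (G a s x)) (T (a, (s, x)))) ->
  forall l s,
  (forall l1 x l2, l = l1 ++ x :: l2 -> T (a, (fold_left (G a) l1 s, x)) <= W) ->
  (forall l1 l2, l = l1 ++ l2 -> sz (fold_left (G a) l1 s) <= W) ->
  sz a + sz l <= W ->
  eval (PWhile (fold_body pF)) (TCons (enc l) (TCons (enc a) (enc s)))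
    (TCons TNil (TCons (enc a) (enc (fold_left (G a) l s)))) (length l * (300 * W) + 1).
Proof.
  intros HF; induction l as [|x l IH]; intros s HT Hs HW; [constructor; lia|].
  simpl fold_left. change (enc (x :: l)) with (TCons (enc x) (enc l)).
  pose proof (sz_pos a).
  rewrite sz_cons in HW.
  eapply eval_while_loop with (t2 := length l * (300 * W) + 1) (t1 := 299 * W);
    [|apply IH|simpl length; lia].
  - eapply eval_le; [apply eval_fold_body, HF|].
    specialize (HT [] x l eq_refl). simpl in HT.
    pose proof (Hs [] (x :: l) eq_refl) as Hs0. pose proof (Hs [x] l eq_refl) as Hs1.
    simpl in Hs0, Hs1. unfold sz in *. lia.
  - intros l1 y l2 ->. apply (HT (x :: l1) y l2). reflexivity.
  - intros l1 l2 ->. apply (Hs (x :: l1) l2). reflexivity.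
  - lia.
Qed.

(** A polynomially computable step may still double the accumulator at each iteration, so a bound
    [beta] on all intermediate accumulators has to be supplied. *)
Lemma CT_fold {A X S : Type} `{Enc A} `{Enc X} `{Enc S} mu (l : A -> list X) (s0 : A -> S)
    (G : A -> S -> X -> S) (beta : A -> nat) :
  CT mu l -> CT mu s0 ->
  PT (fun z : A * (S * X) => G (fst z) (fst (snd z)) (snd (snd z))) ->
  dom beta mu ->
  (forall a l1 l2, l a = l1 ++ l2 -> sz (fold_left (G a) l1 (s0 a)) <= beta a) ->
  CT mu (fun a => fold_left (G a) (l a) (s0 a)).
Proof.
  intros Hl Hs HG Hb Hbound. pose proof (CT_size _ _ Hl) as Hsl. pose proof (CT_size _ _ Hs) as Hss.
  destruct Hl as [Hm (r & R & HR & Hr)], Hs as [_ (p & T & HT & Hp)], HG as [_ (q & U & [c HU] & Hq)].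
  split; auto.
  set (V := fun a => sz a + sz (l a) + beta a + 2 * (sz a + beta a + sz (l a) + 5) ^ c).
  exists (PComp (PPair r (PPair PId p)) (PComp (PWhile (fold_body q)) (PComp PTl PTl))),
    (fun a => 10 * (R a + T a + sz a + sz (s0 a)) + (sz (l a) * (300 * V a) + 1) + 10 * V a + 10); split.
  - assert (dom V mu) by (unfold V; auto 12 with dom). auto 12 with dom.
  - intros a. specialize (Hr a). specialize (Hp a). pose proof (sz_pos a).
    eapply eval_comp with (t1 := 10 * (R a + T a + sz a + sz (s0 a)))
      (y := TCons (enc (l a)) (TCons (enc a) (enc (s0 a))))
      (t2 := (sz (l a) * (300 * V a) + 1) + 10 * V a + 10); [| |lia].
    + eapply eval_pair with (t1 := R a) (t2 := T a + 3 * sz a + sz (s0 a));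
        [exact Hr| |unfold sz in *; simpl; lia].
      eapply eval_pair with (t1 := 0) (t2 := T a); [constructor|exact Hp|unfold sz; lia].
    + eapply eval_comp with (t1 := sz (l a) * (300 * V a) + 1) (t2 := 10 * V a + 10); [| |lia].
      * eapply eval_le; [apply (eval_fold G q U (V a) a)|].
        -- intros s x. apply (Hq (a, (s, x))).
        -- intros l1 x l2 E. eapply Nat.le_trans; [apply HU|].
           rewrite sz_pair; simpl fst; simpl snd. rewrite sz_pair; simpl fst; simpl snd.
           pose proof (Hbound a l1 (x :: l2) E).
           assert (sz x <= sz (l a)) by (apply sz_in; rewrite E, in_app_iff; right; left; auto).
           unfold V.
           assert ((1 + sz a + (1 + sz (fold_left (G a) l1 (s0 a)) + sz x) + 2) ^ c
             <= (sz a + beta a + sz (l a) + 5) ^ c) by (apply Nat.pow_le_mono_l; lia).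
           lia.
        -- intros l1 l2 E. specialize (Hbound a l1 l2 E). unfold V; lia.
        -- unfold V; lia.
        -- pose proof (length_sz (l a)). nia.
      * eapply eval_comp with (t1 := 1) (t2 := sz a); [constructor; simpl; lia|constructor; unfold sz; lia|].
        unfold V; lia.
Qed.

(** If a step adds an amount that depends on the parameter and the list element but not on the
    accumulator, growth does not compound. *)
Lemma CT_fold_additive {A X S : Type} `{Enc A} `{Enc X} `{Enc S} mu (l : A -> list X) (s0 : A -> S)
    (G : A -> S -> X -> S) (c : nat) :
  CT mu l -> CT mu s0 ->
  PT (fun z : A * (S * X) => G (fst z) (fst (snd z)) (snd (snd z))) ->
  (forall a s x, sz (G a s x) <= sz s + (sz a + sz x + 2) ^ c) ->
  CT mu (fun a => fold_left (G a) (l a) (s0 a)).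
Proof.
  intros Hl Hs HG Hc.
  apply CT_fold with (beta := fun a => sz (s0 a) + sz (l a) * (sz a + sz (l a) + 2) ^ c); auto.
  - pose proof (CT_size _ _ Hl). pose proof (CT_size _ _ Hs). destruct Hl as [Hm _].
    auto 12 with dom.
  - intros a l1 l2 E.
    assert (Hlen : length l1 <= sz (l a)).
    { pose proof (length_sz (l a)) as Hsz. rewrite E, length_app in Hsz at 1. lia. }
    assert (Hin : forall x, In x l1 -> sz x <= sz (l a))
      by (intros x Hx; apply sz_in; rewrite E, in_app_iff; auto).
    assert (Hgen : forall l1 s, (forall x, In x l1 -> sz x <= sz (l a)) ->
      sz (fold_left (G a) l1 s) <= sz s + length l1 * (sz a + sz (l a) + 2) ^ c).
    { clear - Hc. induction l1 as [|x l1 IH]; intros s Hin; simpl; [lia|].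
      eapply Nat.le_trans; [apply IH; intros; apply Hin; simpl; auto|].
      assert ((sz a + sz x + 2) ^ c <= (sz a + sz (l a) + 2) ^ c)
        by (apply Nat.pow_le_mono_l; specialize (Hin x (or_introl eq_refl)); lia).
      specialize (Hc a s x). lia. }
    specialize (Hgen l1 (s0 a) Hin). nia.
Qed.

(** * Lists and binary arithmetic *)

Ltac ct_core := first
  [ assumption
  | simple apply CT_id | simple apply CT_const
  | simple apply CT_pair | simple apply CT_fst | simple apply CT_snd
  | simple apply CT_cons | simple apply CT_if ].
Ltac ct_side := solve
  [ match goal with Hc : CT ?mu _ |- dom sz ?mu => exact (CT_measure _ _ Hc) end | auto with dom ].
Ltac ct0 := repeat (cbv beta; first [ct_core | ct_side]).

Lemma CT_rev {A B : Type} `{Enc A} `{Enc B} mu (l : A -> list B) :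
  CT mu l -> CT mu (fun a => rev (l a)).
Proof.
  intros Hl.
  apply CT_ext with (fun a => fold_left (fun s x => x :: s) (l a) []).
  - intros a. rewrite rev_alt, rev_append_rev, app_nil_r.
    assert (G : forall l s, fold_left (fun (s : list B) x => x :: s) l s = rev l ++ s).
    { clear. induction l as [|x l IH]; intros s; simpl; auto. rewrite IH, <- app_assoc; auto. }
    rewrite G, app_nil_r. auto.
  - apply (CT_fold_additive mu l (fun _ => []) (fun _ s x => x :: s) 1); ct0.
    intros a s x. rewrite sz_cons. simpl. lia.
Qed.

Lemma CT_app {A B : Type} `{Enc A} `{Enc B} mu (l1 l2 : A -> list B) :
  CT mu l1 -> CT mu l2 -> CT mu (fun a => l1 a ++ l2 a).
Proof.
  intros H1 H2.
  apply CT_ext with (fun a => fold_left (fun s x => x :: s) (rev (l1 a)) (l2 a)).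
  - intros a. rewrite <- (rev_involutive (l1 a)) at 2. generalize (rev (l1 a)), (l2 a). clear.
    induction l as [|x l IH]; intros s; simpl; auto. rewrite IH, <- app_assoc; auto.
  - apply (CT_fold_additive mu (fun a => rev (l1 a)) l2 (fun _ s x => x :: s) 1);
      [apply CT_rev; auto | ct0 .. |].
    intros a s x. rewrite sz_cons. simpl. lia.
Qed.

Lemma CT_hd {A B : Type} `{Enc A} `{Enc B} mu (d : B) (l : A -> list B) :
  CT mu l -> CT mu (fun a => hd d (l a)).
Proof. intros Hl. apply (CT_case mu l (fun _ => d) (fun _ x _ => x)); ct0. Qed.

Lemma CT_tl {A B : Type} `{Enc A} `{Enc B} mu (l : A -> list B) :
  CT mu l -> CT mu (fun a => tl (l a)).
Proof. intros Hl. apply (CT_case mu l (fun _ => []) (fun _ _ t => t)); ct0. Qed.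

Lemma CT_andb {A : Type} `{Enc A} mu (f g : A -> bool) :
  CT mu f -> CT mu g -> CT mu (fun a => f a && g a).
Proof. intros; apply (CT_if mu f g (fun _ => false)); ct0. Qed.

Lemma CT_orb {A : Type} `{Enc A} mu (f g : A -> bool) :
  CT mu f -> CT mu g -> CT mu (fun a => f a || g a).
Proof. intros; apply (CT_if mu f (fun _ => true) g); ct0. Qed.

Lemma CT_negb {A : Type} `{Enc A} mu (f : A -> bool) : CT mu f -> CT mu (fun a => negb (f a)).
Proof. intros; apply (CT_if mu f (fun _ => false) (fun _ => true)); ct0. Qed.

Lemma CT_xorb {A : Type} `{Enc A} mu (f g : A -> bool) :
  CT mu f -> CT mu g -> CT mu (fun a => xorb (f a) (g a)).
Proof.
  intros. apply CT_ext with (fun a => if f a then negb (g a) else g a).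
  - intros a; destruct (f a), (g a); auto.
  - apply CT_if; auto. apply CT_negb; auto.
Qed.

Ltac ct1 := cbv beta; first
  [ ct_core
  | simple apply CT_rev | simple apply CT_app | simple apply CT_hd | simple apply CT_tl
  | simple apply CT_andb | simple apply CT_orb | simple apply CT_negb | simple apply CT_xorb
  | ct_side ].

Lemma CT_existsb {A B : Type} `{Enc A} `{Enc B} mu (l : A -> list B) (F : A -> B -> bool) :
  CT mu l -> PT (fun z : A * B => F (fst z) (snd z)) -> CT mu (fun a => existsb (F a) (l a)).
Proof.
  intros Hl HF.
  apply CT_ext with (fun a => fold_left (fun b x => b || F a x) (l a) false).
  - intros a.
    assert (G : forall l b, fold_left (fun b x => b || F a x) l b = b || existsb (F a) l).
    { clear. induction l as [|x l IH]; intros b; simpl; [rewrite orb_false_r; auto|].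
      rewrite IH, orb_assoc; auto. }
    apply G.
  - apply (CT_fold_additive mu l (fun _ => false) (fun a b x => b || F a x) 3); repeat ct1.
    + apply (CT_comp sz (fun z : A * (bool * B) => (fst z, snd (snd z)))
        (fun z => F (fst z) (snd z))); repeat ct1.
    + intros a b x. pose proof (sz_bool (b || F a x)).
      pose proof (le_pow_add2 (sz a + sz x) 3). lia.
Qed.

(* Least significant bit first, without leading zeros. *)
Fixpoint posbits (p : positive) : list bool :=
  match p with xH => [true] | xO p' => false :: posbits p' | xI p' => true :: posbits p' end.
Definition bits (n : nat) : list bool :=
  match N.of_nat n with N0 => [] | Npos p => posbits p end.
Fixpoint val (l : list bool) : nat :=
  match l with [] => 0 | b :: l' => Nat.b2n b + 2 * val l' end.

#[export] Instance enc_nat : Enc nat := fun n => enc (bits n).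

(** Prepends a low bit but leaves zero empty; folding it strips leading zeros, which is how results
    are normalised. *)
Definition canon_step (s : list bool) (b : bool) : list bool :=
  match s with [] => if b then [true] else [] | x :: t => b :: x :: t end.

Lemma bits_double b n : bits (Nat.b2n b + 2 * n) = canon_step (bits n) b.
Proof.
  unfold bits.
  replace (N.of_nat (Nat.b2n b + 2 * n)) with
    (if b then N.succ_double (N.of_nat n) else N.double (N.of_nat n)).
  2:{ destruct b; simpl Nat.b2n; [rewrite Nat.add_1_l; symmetry; apply Nat2N.inj_succ_double|
      rewrite Nat.add_0_l; symmetry; apply Nat2N.inj_double]. }
  destruct (N.of_nat n) as [|p]; destruct b; auto; simpl; destruct p; auto.
Qed.

Lemma val_bits n : val (bits n) = n.
Proof.
  unfold bits. rewrite <- (Nat2N.id n) at 2. destruct (N.of_nat n) as [|p]; auto. simpl.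
  induction p; simpl; rewrite ?IHp; rewrite ?Pos2Nat.inj_xI, ?Pos2Nat.inj_xO; simpl; lia.
Qed.

Lemma bits_val l : bits (val l) = fold_left canon_step (rev l) [].
Proof.
  induction l as [|b l IH]; auto. cbn [val rev]. rewrite bits_double, fold_left_app, IH. auto.
Qed.

Lemma growth_room {A B : Type} `{Enc A} `{Enc B} (a : A) (x : B) :
  14 + sz x <= (sz a + sz x + 2) ^ 2.
Proof. pose proof (sz_pos a); pose proof (sz_pos x). simpl; nia. Qed.

Lemma CT_val {A : Type} `{Enc A} mu (l : A -> list bool) : CT mu l -> CT mu (fun a => val (l a)).
Proof.
  intros Hl.
  change (CT mu (fun a => bits (val (l a)))).
  apply CT_ext with (fun a => fold_left canon_step (rev (l a)) []).
  - intros a; rewrite bits_val; auto.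
  - apply (CT_fold_additive mu (fun a => rev (l a)) (fun _ => []) (fun _ => canon_step) 2); repeat ct1.
    + apply (CT_case sz (fun z : A * (list bool * bool) => fst (snd z))
        (fun z => if snd (snd z) then [true] else [])
        (fun z x t => snd (snd z) :: x :: t)); repeat ct1.
    + intros a s x. pose proof (sz_bool x). pose proof (sz_pos a); pose proof (sz_pos x).
      pose proof (growth_room a x).
      unfold canon_step. destruct s as [|y s]; [|rewrite sz_cons; lia].
      change (sz (@nil bool)) with 1. destruct x; [change (sz [true]) with 5|change (sz (@nil bool)) with 1]; lia.
Qed.

Lemma CT_bits {A : Type} `{Enc A} mu (f : A -> nat) : CT mu f -> CT mu (fun a => bits (f a)).
Proof. intros H0; exact H0. Qed.

Lemma val_app l1 l2 : val (l1 ++ l2) = val l1 + 2 ^ length l1 * val l2.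
Proof. induction l1 as [|b l1 IH]; simpl; [lia|]. rewrite IH. lia. Qed.

Definition add_step (s : list bool * (bool * list bool)) (x : bool)
  : list bool * (bool * list bool) :=
  (tl (fst s),
   (if x then hd false (fst s) || fst (snd s) else hd false (fst s) && fst (snd s),
    xorb x (xorb (hd false (fst s)) (fst (snd s))) :: snd (snd s))).

(** Invariant of binary addition: the bits already emitted, plus carry and unread bits of the second
    summand at the current weight. *)
Definition add_value (s : list bool * (bool * list bool)) : nat :=
  val (rev (snd (snd s))) + 2 ^ length (snd (snd s)) * (Nat.b2n (fst (snd s)) + val (fst s)).

Lemma add_value_fold l : forall s, add_value (fold_left add_step l s) =
  add_value s + 2 ^ length (snd (snd s)) * val l.
Proof.
  induction l as [|x l IH]; intros [b [c out]]; [simpl; lia|].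
  cbn [fold_left]. rewrite IH. unfold add_value, add_step. cbn [fst snd rev length].
  rewrite val_app, length_rev, Nat.pow_succ_r'. cbn [val].
  destruct b as [|y b]; cbn [hd tl val]; destruct x, c; try destruct y; simpl Nat.b2n; lia.
Qed.

Lemma CT_add {A : Type} `{Enc A} mu (f g : A -> nat) : CT mu f -> CT mu g -> CT mu (fun a => f a + g a).
Proof.
  intros Hf Hg. apply CT_bits in Hf; apply CT_bits in Hg.
  assert (Hstep : forall (s0 : A -> list bool * (bool * list bool)) (l : A -> list bool),
    CT mu l -> CT mu s0 -> CT mu (fun a => fold_left add_step (l a) (s0 a))).
  { intros s0 l Hl Hs. apply (CT_fold_additive mu l s0 (fun _ => add_step) 2); auto.
    - unfold add_step. repeat ct1.
    - intros a [b [c out]] x. unfold add_step. repeat (rewrite sz_pair; cbn [fst snd]).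
      rewrite sz_cons.
      match goal with |- context [sz (if x then ?u else ?v)] => pose proof (sz_bool (if x then u else v)) end.
      match goal with |- context [sz (xorb ?u ?v)] => pose proof (sz_bool (xorb u v)) end.
      pose proof (sz_pos a); pose proof (sz_pos x). pose proof (sz_pos c).
      assert (sz (tl b) <= sz b) by (destruct b; [simpl tl; lia|simpl tl; rewrite sz_cons; lia]).
      pose proof (growth_room a x). lia. }
  (* The second pass runs over the bits of [g a] left over by the first one, to propagate the carry
     beyond the length of [f a]. *)
  apply CT_ext with (fun a =>
    let s := fold_left add_step (bits (f a)) (bits (g a), (false, [])) in
    let s' := fold_left add_step (fst s) ([], snd s) in
    val (rev (fst (snd s') :: snd (snd s')))).
  - intros a. cbv zeta.
    pose proof (add_value_fold (bits (f a)) (bits (g a), (false, []))) as E1.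
    destruct (fold_left add_step (bits (f a)) (bits (g a), (false, []))) as [b [c out]].
    cbn [fst snd].
    pose proof (add_value_fold b ([], (c, out))) as E2.
    assert (Hn : forall l s, fst s = [] -> fst (fold_left add_step l s) = [])
      by (induction l; intros s Hs; simpl; auto; apply IHl; simpl; rewrite Hs; auto).
    specialize (Hn b ([], (c, out)) eq_refl).
    destruct (fold_left add_step b ([], (c, out))) as [b' [c' out']]. cbn [fst snd] in *. subst b'.
    unfold add_value in E1, E2. cbn [fst snd length rev val Nat.b2n Nat.pow] in E1, E2.
    rewrite !val_bits in E1. cbn [rev]. rewrite val_app, length_rev. cbn [val]. lia.
  - assert (H1 := Hstep (fun a => (bits (g a), (false, []))) (fun a => bits (f a)) Hf ltac:(repeat ct1)).
    assert (H2 := Hstep (fun a => ([], snd (fold_left add_step (bits (f a)) (bits (g a), (false, [])))))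
      (fun a => fst (fold_left add_step (bits (f a)) (bits (g a), (false, []))))
      ltac:(repeat ct1) ltac:(repeat ct1)).
    cbv zeta. apply CT_val. repeat ct1.
Qed.

(** Low bits come first, so the last differing position decides; a set bit left over in the first
    component makes that number the larger one. *)
Definition cmp_step (s : list bool * bool) (x : bool) : list bool * bool :=
  (tl (fst s), if xorb x (hd false (fst s)) then hd false (fst s) else snd s).

Lemma existsb_val l : existsb (fun b => b) l = (0 <? val l).
Proof.
  induction l as [|b l IH]; auto. cbn [existsb val]. rewrite IH.
  destruct b; simpl Nat.b2n; [reflexivity|]. rewrite orb_false_l.
  destruct (Nat.ltb_spec 0 (val l)), (Nat.ltb_spec 0 (0 + 2 * val l)); auto; lia.
Qed.

Lemma cmp_fold l : forall b res,
  existsb (fun b => b) (fst (fold_left cmp_step l (b, res))) || snd (fold_left cmp_step l (b, res))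
  = ((val l <? val b) || ((val l =? val b) && res)).
Proof.
  induction l as [|x l IH]; intros b res.
  - cbn [fold_left fst snd val]. rewrite existsb_val. destruct (val b), res; auto.
  - cbn [fold_left]. unfold cmp_step at 2 4. cbn [fst snd]. rewrite IH.
    assert (Eb : val b = Nat.b2n (hd false b) + 2 * val (tl b)) by (destruct b; auto).
    rewrite Eb. cbn [val].
    destruct x, (hd false b), res; cbn [xorb Nat.b2n];
    repeat match goal with |- context [?m <? ?n] => destruct (Nat.ltb_spec m n) end;
    repeat match goal with |- context [?m =? ?n] => destruct (Nat.eqb_spec m n) end;
    try reflexivity; lia.
Qed.

Lemma CT_leb {A : Type} `{Enc A} mu (f g : A -> nat) : CT mu f -> CT mu g -> CT mu (fun a => f a <=? g a).
Proof.
  intros Hf Hg. apply CT_bits in Hf; apply CT_bits in Hg.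
  apply CT_ext with (fun a =>
    existsb (fun b => b) (fst (fold_left cmp_step (bits (f a)) (bits (g a), true))) ||
    snd (fold_left cmp_step (bits (f a)) (bits (g a), true))).
  - intros a. rewrite (cmp_fold (bits (f a)) (bits (g a)) true), !val_bits.
    destruct (Nat.ltb_spec (f a) (g a)), (Nat.eqb_spec (f a) (g a)), (Nat.leb_spec (f a) (g a)); auto; lia.
  - assert (HS : CT mu (fun a => fold_left cmp_step (bits (f a)) (bits (g a), true))).
    { apply (CT_fold_additive mu (fun a => bits (f a)) (fun a => (bits (g a), true)) (fun _ => cmp_step) 2);
        repeat ct1.
      - unfold cmp_step. repeat ct1.
      - intros a [b c] x. unfold cmp_step. repeat (rewrite sz_pair; cbn [fst snd]).
        match goal with |- context [sz (if ?w then ?u else ?v)] => pose proof (sz_bool (if w then u else v)) end.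
        pose proof (sz_pos a); pose proof (sz_pos x). pose proof (sz_pos c).
        assert (sz (tl b) <= sz b) by (destruct b; [simpl tl; lia|simpl tl; rewrite sz_cons; lia]).
        pose proof (growth_room a x). lia. }
    apply CT_orb; [|repeat ct1].
    apply (CT_existsb mu _ (fun _ b => b)); repeat ct1.
Qed.

Lemma CT_eqb {A : Type} `{Enc A} mu (f g : A -> nat) : CT mu f -> CT mu g -> CT mu (fun a => f a =? g a).
Proof.
  intros Hf Hg. apply CT_ext with (fun a => (f a <=? g a) && (g a <=? f a)).
  - intros a. destruct (Nat.leb_spec (f a) (g a)), (Nat.leb_spec (g a) (f a)), (Nat.eqb_spec (f a) (g a)); auto; lia.
  - apply CT_andb; apply CT_leb; auto.
Qed.

Definition pred_step (s : bool * list bool) (x : bool) : bool * list bool :=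
  (fst s && negb x, xorb x (fst s) :: snd s).

(** Invariant of subtraction with borrow: a borrow weighs 2 to the number of bits emitted so far. *)
Lemma pred_fold l : forall b out, let s := fold_left pred_step l (b, out) in
  length (snd s) = length out + length l /\
  val (rev (snd s)) + 2 ^ length out * Nat.b2n b =
  val (rev out) + 2 ^ length out * val l + 2 ^ length (snd s) * Nat.b2n (fst s).
Proof.
  induction l as [|x l IH]; intros b out; cbn zeta; [simpl; lia|].
  cbn [fold_left]. specialize (IH (b && negb x) (xorb x b :: out)). cbv zeta in IH.
  change (pred_step (b, out) x) with (b && negb x, xorb x b :: out).
  destruct IH as [IHl IHv]. split; [rewrite IHl; simpl; lia|].
  cbn [rev length] in IHv. rewrite val_app, length_rev, Nat.pow_succ_r' in IHv. cbn [val] in *.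
  destruct x, b; simpl xorb in *; simpl andb in *; simpl Nat.b2n in *; lia.
Qed.

Lemma val_lt l : val l < 2 ^ length l.
Proof. induction l as [|[] l IH]; simpl; lia. Qed.

Lemma CT_pred {A : Type} `{Enc A} mu (f : A -> nat) : CT mu f -> CT mu (fun a => pred (f a)).
Proof.
  intros Hf. apply CT_bits in Hf.
  apply CT_ext with (fun a => val (rev (snd (fold_left pred_step (bits (f a)) (true, []))))).
  - intros a. destruct (Nat.eq_dec (f a) 0) as [E|E]; [rewrite E; reflexivity|].
    pose proof (pred_fold (bits (f a)) true []) as P. cbv zeta in P.
    pose proof (val_lt (rev (snd (fold_left pred_step (bits (f a)) (true, []))))) as Hlt.
    rewrite length_rev in Hlt. rewrite val_bits in P.
    destruct (fold_left pred_step (bits (f a)) (true, [])) as [b out]. cbn [fst snd] in *.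
    destruct P as [Pl Pv]. simpl in Pv. destruct b; simpl in Pv; lia.
  - apply CT_val, CT_rev, CT_snd.
    apply (CT_fold_additive mu (fun a => bits (f a)) (fun _ => (true, [])) (fun _ => pred_step) 2); repeat ct1.
    + unfold pred_step; repeat ct1.
    + intros a [b out] x. unfold pred_step. repeat (rewrite sz_pair; cbn [fst snd]). rewrite sz_cons.
      pose proof (sz_bool (b && negb x)); pose proof (sz_bool (xorb x b)).
      pose proof (sz_pos a); pose proof (sz_pos x). pose proof (sz_pos b). pose proof (growth_room a x). lia.
Qed.

Lemma sz_repeat_tt n : sz (repeat tt n) = 2 * n + 1.
Proof. induction n; simpl repeat; [reflexivity|]. rewrite sz_cons, IHn. cbn; lia. Qed.

Lemma unary_fold l : fold_left (fun u b => u ++ u ++ if b : bool then [tt] else []) (rev l) []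
  = repeat tt (val l).
Proof.
  induction l as [|b l IH]; auto. cbn [rev val]. rewrite fold_left_app, IH. cbn [fold_left].
  rewrite Nat.add_comm. replace (2 * val l) with (val l + val l) by lia.
  rewrite !repeat_app, <- app_assoc. destruct b; auto.
Qed.

(** Unary is exponentially longer than binary, so [mu] must dominate the value itself. Intermediate
    accumulators are the values of the high-order prefixes, hence at most [f a]. *)
Lemma CT_unary {A : Type} `{Enc A} mu (f : A -> nat) : CT mu f -> dom f mu ->
  CT mu (fun a => repeat tt (f a)).
Proof.
  intros Hf Hd. pose proof (CT_bits _ _ Hf) as Hb.
  apply CT_ext with (fun a => fold_left (fun u b => u ++ u ++ if b : bool then [tt] else []) (rev (bits (f a))) []).
  - intros a. rewrite unary_fold, val_bits; auto.
  - apply (CT_fold mu (fun a => rev (bits (f a))) (fun _ => [])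
      (fun _ u b => u ++ u ++ if b : bool then [tt] else []) (fun a => 2 * f a + 1)); repeat ct1.
    intros a l1 l2 E. rewrite <- (rev_involutive l1), unary_fold, sz_repeat_tt.
    assert (Hv : f a = val (rev l2 ++ rev l1)).
    { rewrite <- rev_app_distr, <- E, rev_involutive, val_bits; auto. }
    rewrite val_app in Hv. pose proof (Nat.pow_nonzero 2 (length (rev l2))). nia.
Qed.

Ltac ct := repeat first
  [ ct1 | simple apply CT_val | simple apply CT_add | simple apply CT_leb
  | simple apply CT_eqb | simple apply CT_pred ].

(** * Sizes of binary numbers *)

Lemma posbits_pow p : 2 ^ length (posbits p) <= 2 * Pos.to_nat p.
Proof.
  induction p; simpl length; rewrite ?Nat.pow_succ_r', ?Pos2Nat.inj_xI, ?Pos2Nat.inj_xO; simpl in *; lia.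
Qed.

Lemma length_bits_le n k : n < 2 ^ k -> length (bits n) <= k.
Proof.
  intros Hn. unfold bits. destruct (N.of_nat n) as [|p] eqn:E; [simpl; lia|].
  pose proof (posbits_pow p) as Hp.
  assert (Ep : Pos.to_nat p = n) by (rewrite <- (Nat2N.id n), E; reflexivity).
  rewrite Ep in Hp. apply Nat.lt_succ_r. apply (Nat.pow_lt_mono_r_iff 2); [lia|].
  rewrite Nat.pow_succ_r'. lia.
Qed.

Lemma lt_pow_bits n : n < 2 ^ length (bits n).
Proof. rewrite <- (val_bits n) at 1. apply val_lt. Qed.

Lemma sz_bits_upper (n : nat) : sz n <= 4 * length (bits n) + 1.
Proof.
  unfold sz, enc, enc_nat. induction (bits n) as [|b l IH]; [cbn; lia|].
  fold (sz l) in *. fold (sz (b :: l)). rewrite sz_cons. pose proof (sz_bool b). simpl.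
  change (size (enc l)) with (sz l) in IH. lia.
Qed.

Lemma sz_bits_lower (n : nat) : 2 * length (bits n) + 1 <= sz n.
Proof.
  unfold sz, enc, enc_nat. induction (bits n) as [|b l IH]; [cbn; lia|].
  change (size (enc (b :: l))) with (1 + sz b + sz l). change (size (enc l)) with (sz l) in IH.
  pose proof (sz_pos b). simpl. lia.
Qed.

(** The factor 2 is there because [true] and [false] have encodings of different sizes: only the
    number of bits is monotone. *)
Lemma sz_nat_le (m n : nat) : m <= n -> sz m <= 2 * sz n.
Proof.
  intros Hmn. pose proof (sz_bits_upper m); pose proof (sz_bits_lower n).
  pose proof (length_bits_le m (length (bits n))). pose proof (lt_pow_bits n). lia.
Qed.

Lemma sz_nat_add (m n : nat) : sz (m + n) <= 2 * (sz m + sz n) + 4.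
Proof.
  pose proof (sz_bits_upper (m + n)); pose proof (sz_bits_lower n); pose proof (sz_bits_lower m).
  assert (length (bits (m + n)) <= length (bits m) + length (bits n) + 1); [|lia].
  apply length_bits_le. rewrite !Nat.pow_add_r.
  pose proof (lt_pow_bits m); pose proof (lt_pow_bits n). simpl. nia.
Qed.

(** * The search *)

Notation sensor := (nat * nat)%type (only parsing).

(* Cell [c] is the interval [c, c + 1]. *)
Definition covers (s : sensor) (c : nat) : bool :=
  (fst s <=? c + snd s) && (c + 1 <=? fst s + snd s).

Definition advance (S : list sensor) (p : nat) : nat :=
  fold_left (fun p s => if covers s p then fst s + snd s else p) S p.

(* The first uncovered cell: every pass that moves [p] retires a sensor, so [length S]
   passes suffice. *)
Definition frontier (S : list sensor) : nat := fold_left (fun p _ => advance S p) S 0.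

(* ((unmoved sensors, moved sensors), ((offset, radius bound), unary budget)). *)
Notation state := ((list (nat * nat) * list (nat * nat)) * ((nat * nat) * list unit))%type (only parsing).

Definition sensors (st : state) : list sensor := fst (fst st) ++ snd (fst st).

Definition incr_offset (st : state) : state :=
  (fst st, ((fst (fst (snd st)) + 1, snd (fst (snd st))), snd (snd st))).
Definition incr_radius (st : state) : state :=
  (fst st, ((fst (fst (snd st)), snd (fst (snd st)) + 1), snd (snd st))).

(* [fst (snd c)] is the distance from the end of the sensor to the frontier [fst c];
   the right end if [right], otherwise the left end. *)
Definition eligible (right : bool) (c : nat * (nat * nat)) (s : sensor) : bool :=
  (if right then fst s + snd s + fst (snd c) =? fst c
   else fst s =? fst c + snd s + fst (snd c)) && (snd (snd c) <=? snd s).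

Definition pick_step (right : bool) (c : nat * (nat * nat))
    (acc : list sensor * list sensor) (s : sensor) : list sensor * list sensor :=
  if eligible right c s then
    match fst acc with
    | [] => ([s], snd acc)
    | b :: _ => if snd s <=? snd b then ([s], b :: snd acc) else ([b], s :: snd acc)
    end
  else (fst acc, s :: snd acc).

(* ([a smallest eligible sensor, if any], the other sensors). *)
Definition pick (right : bool) (c : nat * (nat * nat)) (U : list sensor)
  : list sensor * list sensor :=
  fold_left (pick_step right c) U ([], []).

Definition select (right : bool) (st : state) : state :=
  match fst (pick right (frontier (sensors st), fst (snd st)) (fst (fst st))) with
  | [] => st
  | s :: _ => ((snd (pick right (frontier (sensors st), fst (snd st)) (fst (fst st))),
                s :: snd (fst st)), ((0, 0), snd (snd st)))
  end.

Definition move_head (right : bool) (st : state) : state :=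
  match snd (fst st) with
  | [] => st
  | s :: M =>
      match snd (snd st) with
      | [] => st
      | _ :: b => ((fst (fst st), (if right then fst s + 1 else pred (fst s), snd s) :: M),
                   (fst (snd st), b))
      end
  end.

(** An inapplicable operation returns the state unchanged, so failure needs no representation and
    words of one fixed length suffice. *)
Definition expand (st : state) : list state :=
  [incr_offset st; incr_radius st; select true st; select false st;
   move_head true st; move_head false st].

Definition round (S : list state) : list state :=
  fold_left (fun acc st => expand st ++ acc) S [].

(** At most B sensors move, and each takes at most B letters for the offset, B for the radius, one
    selection and B unit moves. *)
Definition fuel (u : list unit) : list unit :=
  fold_left (fun acc _ => u ++ u ++ u ++ tt :: acc) u [].

Definition initial (s : list sensor) (u : list unit) : state := ((s, []), ((0, 0), u)).

Definition search (s : list sensor) (u : list unit) : list state :=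
  fold_left (fun S _ => round S) (fuel u) [initial s u].

(* On the degenerate barrier [0, 0] a sensor of radius 0 is useful although it covers no cell. *)
Definition accepting (L B : nat) (s : list sensor) (st : state) : bool :=
  if L =? 0 then existsb (fun xr => fst xr <=? B + snd xr) s
  else L <=? frontier (sensors st).

(* Symbols arrive most significant bit first, so consing them yields the least significant
   bit first; the numbers come out in reverse order and [pair_step] turns them into
   (L, B) :: sensors. *)
Definition parse_step (acc : list bool * list nat) (a : bool * bool) : list bool * list nat :=
  if fst a then ([], val (fst acc) :: snd acc) else (snd a :: fst acc, snd acc).

Definition numbers (w : list (bool * bool)) : list nat :=
  val (fst (fold_left parse_step w ([], []))) :: snd (fold_left parse_step w ([], [])).

Definition pair_step (acc : list nat * list (nat * nat)) (n : nat) : list nat * list (nat * nat) :=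
  match fst acc with
  | [] => ([n], snd acc)
  | r :: _ => ([], (n, r) :: snd acc)
  end.

Definition parse (w : list (bool * bool)) : list (nat * nat) :=
  snd (fold_left pair_step (numbers w) ([], [])).

Definition input_L (w : list (bool * bool)) : nat := fst (hd (0, 0) (parse w)).
Definition input_B (w : list (bool * bool)) : nat := snd (hd (0, 0) (parse w)).
Definition input_s (w : list (bool * bool)) : list sensor := tl (parse w).

Definition decide (w : list (bool * bool)) : bool :=
  existsb (accepting (input_L w) (input_B w) (input_s w))
    (search (input_s w) (repeat tt (input_B w))).

(** * Running time of the search *)

Lemma CT_covers {A : Type} `{Enc A} mu (s : A -> sensor) (c : A -> nat) :
  CT mu s -> CT mu c -> CT mu (fun a => covers (s a) (c a)).
Proof. intros; unfold covers; ct. Qed.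

(** Iterating [advance] does not make numbers grow: [p] is only ever replaced by an end of a given
    sensor. *)
Lemma advance_cases S : forall p,
  advance S p = p \/ exists s, In s S /\ advance S p = fst s + snd s.
Proof.
  induction S as [|s S IH]; intros p; [left; auto|]. unfold advance; simpl.
  destruct (covers s p).
  - destruct (IH (fst s + snd s)) as [E|(s' & Hs & E)]; unfold advance in E; rewrite E.
    + right; exists s; auto.
    + right; exists s'; auto.
  - destruct (IH p) as [E|(s' & Hs & E)]; unfold advance in E; rewrite E; auto.
    right; exists s'; auto.
Qed.

Lemma sz_end (s : sensor) : sz (fst s + snd s) <= 2 * sz s + 4.
Proof. pose proof (sz_nat_add (fst s) (snd s)). rewrite (sz_pair s). lia. Qed.

Lemma growth_square {A B : Type} `{Enc A} `{Enc B} (a : A) (x : B) :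
  2 * sz a + 2 * sz x + 8 <= (sz a + sz x + 2) ^ 2.
Proof. pose proof (sz_pos a); pose proof (sz_pos x). simpl; nia. Qed.

Lemma CT_advance {A : Type} `{Enc A} mu (S : A -> list sensor) (p : A -> nat) :
  CT mu S -> CT mu p -> CT mu (fun a => advance (S a) (p a)).
Proof.
  intros HS Hp.
  apply (CT_fold_additive mu S p (fun _ p s => if covers s p then fst s + snd s else p) 2); auto.
  - apply CT_if; [apply CT_covers| |]; ct.
  - intros a q s. pose proof (growth_square a s). pose proof (sz_end s).
    destruct (covers s q); lia.
Qed.

Lemma CT_frontier {A : Type} `{Enc A} mu (S : A -> list sensor) :
  CT mu S -> CT mu (fun a => frontier (S a)).
Proof.
  intros HS. apply (CT_comp mu S frontier HS).
  apply (CT_fold_additive sz (fun S => S) (fun _ => 0) (fun S p _ => advance S p) 2); ct.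
  - apply CT_advance; ct.
  - intros T p x. pose proof (growth_square T x).
    destruct (advance_cases T p) as [-> | (s & Hs & ->)]; [lia|].
    pose proof (sz_end s). pose proof (sz_in s T Hs). lia.
Qed.

Lemma CT_pick right {A : Type} `{Enc A} mu (c : A -> nat * (nat * nat)) (U : A -> list sensor) :
  CT mu c -> CT mu U -> CT mu (fun a => pick right (c a) (U a)).
Proof.
  intros Hc HU.
  apply (CT_comp mu (fun a => (c a, U a)) (fun z => pick right (fst z) (snd z))); [ct|].
  apply (CT_fold_additive sz (fun z => snd z) (fun _ => ([], [])) (fun z => pick_step right (fst z)) 2); ct.
  - unfold pick_step. apply CT_if.
    + unfold eligible. destruct right; ct.
    + apply (CT_case sz
        (fun z : ((nat * (nat * nat)) * list sensor) * ((list sensor * list sensor) * sensor) => fst (fst (snd z)))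
        (fun z => ([snd (snd z)], snd (fst (snd z))))
        (fun z b _ => if snd (snd (snd z)) <=? snd b then ([snd (snd z)], b :: snd (fst (snd z)))
           else ([b], snd (snd z) :: snd (fst (snd z))))); ct.
    + ct.
  - intros z [best rest] s. pose proof (growth_square z s). unfold pick_step. cbn [fst snd].
    destruct (eligible right (fst z) s); [destruct best as [|b best]; [|destruct (snd s <=? snd b)]|];
      rewrite !sz_mkpair, ?sz_cons;
      try change (sz (@nil (nat * nat))) with 1; try lia; pose proof (sz_pos best); lia.
Qed.

Lemma CT_select right {A : Type} `{Enc A} mu (st : A -> state) :
  CT mu st -> CT mu (fun a => select right (st a)).
Proof.
  intros Hst. apply (CT_comp mu st (select right) Hst).
  assert (Hp : PT (fun st : state => pick right (frontier (sensors st), fst (snd st)) (fst (fst st)))).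
  { apply CT_pick; [apply CT_pair; [apply CT_frontier; unfold sensors; ct|ct]|ct]. }
  apply (CT_case sz (fun st : state => fst (pick right (frontier (sensors st), fst (snd st)) (fst (fst st))))
    (fun st => st)
    (fun st s _ => ((snd (pick right (frontier (sensors st), fst (snd st)) (fst (fst st))),
                s :: snd (fst st)), ((0, 0), snd (snd st))))); ct.
  apply (CT_comp sz (fun z : state * (sensor * list sensor) => fst z)
    (fun st => pick right (frontier (sensors st), fst (snd st)) (fst (fst st)))); ct.
Qed.

Lemma CT_move_head right {A : Type} `{Enc A} mu (st : A -> state) :
  CT mu st -> CT mu (fun a => move_head right (st a)).
Proof.
  intros Hst. apply (CT_comp mu st (move_head right) Hst).
  apply (CT_case sz (fun st : state => snd (fst st)) (fun st => st)
    (fun st s M => match snd (snd st) with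
      | [] => st
      | _ :: b => ((fst (fst st), (if right then fst s + 1 else pred (fst s), snd s) :: M),
                   (fst (snd st), b))
      end)); ct.
  apply (CT_case sz (fun z : state * (sensor * list sensor) => snd (snd (fst z))) (fun z => fst z)
    (fun z _ b => ((fst (fst (fst z)),
       (if right then fst (fst (snd z)) + 1 else pred (fst (fst (snd z))), snd (fst (snd z))) :: snd (snd z)),
       (fst (snd (fst z)), b)))); ct.
Qed.

Lemma CT_expand {A : Type} `{Enc A} mu (st : A -> state) :
  CT mu st -> CT mu (fun a => expand (st a)).
Proof.
  intros Hst. unfold expand.
  repeat (apply CT_cons; [first [apply CT_select | apply CT_move_head | unfold incr_offset, incr_radius]; ct|]).
  ct.
Qed.

(* In contrast to the polynomial bounds above, these bounds are iterated and must be linear. *)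
Lemma sz_pick right c U : sz (pick right c U) <= 2 + sz U.
Proof.
  assert (G : forall U acc, sz (fold_left (pick_step right c) U acc) + 1 <= sz acc + sz U).
  { clear. induction U as [|s U IH]; intros acc; [simpl; change (sz (@nil (nat * nat))) with 1; lia|].
    simpl fold_left. eapply Nat.le_trans; [apply IH|]. rewrite sz_cons.
    destruct acc as [best rest]. unfold pick_step; cbn [fst snd].
    destruct (eligible right c s); [destruct best as [|b best]; [|destruct (snd s <=? snd b)]|];
      rewrite !sz_mkpair, ?sz_cons;
      try change (sz (@nil (nat * nat))) with 1; try lia; pose proof (sz_pos best); lia. }
  specialize (G U ([], [])). unfold pick.
  change (sz (@nil (nat * nat), @nil (nat * nat))) with 3 in G. lia.
Qed.

Ltac szs := cbn [fst snd] in *; rewrite ?sz_mkpair in *.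

Lemma sz_select right st : sz (select right st) <= 20 * sz st.
Proof.
  unfold select. destruct (pick right _ _) as [[|s best] rest] eqn:E; cbn [fst snd]; [lia|].
  pose proof (sz_pick right (frontier (sensors st), fst (snd st)) (fst (fst st))) as Hp. rewrite E in Hp.
  destruct st as [[U M] [[o k] b]]. szs. rewrite sz_cons in *. change (sz 0) with 1.
  pose proof (sz_pos o); pose proof (sz_pos k). lia.
Qed.

Lemma sz_move_head right st : sz (move_head right st) <= 20 * sz st.
Proof.
  unfold move_head. destruct st as [[U M] [ok b]]. cbn [fst snd].
  destruct M as [|[x r] M]; [lia|]. destruct b as [|t b]; [lia|].
  szs. rewrite !sz_cons. szs.
  assert (sz (if right then x + 1 else pred x) <= 2 * sz x + 20).
  { destruct right; [pose proof (sz_nat_add x 1); change (sz 1) with 5 in *; lia|].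
    pose proof (sz_nat_le (pred x) x). lia. }
  lia.
Qed.

Lemma sz_expand st : sz (expand st) <= 200 * sz st.
Proof.
  unfold expand. rewrite !sz_cons. change (sz (@nil state)) with 1.
  pose proof (sz_select true st); pose proof (sz_select false st).
  pose proof (sz_move_head true st); pose proof (sz_move_head false st).
  destruct st as [[U M] [[o k] b]]. unfold incr_offset, incr_radius. szs.
  pose proof (sz_nat_add o 1); pose proof (sz_nat_add k 1); change (sz 1) with 5 in *. lia.
Qed.

Lemma CT_round {A : Type} `{Enc A} mu (S : A -> list state) :
  CT mu S -> CT mu (fun a => round (S a)).
Proof.
  intros HS.
  apply (CT_fold_additive mu S (fun _ => []) (fun _ acc st => expand st ++ acc) 8); auto.
  - ct.
  - apply CT_app; [apply CT_expand|]; ct.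
  - intros a acc st. pose proof (sz_app (expand st) acc). pose proof (sz_expand st).
    assert (200 * sz st <= (sz a + sz st + 2) ^ 8); [|lia].
    pose proof (sz_pos a). change 8 with (1 + 7). rewrite Nat.pow_add_r, Nat.pow_1_r.
    assert (3 ^ 7 <= (sz a + sz st + 2) ^ 7) by (apply Nat.pow_le_mono_l; lia).
    change (3 ^ 7) with 2187 in *. nia.
Qed.

Lemma sz_round S : sz (round S) <= 201 * sz S.
Proof.
  assert (G : forall S acc, sz (fold_left (fun acc st => expand st ++ acc) S acc) + 1 <= sz acc + 201 * sz S).
  { clear. induction S as [|st S IH]; intros acc; [cbn [fold_left]; change (sz (@nil state)) with 1; lia|].
    cbn [fold_left]. specialize (IH (expand st ++ acc)). rewrite sz_cons.
    pose proof (sz_app (expand st) acc). pose proof (sz_expand st). lia. }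
  specialize (G S []). unfold round. change (sz (@nil state)) with 1 in G. lia.
Qed.

Lemma fuel_repeat n : fuel (repeat tt n) = repeat tt (n * (3 * n + 1)).
Proof.
  unfold fuel.
  assert (G : forall (v : list unit) m, fold_left (fun acc _ => repeat tt n ++ repeat tt n ++ repeat tt n ++ tt :: acc) v (repeat tt m)
     = repeat tt (length v * (3 * n + 1) + m)).
  { induction v as [|x v IH]; intros m; auto. simpl fold_left.
    change (tt :: repeat tt m) with (repeat tt (S m)). rewrite <- !repeat_app, IH.
    f_equal. simpl length. lia. }
  specialize (G (repeat tt n) 0). change (repeat tt 0) with (@nil unit) in G. rewrite G, repeat_length. f_equal; lia.
Qed.

Lemma CT_fuel {A : Type} `{Enc A} mu (u : A -> list unit) : CT mu u -> CT mu (fun a => fuel (u a)).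
Proof.
  intros Hu. apply (CT_comp mu u fuel Hu).
  apply (CT_fold_additive sz (fun u => u) (fun _ => []) (fun u acc _ => u ++ u ++ u ++ tt :: acc) 2); ct.
  intros v acc x. pose proof (sz_app v (v ++ v ++ tt :: acc)).
  pose proof (sz_app v (v ++ tt :: acc)). pose proof (sz_app v (tt :: acc)).
  rewrite sz_cons in *. change (sz tt) with 1 in *.
  pose proof (sz_pos v); pose proof (sz_pos x). assert (3 * sz v + 5 <= (sz v + sz x + 2) ^ 2) by (simpl; nia). lia.
Qed.

Lemma sz_val l : sz (val l) <= sz l.
Proof.
  unfold sz at 1, enc, enc_nat. rewrite bits_val. fold (sz (fold_left canon_step (rev l) [])).
  induction l as [|b l IH]; [simpl; lia|]. simpl rev. rewrite fold_left_app, sz_cons. simpl.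
  destruct (fold_left canon_step (rev l) []) as [|x t]; unfold canon_step.
  - pose proof (sz_pos b); pose proof (sz_pos l). destruct b; [|change (sz (@nil bool)) with 1; lia].
    change (sz [true]) with 5. change (sz true) with 3. lia.
  - rewrite sz_cons. lia.
Qed.

Lemma PT_parse : PT parse.
Proof.
  assert (Hn : PT numbers).
  { assert (PT (fun w => fold_left parse_step w ([], []))).
    { apply (CT_fold_additive sz (fun w => w) (fun _ => ([], [])) (fun _ => parse_step) 2); ct.
      - unfold parse_step; ct.
      - intros w [cur done] [sep b]. pose proof (growth_square w (sep, b)).
        unfold parse_step; cbn [fst snd]. destruct sep; szs; rewrite ?sz_cons.
        + pose proof (sz_val cur). change (sz (@nil bool)) with 1. lia.
        + lia. }
    unfold numbers; ct. }
  apply CT_snd. apply (CT_comp sz numbers (fun l => fold_left pair_step l ([], [])) Hn).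
  apply (CT_fold_additive sz (fun l => l) (fun _ => ([], [])) (fun _ => pair_step) 2); ct.
  - apply (CT_case sz (fun z : list nat * ((list nat * list (nat * nat)) * nat) => fst (fst (snd z)))
      (fun z => ([snd (snd z)], snd (fst (snd z))))
      (fun z r _ => ([], (snd (snd z), r) :: snd (fst (snd z))))); ct.
  - intros l [pend ps] n. pose proof (growth_square l n). unfold pair_step; cbn [fst snd].
    destruct pend as [|r pend]; szs; rewrite !sz_cons; szs.
    + change (sz (@nil nat)) with 1. lia.
    + change (sz (@nil nat)) with 1. lia.
Qed.

(** The measure in which the whole decision is polynomial: [input_B w] pays for the unary budget,
    and the growth factor of [round] to the power of the number of rounds pays for the list of
    states. *)
Definition work (w : list (bool * bool)) : nat :=
  sz w + input_B w + 201 ^ (input_B w * (3 * input_B w + 1)).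

Lemma CT_decide : CT work decide.
Proof.
  assert (Hm : dom sz work) by (apply dom_le with work; [unfold work; intros; lia|auto with dom]).
  assert (Hparse : CT work parse) by (apply (CT_comp work (fun w => w) parse); [ct|apply PT_parse]).
  assert (HB : CT work input_B) by (unfold input_B; ct).
  assert (Hs : CT work input_s) by (unfold input_s; ct).
  assert (Hu : CT work (fun w => repeat tt (input_B w))).
  { apply CT_unary; auto. apply dom_le with work; [unfold work; intros; lia|auto with dom]. }
  assert (Hsearch : CT work (fun w => search (input_s w) (repeat tt (input_B w)))).
  { assert (Hinit : CT work (fun w => [initial (input_s w) (repeat tt (input_B w))]))
      by (unfold initial; ct).
    (* Every round multiplies the size of the list, so the additive rule does not apply and a
       geometric bound is supplied. *)
    apply (CT_fold work (fun w => fuel (repeat tt (input_B w)))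
      (fun w => [initial (input_s w) (repeat tt (input_B w))]) (fun _ S _ => round S)
      (fun w => work w * sz [initial (input_s w) (repeat tt (input_B w))])); auto.
    - apply CT_fuel; auto.
    - apply CT_round; ct.
    - pose proof (CT_size _ _ Hinit). auto with dom.
    - intros w l1 l2 E.
      assert (G : forall l S, sz (fold_left (fun S _ => round S) l S) <= 201 ^ @length unit l * sz S).
      { clear. induction l as [|x l IH]; intros S; simpl length; [simpl; lia|].
        cbn [fold_left]. eapply Nat.le_trans; [apply IH|]. pose proof (sz_round S).
        rewrite Nat.pow_succ_r'. nia. }
      eapply Nat.le_trans; [apply G|]. apply Nat.mul_le_mono_r.
      apply (f_equal (@length unit)) in E. rewrite fuel_repeat, repeat_length, length_app in E.
      apply Nat.le_trans with (201 ^ (input_B w * (3 * input_B w + 1))); [|unfold work; lia].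
      apply Nat.pow_le_mono_r; lia. }
  apply (CT_existsb work _ (fun w => accepting (input_L w) (input_B w) (input_s w)) Hsearch).
  assert (Hw : PT (fun z : list (bool * bool) * state => parse (fst z)))
    by (apply (CT_comp sz (fun z : list (bool * bool) * state => fst z) parse); [ct|apply PT_parse]).
  unfold accepting, input_L, input_B, input_s. apply CT_if; [ct| |].
  - apply (CT_existsb sz (fun z : list (bool * bool) * state => tl (parse (fst z)))
      (fun z xr => fst xr <=? snd (hd (0, 0) (parse (fst z))) + snd xr)); ct.
    apply (CT_comp sz (fun z : (list (bool * bool) * state) * (nat * nat) => fst z)
      (fun z => parse (fst z))); ct.
  - apply CT_leb; [ct|]. apply CT_frontier. unfold sensors. ct.
Qed.

(** * Correctness of the search *)

Lemma coversP s c : covers s c = true <-> fst s <= c + snd s /\ c < fst s + snd s.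
Proof. unfold covers. rewrite andb_true_iff, !Nat.leb_le. lia. Qed.

(** * Coverage and the frontier *)

Definition covered (S : list sensor) (c : nat) : Prop := exists s, In s S /\ covers s c = true.
Definition covers_all (S : list sensor) (L : nat) : Prop := forall c, c < L -> covered S c.

Lemma covered_incl S T c : incl S T -> covered S c -> covered T c.
Proof. intros HST (s & Hs & Hc); exists s; auto. Qed.

Lemma advance_ge T p : p <= advance T p.
Proof.
  revert p; induction T as [|s T IH]; intros p; [apply le_n|].
  unfold advance; cbn [fold_left]. fold (advance T).
  destruct (covers s p) eqn:E; [apply coversP in E|].
  - specialize (IH (fst s + snd s)). unfold advance in IH; lia.
  - apply IH.
Qed.

Lemma advance_covered S T p : incl T S -> covers_all S p -> covers_all S (advance T p).
Proof.
  revert p; induction T as [|s T IH]; intros p Hi Hp; [exact Hp|].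
  unfold advance; cbn [fold_left]. apply IH; [intros x Hx; apply Hi; simpl; auto|].
  destruct (covers s p) eqn:E; auto. intros c Hc.
  destruct (le_lt_dec p c) as [Hpc|Hpc]; [|apply Hp; auto].
  exists s; split; [apply Hi; simpl; auto|]. apply coversP in E; apply coversP; lia.
Qed.

(** The potential of the frontier iteration. *)
Definition pending (S : list sensor) (p : nat) : nat :=
  length (filter (fun s => p <? fst s + snd s) S).

Lemma pending_mono S p q : p <= q -> pending S q <= pending S p.
Proof.
  intros Hpq. unfold pending. induction S as [|s S IH]; simpl; auto.
  destruct (Nat.ltb_spec q (fst s + snd s)), (Nat.ltb_spec p (fst s + snd s)); simpl; lia.
Qed.

Lemma pending_end S s p : In s S -> p < fst s + snd s -> pending S (fst s + snd s) < pending S p.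
Proof.
  intros Hs Hp. induction S as [|s' S IH]; [destruct Hs|].
  pose proof (pending_mono S p (fst s + snd s)) as Hm. unfold pending in *. simpl.
  destruct Hs as [->|Hs].
  - rewrite Nat.ltb_irrefl. destruct (Nat.ltb_spec p (fst s + snd s)); simpl; lia.
  - specialize (IH Hs).
    destruct (Nat.ltb_spec (fst s + snd s) (fst s' + snd s')), (Nat.ltb_spec p (fst s' + snd s')); simpl; lia.
Qed.

Lemma advance_pending S p : advance S p = p \/ pending S (advance S p) < pending S p.
Proof.
  pose proof (advance_ge S p) as Hge.
  destruct (advance_cases S p) as [E|(s & Hs & E)]; [auto|].
  destruct (Nat.eq_dec (advance S p) p) as [?|ne]; [auto|right].
  rewrite E in *. apply pending_end; auto; lia.
Qed.

Lemma advance_stuck S p : advance S p = p -> ~ covered S p.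
Proof.
  intros E (s & Hs & Hc).
  (* Either the scan is still at [p] when it meets [s], which then pushes it on, or it has left [p]
     before. *)
  assert (G : forall T q, p <= q -> In s T \/ p < q -> p < advance T q).
  { intros T; induction T as [|t T IH]; intros q Hq [Hin|Hlt]; try destruct Hin; subst; auto;
      unfold advance; cbn [fold_left]; fold (advance T).
    - destruct (Nat.eq_dec p q) as [->|ne].
      + rewrite Hc. apply coversP in Hc. apply IH; [lia|right; lia].
      + pose proof (advance_ge T (if covers s q then fst s + snd s else q)) as Hge.
        unfold advance in Hge. destruct (covers s q) eqn:Eq; [apply coversP in Eq|]; lia.
    - apply IH; auto. destruct (covers t q) eqn:Eq; [apply coversP in Eq|]; lia.
    - pose proof (advance_ge T (if covers t q then fst t + snd t else q)) as Hge.
      unfold advance in Hge. destruct (covers t q) eqn:Eq; [apply coversP in Eq|]; lia. }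
  specialize (G S p (le_n _) (or_introl Hs)). lia.
Qed.

Lemma frontier_spec S : covers_all S (frontier S) /\ ~ covered S (frontier S).
Proof.
  assert (G : forall l p, covers_all S p ->
    covers_all S (fold_left (fun p (_ : sensor) => advance S p) l p) /\
    (advance S (fold_left (fun p (_ : sensor) => advance S p) l p) =
       fold_left (fun p (_ : sensor) => advance S p) l p \/
     pending S (fold_left (fun p (_ : sensor) => advance S p) l p) + length l <= pending S p)).
  { induction l as [|x l IH]; intros p Hp; cbn [fold_left length]; [split; auto; right; lia|].
    destruct (IH (advance S p)) as [H1 H2]; [apply advance_covered; auto using incl_refl|].
    split; auto. destruct H2 as [H2|H2]; auto.
    destruct (advance_pending S p) as [E|Hlt]; [|right; lia].
    left. rewrite E. clear -E. induction l as [|y l IH]; cbn [fold_left]; auto. rewrite E; auto. }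
  destruct (G S 0) as [H1 H2]; [intros c Hc; lia|]. fold (frontier S) in H1, H2.
  split; auto. destruct H2 as [H2|H2]; [apply advance_stuck; auto|].
  (* If all [length S] passes made progress, the potential is exhausted, while a sensor covering the
     frontier would let it drop once more. *)
  intros (s & Hs & Hc). apply coversP in Hc.
  assert (Hlen : pending S 0 <= length S) by apply filter_length_le.
  pose proof (pending_end S s (frontier S) Hs ltac:(lia)). lia.
Qed.

Lemma frontier_le S L : L <= frontier S <-> covers_all S L.
Proof.
  destruct (frontier_spec S) as [H1 H2]. split.
  - intros HL c Hc. apply H1; lia.
  - intros HL. destruct (le_lt_dec L (frontier S)) as [?|Hlt]; auto.
    destruct H2. auto.
Qed.

Lemma pick_spec right c U :
  (fst (pick right c U) = [] /\ forall s, In s U -> eligible right c s = false) \/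
  exists s, fst (pick right c U) = [s] /\ Permutation U (s :: snd (pick right c U)) /\
    eligible right c s = true /\
    forall s', In s' U -> eligible right c s' = true -> snd s <= snd s'.
Proof.
  enough (
  (fst (pick right c U) = [] /\ Permutation U (snd (pick right c U)) /\
     forall s, In s U -> eligible right c s = false) \/
  exists s, fst (pick right c U) = [s] /\ Permutation U (s :: snd (pick right c U)) /\
    eligible right c s = true /\
    forall s', In s' U -> eligible right c s' = true -> snd s <= snd s') by tauto.
  induction U as [|t U IH] using rev_ind.
  - left. simpl. repeat split; auto. intros s [].
  - unfold pick in *. rewrite fold_left_app. cbn [fold_left]. set (r := fold_left _ _ _) in *.
    destruct r as [best rest]. cbn [fst snd] in *. unfold pick_step. cbn [fst snd].
    assert (Pc : Permutation (U ++ [t]) (t :: U)) by (symmetry; apply Permutation_cons_append).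
    destruct (eligible right c t) eqn:Et.
    + right. destruct IH as [(-> & Hp & Hn)|(s & -> & Hp & Hs & Hmin)].
      * exists t. cbn [fst snd]. repeat split; auto.
        -- rewrite Pc, Hp at 1; auto.
        -- intros s' Hs' He. apply in_app_iff in Hs'. destruct Hs' as [Hs'|[<-|[]]]; auto.
           rewrite Hn in He by auto; discriminate.
      * destruct (Nat.leb_spec (snd t) (snd s)) as [Hle|Hlt]; cbn [fst snd].
        -- exists t. repeat split; auto.
           ++ rewrite Pc, Hp at 1; auto.
           ++ intros s' Hs' He. apply in_app_iff in Hs'. destruct Hs' as [Hs'|[<-|[]]]; auto.
              specialize (Hmin s' Hs' He); lia.
        -- exists s. repeat split; auto.
           ++ rewrite Pc, Hp at 1. constructor.
           ++ intros s' Hs' He. apply in_app_iff in Hs'. destruct Hs' as [Hs'|[<-|[]]]; auto. lia.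
    + destruct IH as [(-> & Hp & Hn)|(s & -> & Hp & Hs & Hmin)]; cbn [fst snd].
      * left. repeat split; auto.
        -- rewrite Pc, Hp at 1; auto.
        -- intros s' Hs'. apply in_app_iff in Hs'. destruct Hs' as [Hs'|[<-|[]]]; auto.
      * right. exists s. repeat split; auto.
        -- rewrite Pc, Hp at 1. constructor.
        -- intros s' Hs' He. apply in_app_iff in Hs'. destruct Hs' as [Hs'|[<-|[]]]; auto. congruence.
Qed.

(** * Integral assignments *)

Definition displacement (x y : nat) : nat := (x - y) + (y - x).

(* An assignment pairs each sensor with its new position. *)
Definition place (v : sensor * nat) : sensor := (snd v, snd (fst v)).
Definition cost (V : list (sensor * nat)) : nat :=
  list_sum (map (fun v => displacement (fst (fst v)) (snd v)) V).

(** The sensors in [M] are placed for good. Completeness relies on this separation; soundness takes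
    [M] empty, so that a sensor moved once may move again. *)
Definition solvable (U M : list sensor) (b L : nat) : Prop :=
  exists V, map fst V = U /\ cost V <= b /\ covers_all (map place V ++ M) L.

Lemma cost_cons v V : cost (v :: V) = displacement (fst (fst v)) (snd v) + cost V.
Proof. reflexivity. Qed.

Lemma cost_app V W : cost (V ++ W) = cost V + cost W.
Proof. unfold cost. rewrite map_app, list_sum_app. auto. Qed.

Lemma cost_perm V W : Permutation V W -> cost V = cost W.
Proof. induction 1; rewrite ?cost_cons; lia. Qed.

Lemma assignment_perm (V : list (sensor * nat)) U : Permutation (map fst V) U ->
  exists W, Permutation V W /\ map fst W = U.
Proof.
  intros H. symmetry in H. apply Permutation_map_inv in H. destruct H as (W & E & HW).
  exists W; auto.
Qed.

Lemma covers_all_incl S T L : incl S T -> covers_all S L -> covers_all T L.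
Proof. intros Hi H c Hc. eapply covered_incl; eauto. Qed.

Lemma solvable_perm U U' b L : Permutation U U' -> solvable U [] b L -> solvable U' [] b L.
Proof.
  intros HU (V & HV & Hb & HL). subst U.
  destruct (assignment_perm V U' HU) as (W & HW & HWU).
  exists W; repeat split; auto.
  - rewrite <- (cost_perm V W); auto.
  - eapply covers_all_incl; [|exact HL]. intros s Hs. rewrite app_nil_r in *.
    eapply Permutation_in; [|exact Hs]. apply Permutation_map; auto.
Qed.

(** Triangle inequality: the unit move is put in front of the remaining displacement. *)
Lemma solvable_step x x' r S b L : displacement x x' <= 1 ->
  solvable ((x', r) :: S) [] b L -> solvable ((x, r) :: S) [] (Datatypes.S b) L.
Proof.
  intros Hx (V & HV & Hb & HL). destruct V as [|[s y] V]; [discriminate|].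
  cbn [map fst] in HV. injection HV as -> HV.
  exists (((x, r), y) :: V). repeat split.
  - cbn [map fst]; congruence.
  - rewrite cost_cons in *. cbn [fst snd] in *. unfold displacement in *. lia.
  - exact HL.
Qed.

(** Solutions are pulled back: a selection merely permutes the sensors, whichever it picks, and a
    unit move is paid for by the token it removes. *)
Lemma expand_sound st st' L : In st' (expand st) ->
  solvable (sensors st') [] (length (snd (snd st'))) L ->
  solvable (sensors st) [] (length (snd (snd st))) L.
Proof.
  assert (Hsel : forall right, solvable (sensors (select right st)) [] (length (snd (snd (select right st)))) L ->
    solvable (sensors st) [] (length (snd (snd st))) L).
  { intros right. unfold select.
    destruct (pick_spec right (frontier (sensors st), fst (snd st)) (fst (fst st)))
      as [(-> & _)|(s & -> & Hp & _)]; auto.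
    unfold sensors; cbn [fst snd]. apply solvable_perm.
    eapply Permutation_trans; [apply Permutation_sym, Permutation_middle|].
    apply Permutation_sym. exact (Permutation_app_tail (snd (fst st)) Hp). }
  assert (Hmov : forall right, solvable (sensors (move_head right st)) [] (length (snd (snd (move_head right st)))) L ->
    solvable (sensors st) [] (length (snd (snd st))) L).
  { intros right. unfold move_head. destruct st as [[U M] [ok b]]. cbn [fst snd].
    destruct M as [|[x r] M]; auto. destruct b as [|t b]; auto.
    unfold sensors; cbn [fst snd length]. intros H.
    eapply solvable_perm; [apply Permutation_middle|].
    eapply solvable_step with (x' := if right then x + 1 else pred x).
    - unfold displacement; destruct right; lia.
    - eapply solvable_perm; [|exact H]. symmetry; apply Permutation_middle. }
  intros [<-|[<-|[<-|[<-|[<-|[<-|[]]]]]]]; auto; eauto.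
Qed.

(** * States reached by words of operations *)

Inductive reach : nat -> state -> state -> Prop :=
  | reach_refl st : reach 0 st st
  | reach_step n st1 st2 st3 : In st2 (expand st1) -> reach n st2 st3 -> reach (S n) st1 st3.

Lemma reach_trans m n st1 st2 st3 : reach m st1 st2 -> reach n st2 st3 -> reach (m + n) st1 st3.
Proof. induction 1; simpl; auto. intros; econstructor; eauto. Qed.

Lemma reach_one st1 st2 : In st2 (expand st1) -> reach 1 st1 st2.
Proof. intros; econstructor; [eauto|constructor]. Qed.

Lemma reach_sound n st st' L : reach n st st' -> covers_all (sensors st') L ->
  solvable (sensors st) [] (length (snd (snd st))) L.
Proof.
  induction 1 as [st|n st1 st2 st3 H1 H2 IH]; intros HL.
  - exists (map (fun s => (s, fst s)) (sensors st)). repeat split.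
    + rewrite map_map. apply map_id.
    + assert (E : forall l : list sensor, cost (map (fun s => (s, fst s)) l) = 0).
      { induction l as [|s l IH]; auto. cbn [map]. rewrite cost_cons, IH. unfold displacement; simpl; lia. }
      rewrite E; lia.
    + rewrite app_nil_r, map_map. eapply covers_all_incl; [|exact HL].
      intros s Hs. apply in_map_iff. exists s; split; auto. destruct s; auto.
  - eapply expand_sound; eauto.
Qed.

Lemma in_round st' S : In st' (round S) <-> exists st, In st S /\ In st' (expand st).
Proof.
  unfold round.
  assert (G : forall S acc, In st' (fold_left (fun acc st => expand st ++ acc) S acc) <->
    In st' acc \/ exists st, In st S /\ In st' (expand st)).
  { induction S0 as [|st S0 IH]; intros acc; cbn [fold_left].
    - firstorder.
    - rewrite IH, in_app_iff. split.
      + intros [[H|H]|(st1 & H1 & H2)]; [right; exists st; simpl; auto|auto|right; exists st1; simpl; auto].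
      + intros [H|(st1 & [->|H1] & H2)]; auto. right; exists st1; auto. }
  rewrite G. simpl. tauto.
Qed.

Lemma in_search st' s n :
  In st' (search s (repeat tt n)) <-> reach (n * (3 * n + 1)) (initial s (repeat tt n)) st'.
Proof.
  unfold search. rewrite fuel_repeat.
  assert (G : forall m S, In st' (fold_left (fun S (_ : unit) => round S) (repeat tt m) S) <->
    exists st, In st S /\ reach m st st').
  { induction m as [|m IH]; intros S; cbn [repeat fold_left].
    - split; [intros H; exists st'; split; auto; constructor|].
      intros (st & Hs & Hr); inversion Hr; subst; auto.
    - rewrite IH. split.
      + intros (st & Hs & Hr). apply in_round in Hs. destruct Hs as (st0 & H0 & H1).
        exists st0; split; auto. econstructor; eauto.
      + intros (st & Hs & Hr). inversion Hr; subst. eexists; split; [|eassumption].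
        apply in_round; eauto. }
  rewrite G. split; [intros (st & [->|[]] & Hr); auto|intros Hr; eexists; split; [left; reflexivity|auto]].
Qed.

Lemma reach_offset n : forall UM o k b, reach n (UM, ((o, k), b)) (UM, ((o + n, k), b)).
Proof.
  induction n as [|n IH]; intros UM o k b; [rewrite Nat.add_0_r; constructor|].
  econstructor; [left; reflexivity|]. unfold incr_offset; cbn [fst snd].
  replace (o + S n) with (o + 1 + n) by lia. apply IH.
Qed.

Lemma reach_radius n : forall UM o k b, reach n (UM, ((o, k), b)) (UM, ((o, k + n), b)).
Proof.
  induction n as [|n IH]; intros UM o k b; [rewrite Nat.add_0_r; constructor|].
  econstructor; [right; left; reflexivity|]. unfold incr_radius; cbn [fst snd].
  replace (k + S n) with (k + 1 + n) by lia. apply IH.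
Qed.

Lemma reach_move (right : bool) n : forall U M x r ok b, n <= length b ->
  reach n ((U, (x, r) :: M), (ok, b))
    ((U, (if right then x + n else x - n, r) :: M), (ok, skipn n b)).
Proof.
  induction n as [|n IH]; intros U M x r ok b Hn.
  - rewrite Nat.add_0_r, Nat.sub_0_r. destruct right; constructor.
  - destruct b as [|t b]; simpl in Hn; [lia|].
    econstructor; [destruct right; [do 4 right; left|do 5 right; left]; reflexivity|].
    unfold move_head; cbn [fst snd skipn].
    replace (x + S n) with (x + 1 + n) by lia. replace (x - S n) with (pred x - n) by lia.
    destruct right; [apply (IH U M (x + 1))|apply (IH U M (pred x))]; lia.
Qed.

(* Two sensors with the same right end, the longer one moving right and the shorter one
   not: exchanging the displacements covers at least as much. *)
Lemma exchange_right x r x' r' y y' b c :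
  x + r = x' + r' -> r' <= r -> b <= r' \/ r' = r -> x < y -> y' <= x' ->
  (y - x) + (x' - y') <= b ->
  covers (y, r) c = true \/ covers (y', r') c = true ->
  covers (x' + (y - x), r') c = true \/ covers (x + y' - x', r) c = true.
Proof. intros. rewrite !coversP in *. cbn [fst snd] in *. lia. Qed.

(** Mirror image, with a common left end. The longer sensor now contains the old interval of the
    shorter one and reaches at least as far right as before; the shorter one takes over the left end
    of the longer one's old interval. No gap opens between them since the displacements add up to at
    most [b <= r']; if [r' = r], the two merely swap targets. *)
Lemma exchange_left x r x' r' y y' b c :
  x + r' = x' + r -> r <= x -> r' <= r -> b <= r' \/ r' = r -> y < x -> x' <= y' ->
  (x - y) + (y' - x') <= b ->
  covers (y, r) c = true \/ covers (y', r') c = true ->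
  covers (x' - (x - y), r') c = true \/ covers (x + (y' - x'), r) c = true.
Proof. intros. rewrite !coversP in *. cbn [fst snd] in *. lia. Qed.

(** * Completeness of the search *)

Definition moves_towards (right : bool) (x y : nat) : Prop := if right then x < y else y < x.

(** The picked sensor [s] can stand in for the sensor (x, r) that the solution moves towards the
    frontier: if [s] itself moves that way nothing has to change, otherwise the two displacements
    are exchanged. *)
Lemma move_candidate right V M b L p s rest x r y :
  Permutation (map fst V) (s :: rest) -> cost V <= b -> covers_all (map place V ++ M) L ->
  In ((x, r), y) V -> moves_towards right x y ->
  (if right then x + r = fst s + snd s else x + snd s = fst s + r /\ p + r < x) ->
  snd s <= r -> Nat.min r b <= snd s ->
  exists y' W, map fst W = rest /\ moves_towards right (fst s) y' /\
    displacement (fst s) y' + cost W <= b /\ covers_all (place (s, y') :: map place W ++ M) L.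
Proof.
  intros HP Hb HL Hin Hxy Hs Hr Hmin.
  destruct (assignment_perm V _ HP) as (V1 & HV1 & EV1).
  destruct V1 as [|[s1 y1] V1]; [discriminate|]. cbn [map fst] in EV1.
  injection EV1 as -> EV1.
  rewrite (cost_perm _ _ HV1), cost_cons in Hb. cbn [fst snd] in Hb.
  assert (HL1 : covers_all (place (s, y1) :: map place V1 ++ M) L).
  { eapply covers_all_incl; [|exact HL]. intros t Ht. change (In t (map place ((s, y1) :: V1) ++ M)).
    apply in_app_iff in Ht. apply in_app_iff. destruct Ht as [Ht|Ht]; auto. left.
    eapply Permutation_in; [|exact Ht]. apply Permutation_map; auto. }
  destruct s as [x' r']. cbn [fst snd] in *.
  assert (Hcase : moves_towards right x' y1 \/ ~ moves_towards right x' y1)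
    by (unfold moves_towards; destruct right; lia).
  destruct Hcase as [Hy1|Hy1].
  { exists y1, V1. auto. }
  assert (HinV1 : In ((x, r), y) V1).
  { pose proof (Permutation_in _ HV1 Hin) as [E|?]; auto. injection E as -> -> ->. contradiction. }
  apply in_split in HinV1. destruct HinV1 as (V2 & V3 & ->).
  rewrite cost_app, cost_cons in Hb. cbn [fst snd] in Hb.
  set (yj := if right then x' + (y - x) else x' - (x - y)).
  set (yi := if right then x + y1 - x' else x + (y1 - x')).
  exists yj, (V2 ++ ((x, r), yi) :: V3).
  (* A truncated radius below [b] is exact, and then minimality of [s] forces equality. *)
  assert (Hbr : b <= r' \/ r' = r) by lia.
  assert (Hxyb : displacement x y <= b) by lia.
  split; [rewrite <- EV1, !map_app; reflexivity|].
  (* In the left case [p + r < x] makes [x'] positive, so the truncated subtraction in [yj] really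
     moves [s]. *)
  split; [unfold moves_towards, yj in *; unfold displacement in *; destruct right; lia|].
  split.
  { rewrite cost_app, cost_cons. cbn [fst snd].
    assert (displacement x' yj + displacement x yi <= displacement x' y1 + displacement x y); [|lia].
    unfold moves_towards, displacement, yi, yj in *; destruct right; lia. }
  intros c Hc. destruct (HL1 c Hc) as (t & Ht & Hct).
  assert (Hold : In t (map place (V2 ++ V3) ++ M) \/ covers (y, r) c = true \/ covers (y1, r') c = true).
  { destruct Ht as [<-|Ht]; [auto|]. rewrite map_app, <- app_assoc in Ht. cbn [map] in Ht.
    apply in_app_iff in Ht. rewrite map_app, <- app_assoc, in_app_iff.
    destruct Ht as [Ht|[<-|Ht]]; auto. }
  destruct Hold as [Hold|Hold].
  - exists t; split; auto. right. rewrite map_app, <- app_assoc in *. cbn [map].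
    apply in_app_iff in Hold. apply in_app_iff. destruct Hold; auto. right; right; auto.
  - assert (Hnew : covers (yj, r') c = true \/ covers (yi, r) c = true).
    { unfold moves_towards, displacement, yi, yj in *. destruct right.
      - eapply exchange_right with (b := b) (y := y); eauto; lia.
      - eapply exchange_left with (b := b) (y := y); eauto; lia. }
    destruct Hnew as [Hnew|Hnew].
    + exists (yj, r'); split; [left; reflexivity|auto].
    + exists (yi, r); split; auto. right. rewrite map_app, <- app_assoc. cbn [map].
      apply in_app_iff. right; left. reflexivity.
Qed.

Lemma search_complete L n : forall U M b, length b <= n -> solvable U M (length b) L ->
  exists m st, m <= length b * (3 * length b + 1) /\
    reach m ((U, M), ((0, 0), b)) st /\ L <= frontier (sensors st).
Proof.
  induction n as [n IH] using lt_wf_ind. intros U M b Hn (V & EV & HV & HL).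
  set (p := frontier (U ++ M)).
  destruct (le_lt_dec L p) as [Hle|Hlt].
  { exists 0, ((U, M), ((0, 0), b)). split; [lia|]. split; [constructor|exact Hle]. }
  destruct (frontier_spec (U ++ M)) as [_ Hunc]. fold p in Hunc.
  destruct (HL p Hlt) as (t & Ht & Hct).
  apply in_app_iff in Ht. destruct Ht as [Ht|Ht].
  2:{ destruct Hunc. exists t; split; auto. apply in_app_iff; auto. }
  apply in_map_iff in Ht. destruct Ht as ([[x r] y] & <- & HinV).
  unfold place in Hct; cbn [fst snd] in Hct. apply coversP in Hct; cbn [fst snd] in Hct.
  assert (HinU : In (x, r) U) by (rewrite <- EV; apply (in_map fst _ _ HinV)).
  assert (Hnot : ~ (x <= p + r /\ p < x + r)).
  { intros Hc. apply Hunc. exists (x, r); split; [apply in_app_iff; auto|apply coversP; auto]. }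
  assert (Hxy : exists right, moves_towards right x y).
  { destruct (lt_eq_lt_dec x y) as [[?| ->]|?]; [exists true; auto|lia|exists false; auto]. }
  destruct Hxy as [right Hxy].
  assert (Hdist : displacement x y <= length b).
  { apply in_split in HinV. destruct HinV as (V1 & V2 & ->).
    rewrite cost_app, cost_cons in HV. cbn [fst snd] in HV. lia. }
  set (o := if right then p - (x + r) else x - (p + r)).
  set (k := Nat.min r (length b)).
  set (st1 := ((U, M), ((o, k), b)) : state).
  assert (R1 : reach (o + k) ((U, M), ((0, 0), b)) st1).
  { eapply reach_trans; [apply reach_offset|apply reach_radius]. }
  assert (Hel : eligible right (p, (o, k)) (x, r) = true).
  { unfold eligible, o, k; cbn [fst snd]. rewrite andb_true_iff, Nat.leb_le.
    unfold moves_towards in Hxy. destruct right; rewrite Nat.eqb_eq; lia. }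
  destruct (pick_spec right (p, (o, k)) U) as [(_ & Hno)|(s & Epick & HP & Hs & Hmin)].
  { rewrite Hno in Hel by auto. discriminate. }
  set (rest := snd (pick right (p, (o, k)) U)) in *.
  specialize (Hmin _ HinU Hel). cbn [snd] in Hmin.
  assert (Ho : o <= length b).
  { unfold o, displacement, moves_towards in *. destruct right; lia. }
  unfold eligible in Hs, Hel. rewrite andb_true_iff, Nat.leb_le in Hs, Hel. cbn [fst snd] in Hs, Hel.
  destruct (move_candidate right V M (length b) L p s rest x r y) as (y' & W & EW & Hy' & HW & HLW); auto.
  { rewrite EV; auto. }
  { destruct Hs as [Hs _], Hel as [Hel _].
    destruct right; rewrite Nat.eqb_eq in Hs, Hel; [lia|]. unfold moves_towards in Hxy. lia. }
  { destruct Hs; auto. }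
  destruct s as [x' r']. cbn [fst snd] in *.
  set (d := displacement x' y') in *.
  assert (Hd : 1 <= d) by (unfold d, displacement, moves_towards in *; destruct right; lia).
  set (st2 := ((rest, (x', r') :: M), ((0, 0), b)) : state).
  assert (R2 : reach 1 st1 st2).
  { apply reach_one. replace st2 with (select right st1).
    - destruct right; simpl; auto 10.
    - unfold select. change (frontier (sensors st1)) with p. unfold st1; cbn [fst snd].
      rewrite Epick. reflexivity. }
  assert (R3 : reach d st2 ((rest, (y', r') :: M), ((0, 0), skipn d b))).
  { replace y' with (if right then x' + d else x' - d).
    - apply reach_move. lia.
    - unfold d, displacement, moves_towards in *. destruct right; lia. }
  destruct (IH (n - d) ltac:(lia) rest ((y', r') :: M) (skipn d b)) as (m & st & Hm & R4 & Hst).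
  { rewrite length_skipn; lia. }
  { exists W. rewrite length_skipn. repeat split; auto; [lia|].
    eapply covers_all_incl; [|exact HLW]. intros t Ht. destruct Ht as [<-|Ht].
    - apply in_app_iff. right; left; reflexivity.
    - apply in_app_iff in Ht. apply in_app_iff. destruct Ht; auto. right; right; auto. }
  exists (o + k + (1 + (d + m))), st. split; [|split; auto].
  (* With budget b and 1 <= d <= b, this sensor takes at most 2 b + 1 + d <= 3 b + 1 letters and the
     others at most (b - d) (3 (b - d) + 1) <= (b - 1) (3 b + 1). *)
  - rewrite length_skipn in Hm. unfold k. nia.
  - eapply reach_trans; [exact R1|]. eapply reach_trans; [exact R2|].
    eapply reach_trans; [exact R3|exact R4].
Qed.

Lemma search_correct s L B :
  (exists st, In st (search s (repeat tt B)) /\ L <= frontier (sensors st)) <-> solvable s [] B L.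
Proof.
  split.
  - intros (st & Hst & HL). apply in_search in Hst. apply frontier_le in HL.
    pose proof (reach_sound _ _ _ _ Hst HL) as H.
    unfold initial, sensors in H; cbn [fst snd] in H. rewrite app_nil_r, repeat_length in H. exact H.
  - intros H. destruct (search_complete L B s [] (repeat tt B)) as (m & st & Hm & Hr & HL).
    + rewrite repeat_length; auto.
    + rewrite repeat_length; auto.
    + rewrite repeat_length in Hm. destruct st as [UM [[o k] b]].
      (* The search tries words of one exact length; a shorter word is padded with radius
         increments, which leave the sensors alone. *)
      exists (UM, ((o, k + (B * (3 * B + 1) - m)), b)). split; [|exact HL].
      apply in_search. replace (B * (3 * B + 1)) with (m + (B * (3 * B + 1) - m)) at 1 by lia.
      eapply reach_trans; [exact Hr|apply reach_radius].
Qed.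

(** * Real and integral solutions *)

Fixpoint sumZ (f : nat -> Z) (n : nat) : Z :=
  match n with O => 0%Z | S m => (sumZ f m + f m)%Z end.

Lemma sumZ_ext f g n : (forall i, i < n -> f i = g i) -> sumZ f n = sumZ g n.
Proof.
  induction n as [|n IH]; intros H; simpl; auto.
  rewrite IH, H; auto.
Qed.

Lemma sumZ_add f g n : sumZ (fun i => (f i + g i)%Z) n = (sumZ f n + sumZ g n)%Z.
Proof. induction n; simpl; lia. Qed.

Lemma sumZ_exchange f n m :
  sumZ (fun i => sumZ (fun j => f i j) m) n = sumZ (fun j => sumZ (fun i => f i j) n) m.
Proof.
  induction n as [|n IH]; simpl.
  - induction m; simpl; lia.
  - rewrite IH, sumZ_add. reflexivity.
Qed.

Lemma sumZ_ge f n a : (forall i, i < n -> (a <= f i)%Z) -> (Z.of_nat n * a <= sumZ f n)%Z.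
Proof.
  induction n as [|n IH]; intros H; cbn [sumZ]; [lia|].
  pose proof (H n (Nat.lt_succ_diag_r n)). specialize (IH (fun i Hi => H i (Nat.lt_lt_succ_r _ _ Hi))). lia.
Qed.

Lemma sumZ_shift g n : (sumZ (fun k => g (S k)) n = sumZ g n - g O + g n)%Z.
Proof. induction n as [|n IH]; simpl in *; lia. Qed.

(** Hermite's identity. Raising [m] by 1 shifts the sequence of quotients by one place: the first
    one drops out and comes back at the end increased by 1. *)
Lemma hermite K m : (0 < K)%nat -> (sumZ (fun k => (m + Z.of_nat k) / Z.of_nat K) K = m)%Z.
Proof.
  intros HK.
  assert (Hstep : forall m, (sumZ (fun k => (Z.succ m + Z.of_nat k) / Z.of_nat K) K
    = sumZ (fun k => (m + Z.of_nat k) / Z.of_nat K) K + 1)%Z).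
  { intros q. rewrite <- (sumZ_ext (fun k => (q + Z.of_nat (S k)) / Z.of_nat K)%Z).
    2:{ intros i _. f_equal. lia. }
    rewrite (sumZ_shift (fun k => (q + Z.of_nat k) / Z.of_nat K)%Z). simpl Z.of_nat.
    replace (q + Z.of_nat K)%Z with (q + 1 * Z.of_nat K)%Z by lia.
    rewrite Z.div_add, Z.add_0_r by lia. lia. }
  induction m as [|m IH|m IH] using Z.peano_ind.
  - assert (G : forall n, n <= K -> sumZ (fun k => (0 + Z.of_nat k) / Z.of_nat K)%Z n = 0%Z).
    { induction n as [|n IH]; intros Hn; cbn [sumZ]; auto.
      rewrite IH by lia. rewrite Z.div_small; lia. }
    apply G; auto.
  - rewrite Hstep, IH. lia.
  - specialize (Hstep (Z.pred m)). rewrite Z.succ_pred, IH in Hstep. lia.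
Qed.

(** All K quotients lie on the same side of the integer [x], so the absolute value can be pulled out
    of the sum. Thus rounding a multiple of 1/K costs nothing on average. *)
Lemma hermite_abs K m x : (0 < K)%nat ->
  (sumZ (fun k => Z.abs ((m + Z.of_nat k) / Z.of_nat K - x)) K = Z.abs (m - Z.of_nat K * x))%Z.
Proof.
  intros HK. pose proof (hermite K m HK) as Hh.
  assert (Hlin : forall e n, sumZ (fun k => e * ((m + Z.of_nat k) / Z.of_nat K - x))%Z n
    = (e * (sumZ (fun k => (m + Z.of_nat k) / Z.of_nat K)%Z n - Z.of_nat n * x))%Z).
  { intros e; induction n as [|n IH]; cbn [sumZ]; [simpl; lia|]. rewrite IH. lia. }
  destruct (Z_le_gt_dec (Z.of_nat K * x) m) as [Hle|Hgt].
  - rewrite (sumZ_ext _ (fun k => 1 * ((m + Z.of_nat k) / Z.of_nat K - x))%Z).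
    + rewrite Hlin, Hh. lia.
    + intros i _. assert (x <= (m + Z.of_nat i) / Z.of_nat K)%Z by (apply Z.div_le_lower_bound; lia). lia.
  - rewrite (sumZ_ext _ (fun k => (-1) * ((m + Z.of_nat k) / Z.of_nat K - x))%Z).
    + rewrite Hlin, Hh. lia.
    + intros i Hi. assert ((m + Z.of_nat i) / Z.of_nat K < x + 1)%Z by (apply Z.div_lt_upper_bound; lia). lia.
Qed.

(** * Rounding a real solution *)

Lemma Int_part_ge z w : (IZR z <= w)%R -> (z <= Int_part w)%Z.
Proof.
  intros H. destruct (base_Int_part w) as [_ H2].
  apply Z.lt_succ_r, lt_IZR. rewrite succ_IZR. lra.
Qed.

Lemma Int_part_lt z w : (w < IZR z)%R -> (Int_part w < z)%Z.
Proof. intros H. destruct (base_Int_part w) as [H1 _]. apply lt_IZR. lra. Qed.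

(** Applied to the right ends of the sensors: a sensor that covers [t'] starts strictly before [t]
    and reaches [t]. Coverage of [t] itself would not give the strict inequality. *)
Lemma point_before (a : nat -> R) c t n : (c < t)%R ->
  exists t', (c <= t' < t)%R /\ forall i, i < n -> (a i < t)%R -> (a i < t')%R.
Proof.
  intros Hct; induction n as [|n (t' & Ht' & H)].
  - exists c; split; [lra|lia].
  - exists (if Rlt_dec (a n) t then Rmax t' ((a n + t) / 2) else t').
    destruct (Rlt_dec (a n) t) as [Hn|Hn].
    + pose proof (Rmax_l t' ((a n + t) / 2)); pose proof (Rmax_r t' ((a n + t) / 2)).
      split; [split; [lra|apply Rmax_lub_lt; lra]|].
      intros i Hi Hai. destruct (Nat.eq_dec i n) as [->|ne]; [lra|].
      specialize (H i ltac:(lia) Hai). lra.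
    + split; auto. intros i Hi Hai. destruct (Nat.eq_dec i n) as [->|ne]; [lra|].
      apply H; auto; lia.
Qed.

Lemma sumR_le f g n : (forall i, i < n -> (f i <= g i)%R) -> (sumR f n <= sumR g n)%R.
Proof.
  induction n as [|n IH]; intros H; simpl; [lra|].
  specialize (IH (fun i Hi => H i (Nat.lt_lt_succ_r _ _ Hi))).
  specialize (H n (Nat.lt_succ_diag_r n)). lra.
Qed.

Lemma sumR_affine a b f n : sumR (fun i => a * f i + b)%R n = (a * sumR f n + INR n * b)%R.
Proof. induction n as [|n IH]; [simpl; ring|]. cbn [sumR]. rewrite IH, S_INR. ring. Qed.

Lemma sumR_IZR f n : sumR (fun i => IZR (f i)) n = IZR (sumZ f n).
Proof. induction n as [|n IH]; simpl; auto. rewrite IH, plus_IZR. auto. Qed.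

Lemma rounded_cover s L y K k c :
  (forall t, (0 <= t <= INR L)%R -> exists i, i < length s /\
     (y i - sensor_r s i <= t <= y i + sensor_r s i)%R) ->
  k < K -> c < L ->
  exists i, i < length s /\
    ((Int_part (INR K * y i) + Z.of_nat k) / Z.of_nat K <= Z.of_nat c + Z.of_nat (snd (nth i s (0, 0)%nat)))%Z /\
    (Z.of_nat c + 1 <= (Int_part (INR K * y i) + Z.of_nat k) / Z.of_nat K + Z.of_nat (snd (nth i s (0, 0)%nat)))%Z.
Proof.
  intros Hcov Hk Hc.
  assert (HKR : (0 < INR K)%R) by (apply lt_0_INR; lia).
  assert (HkR : (0 <= INR k < INR K)%R) by (split; [apply pos_INR|apply lt_INR; auto]).
  (* Rounding y + k/K down leaves cell c covered exactly if y - r < t <= y + r, which singles out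
     this point. *)
  set (t := (INR c + 1 - INR k / INR K)%R).
  assert (Hfrac : (0 <= INR k / INR K < 1)%R).
  { split; [apply Rmult_le_pos; [lra|left; apply Rinv_0_lt_compat; auto]|].
    apply Rmult_lt_reg_r with (INR K); auto. unfold Rdiv. rewrite Rmult_assoc, Rinv_l; lra. }
  assert (HKt : (INR K * t = INR K * (INR c + 1) - INR k)%R) by (unfold t; field; lra).
  destruct (point_before (fun i => y i + sensor_r s i)%R (INR c) t (length s)) as (t' & Ht' & Hbefore);
    [unfold t; lra|].
  pose proof (pos_INR c) as Hc0. assert (HcL : (INR c + 1 <= INR L)%R) by (rewrite <- S_INR; apply le_INR; lia).
  destruct (Hcov t') as (i & Hi & Hi1 & Hi2); [unfold t in Ht'; lra|].
  exists i; split; auto.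
  assert (Hr : sensor_r s i = INR (snd (nth i s (0, 0)))) by reflexivity.
  set (r := snd (nth i s (0, 0))) in *. rewrite Hr in *.
  assert (Hup : (t <= y i + INR r)%R).
  { destruct (Rlt_dec (y i + INR r) t) as [Hlt|]; [|lra].
    specialize (Hbefore i Hi). rewrite Hr in Hbefore. specialize (Hbefore Hlt). lra. }
  split.
  - apply Z.lt_succ_r, Z.div_lt_upper_bound; [lia|].
    assert (Int_part (INR K * y i) < Z.of_nat K * (Z.of_nat c + 1 + Z.of_nat r) - Z.of_nat k)%Z; [|lia].
    apply Int_part_lt. rewrite minus_IZR, mult_IZR, !plus_IZR, <- !INR_IZR_INZ.
    apply Rlt_le_trans with (INR K * (t + INR r))%R; [apply Rmult_lt_compat_l; lra|]. lra.
  - assert (Z.of_nat c + 1 - Z.of_nat r <= (Int_part (INR K * y i) + Z.of_nat k) / Z.of_nat K)%Z; [|lia].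
    apply Z.div_le_lower_bound; [lia|].
    assert (Z.of_nat K * (Z.of_nat c + 1 - Z.of_nat r) - Z.of_nat k <= Int_part (INR K * y i))%Z; [|lia].
    apply Int_part_ge. rewrite minus_IZR, mult_IZR, minus_IZR, plus_IZR, <- !INR_IZR_INZ.
    apply Rle_trans with (INR K * (t - INR r))%R; [lra|]. apply Rmult_le_compat_l; lra.
Qed.

(* Rounding every position down after a common shift k / K keeps the barrier covered;
   on average over k < K the cost grows by less than n / K, so some shift stays within
   the integral budget once K > n. *)
Lemma rounded_cost s y B :
  (sumR (fun i => Rabs (y i - sensor_x s i)) (length s) <= INR B)%R ->
  exists k, k < S (length s) /\
    (sumZ (fun i => Z.abs ((Int_part (INR (S (length s)) * y i) + Z.of_nat k) / Z.of_nat (S (length s))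
       - Z.of_nat (fst (nth i s (0, 0)%nat)))) (length s) <= Z.of_nat B)%Z.
Proof.
  intros HB. set (n := length s) in *. set (K := S n).
  set (m := fun i => Int_part (INR K * y i)).
  set (C := fun k => sumZ (fun i => Z.abs ((m i + Z.of_nat k) / Z.of_nat K - Z.of_nat (fst (nth i s (0, 0)%nat)))) n).
  assert (Htot : (sumZ C K < Z.of_nat K * (Z.of_nat B + 1))%Z).
  { unfold C. rewrite sumZ_exchange.
    rewrite (sumZ_ext _ (fun i => Z.abs (m i - Z.of_nat K * Z.of_nat (fst (nth i s (0, 0)%nat)))))
      by (intros; apply hermite_abs; unfold K; lia).
    apply lt_IZR. rewrite <- sumR_IZR, mult_IZR, plus_IZR, <- !INR_IZR_INZ.
    apply Rle_lt_trans with (sumR (fun i => INR K * Rabs (y i - sensor_x s i) + 1)%R n).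
    - apply sumR_le. intros i Hi. rewrite abs_IZR, minus_IZR, mult_IZR, <- !INR_IZR_INZ.
      unfold sensor_x. set (x := INR (fst (nth i s (0, 0)))).
      destruct (base_Int_part (INR K * y i)) as [H1 H2]. fold (m i) in H1, H2.
      assert (HK : (0 < INR K)%R) by (apply lt_0_INR; unfold K; lia).
      assert (E : (INR K * Rabs (y i - x) = Rabs (INR K * y i - INR K * x))%R).
      { rewrite <- Rmult_minus_distr_l, Rabs_mult, (Rabs_pos_eq (INR K)); lra. }
      rewrite E. unfold Rabs. destruct (Rcase_abs _), (Rcase_abs _); lra.
    - rewrite sumR_affine. assert (INR n < INR K)%R by (apply lt_INR; unfold K; lia).
      pose proof (pos_INR K). assert (INR K * sumR (fun i => Rabs (y i - sensor_x s i)) n <= INR K * INR B)%R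
        by (apply Rmult_le_compat_l; auto). lra. }
  assert (Hex : forall q, (exists k, k < q /\ (C k <= Z.of_nat B)%Z) \/
    forall k, k < q -> (Z.of_nat B + 1 <= C k)%Z).
  { induction q as [|q [(k & Hk & Hc)|IH]]; [right; lia|left; exists k; auto|].
    destruct (Z_le_gt_dec (C q) (Z.of_nat B)) as [Hc|Hc]; [left; exists q; auto|].
    right. intros k Hk. destruct (Nat.eq_dec k q) as [->|ne]; [lia|apply IH; lia]. }
  destruct (Hex K) as [(k & Hk & Hc)|Hall]; [exists k; auto|].
  pose proof (sumZ_ge C K _ Hall) as Hge. destruct (Zlt_not_le _ _ Htot Hge).
Qed.

Lemma map_nth_seq {A : Type} (l : list A) d : map (fun i => nth i l d) (seq 0 (length l)) = l.
Proof.
  induction l as [|a l IH]; auto. simpl. f_equal. rewrite <- seq_shift, map_map. exact IH.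
Qed.

Lemma barrier_solvable s L B : BarrierCoverage s L B -> solvable s [] B L.
Proof.
  intros (y & Hcov & HB). destruct (rounded_cost s y B HB) as (k & Hk & Hcost).
  set (K := S (length s)) in *.
  set (z := fun i => ((Int_part (INR K * y i) + Z.of_nat k) / Z.of_nat K)%Z).
  change (sumZ (fun i => Z.abs (z i - Z.of_nat (fst (nth i s (0, 0)%nat)))) (length s)
    <= Z.of_nat B)%Z in Hcost.
  (* Negative positions are clipped to 0. This brings them closer to the original position and,
     cells being nonnegative, loses no coverage. *)
  exists (map (fun i => (nth i s (0, 0), Z.to_nat (z i))) (seq 0 (length s))).
  split; [|split].
  - rewrite map_map. cbn [fst]. apply map_nth_seq.
  - apply Nat2Z.inj_le. eapply Z.le_trans; [|exact Hcost].
    clearbody z. clear. generalize (length s). induction n as [|n IH]; [simpl; lia|].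
    rewrite seq_S, map_app, cost_app. cbn [map plus]. rewrite cost_cons. cbn [fst snd sumZ].
    change (cost []) with 0. unfold displacement. lia.
  - intros c Hc. rewrite app_nil_r, map_map.
    destruct (rounded_cover s L y K k c Hcov Hk Hc) as (i & Hi & H1 & H2). fold (z i) in H1, H2.
    exists (place (nth i s (0, 0), Z.to_nat (z i))). split.
    + apply in_map_iff. exists i; split; auto. apply in_seq; lia.
    + apply coversP. unfold place; cbn [fst snd]. lia.
Qed.

(** * From integral back to real solutions *)

Lemma sumR_shift f n : sumR f (S n) = (f O + sumR (fun i => f (S i)) n)%R.
Proof. induction n as [|n IH]; [simpl; ring|]. cbn [sumR] in *. rewrite IH. ring. Qed.

Lemma sumR_cost V : sumR (fun i => Rabs (INR (snd (nth i V ((0, 0), 0))) -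
  INR (fst (fst (nth i V ((0, 0), 0)))))) (length V) = INR (cost V).
Proof.
  induction V as [|[[x r] y] V IH]; auto. cbn [length]. rewrite sumR_shift. cbn [nth fst snd].
  rewrite IH, cost_cons, plus_INR. f_equal. cbn [fst snd]. unfold displacement.
  destruct (le_lt_dec x y) as [H|H].
  - replace (x - y + (y - x)) with (y - x) by lia. rewrite minus_INR by auto.
    apply le_INR in H. apply Rabs_pos_eq. lra.
  - replace (x - y + (y - x)) with (x - y) by lia. rewrite minus_INR by lia.
    apply lt_INR in H. rewrite Rabs_left by lra. lra.
Qed.

Lemma sumR_ext f g n : (forall i, i < n -> f i = g i) -> sumR f n = sumR g n.
Proof. induction n as [|n IH]; intros H; simpl; auto. rewrite IH, H; auto. Qed.

Lemma cell_of_point L t : 0 < L -> (0 <= t <= INR L)%R ->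
  exists c, c < L /\ (INR c <= t <= INR c + 1)%R.
Proof.
  induction L as [|L IH]; intros HL Ht; [lia|]. rewrite S_INR in Ht.
  destruct (Rle_dec (INR L) t) as [H|H]; [exists L; split; [lia|lra]|].
  destruct L as [|L]; [simpl in *; lra|].
  destruct IH as (c & Hc & Hct); [lia|lra|]. exists c; split; auto.
Qed.

(** For [L = 0] there are no cells, and integral solvability says nothing about the point 0;
    [barrier_zero] settles that case. *)
Lemma solvable_barrier s L B : 0 < L -> solvable s [] B L -> BarrierCoverage s L B.
Proof.
  intros HL (V & EV & HB & HV). rewrite app_nil_r in HV.
  assert (Hlen : length s = length V) by (rewrite <- EV; apply length_map).
  assert (Hnth : forall i, nth i s (0, 0) = fst (nth i V ((0, 0), 0)))
    by (intros i; rewrite <- EV; apply (map_nth fst V ((0, 0), 0))).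
  exists (fun i => INR (snd (nth i V ((0, 0), 0)))). split.
  - intros t Ht. destruct (cell_of_point L t HL Ht) as (c & Hc & Hct).
    destruct (HV c Hc) as (p & Hp & Hcov). apply in_map_iff in Hp. destruct Hp as (v & <- & Hv).
    apply (In_nth _ _ ((0, 0), 0)) in Hv. destruct Hv as (i & Hi & Ei).
    exists i; split; [lia|]. unfold sensor_r. rewrite Hnth, Ei.
    apply coversP in Hcov. unfold place in Hcov; cbn [fst snd] in Hcov. destruct Hcov as [H1 H2].
    apply le_INR in H1. apply (le_INR (S c)) in H2. rewrite S_INR in H2. rewrite plus_INR in H1, H2. lra.
  - rewrite Hlen. unfold sensor_x.
    rewrite (sumR_ext _ (fun i => Rabs (INR (snd (nth i V ((0, 0), 0))) -
      INR (fst (fst (nth i V ((0, 0), 0))))))) by (intros; rewrite Hnth; auto).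
    rewrite sumR_cost. apply le_INR; auto.
Qed.

(** * The degenerate barrier *)

Lemma sumR_nonneg f n : (forall i, (0 <= f i)%R) -> (0 <= sumR f n)%R.
Proof. intros H; induction n; simpl; [lra|]. specialize (H n); lra. Qed.

Lemma sumR_term f n i : (forall i, (0 <= f i)%R) -> i < n -> (f i <= sumR f n)%R.
Proof.
  intros H; induction n as [|n IH]; intros Hi; [lia|]. cbn [sumR].
  pose proof (sumR_nonneg f n H). pose proof (H n).
  destruct (Nat.eq_dec i n) as [->|ne]; [lra|]. specialize (IH ltac:(lia)). lra.
Qed.

Lemma sumR_single f j n : (forall i, i <> j -> f i = 0%R) -> (0 <= f j)%R -> (sumR f n <= f j)%R.
Proof.
  intros H Hj; induction n as [|n IH]; [simpl; lra|]. cbn [sumR].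
  destruct (Nat.eq_dec n j) as [->|ne]; [|rewrite H; auto; lra].
  assert (G : forall m, m <= j -> sumR f m = 0%R).
  { induction m as [|m IHm]; intros Hm; simpl; auto. rewrite IHm, H by lia. lra. }
  rewrite G by lia. lra.
Qed.

Lemma barrier_zero s B :
  BarrierCoverage s 0 B <-> exists xr, In xr s /\ fst xr <= B + snd xr.
Proof.
  split.
  - intros (y & Hcov & HB). destruct (Hcov 0%R) as (i & Hi & H1 & H2); [simpl; lra|].
    exists (nth i s (0, 0)). split; [apply nth_In; auto|].
    apply INR_le. rewrite plus_INR.
    pose proof (sumR_term (fun i => Rabs (y i - sensor_x s i)) (length s) i
      (fun _ => Rabs_pos _) Hi) as Hterm. cbv beta in Hterm.
    pose proof (Rle_trans _ _ _ Hterm HB) as Hi'. rewrite Rabs_minus_sym in Hi'.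
    pose proof (Rle_abs (sensor_x s i - y i)). unfold sensor_x, sensor_r in *. lra.
  - intros (xr & Hin & Hle). apply (In_nth _ _ (0, 0)) in Hin. destruct Hin as (j & Hj & Ej).
    destruct xr as [x r]. cbn [fst snd] in Hle.
    (* [Nat.min x r] is the nearest position from which the sensor reaches 0; all other sensors
       stay. *)
    exists (fun i => if i =? j then INR (Nat.min x r) else sensor_x s i). split.
    + intros t Ht. simpl in Ht. exists j; split; auto. rewrite Nat.eqb_refl.
      unfold sensor_r. rewrite Ej. cbn [snd].
      assert (INR (Nat.min x r) <= INR r)%R by (apply le_INR; lia).
      pose proof (pos_INR (Nat.min x r)). pose proof (pos_INR r). lra.
    + eapply Rle_trans; [apply (sumR_single _ j)|].
      * intros i Hi. apply Nat.eqb_neq in Hi. rewrite Hi, Rminus_diag. apply Rabs_R0.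
      * apply Rabs_pos.
      * rewrite Nat.eqb_refl. unfold sensor_x. rewrite Ej. cbn [fst].
        assert (INR (Nat.min x r) <= INR x)%R by (apply le_INR; lia).
        rewrite Rabs_left1 by lra. rewrite Ropp_minus_distr, <- minus_INR by lia.
        apply le_INR. lia.
Qed.

(** * Parsing the input *)

(** The list read need not be [bits n]: zero is written with one digit and yields [[false]]. *)
Lemma fold_parse_bin n ns :
  exists l, val l = n /\ fold_left parse_step (map symbol (bin n)) ([], ns) = (l, ns).
Proof.
  assert (Hp : forall p, fold_left parse_step (map symbol (pos_bits p)) ([], ns) = (posbits p, ns)).
  { induction p as [p IH|p IH|]; cbn [pos_bits]; rewrite ?map_app, ?fold_left_app, ?IH; reflexivity. }
  pose proof (val_bits n) as Hv. unfold bin, bits in *. destruct (N.of_nat n) as [|p].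
  - exists [false]; split; auto.
  - exists (posbits p); split; auto.
Qed.

Lemma fold_parse_sep l ns w :
  fold_left parse_step (map symbol ([3] ++ w)) (l, ns) = fold_left parse_step (map symbol w) ([], val l :: ns).
Proof. reflexivity. Qed.

Lemma fold_parse_sensors s : forall l ns,
  exists l' ns', fold_left parse_step (map symbol
    (flat_map (fun xr => [3] ++ bin (fst xr) ++ [3] ++ bin (snd xr)) s)) (l, ns) = (l', ns') /\
    val l' :: ns' = rev (flat_map (fun xr => [fst xr; snd xr]) s) ++ val l :: ns.
Proof.
  induction s as [|[x r] s IH]; intros l ns; [exists l, ns; auto|].
  cbn [flat_map fst snd]. rewrite <- !app_assoc.
  rewrite fold_parse_sep, map_app, fold_left_app.
  destruct (fold_parse_bin x (val l :: ns)) as (lx & Hx & ->).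
  rewrite fold_parse_sep, map_app, fold_left_app, Hx.
  destruct (fold_parse_bin r (x :: val l :: ns)) as (lr & Hr & ->).
  destruct (IH lr (x :: val l :: ns)) as (l' & ns' & E1 & E2).
  exists l', ns'. split; auto. rewrite E2, Hr. cbn [app rev]. rewrite <- !app_assoc. reflexivity.
Qed.

Lemma fold_pair s : forall ps,
  fold_left pair_step (rev (flat_map (fun xr => [fst xr; snd xr]) s)) ([], ps) = ([], s ++ ps).
Proof.
  induction s as [|[x r] s IH] using rev_ind; intros ps; auto.
  rewrite flat_map_app, rev_app_distr, fold_left_app. cbn.
  rewrite IH, <- app_assoc. reflexivity.
Qed.

Lemma parse_encode s L B : parse (map symbol (encode s L B)) = (L, B) :: s.
Proof.
  unfold parse, numbers, encode. rewrite map_app, fold_left_app.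
  destruct (fold_parse_bin L []) as (lL & HL & ->).
  rewrite fold_parse_sep, map_app, fold_left_app.
  destruct (fold_parse_bin B [val lL]) as (lB & HB & ->).
  destruct (fold_parse_sensors s lB [val lL]) as (l' & ns' & -> & E). cbn [fst snd].
  rewrite E, HB, HL.
  change (rev (flat_map (fun xr => [fst xr; snd xr]) s) ++ [B; L])
    with (rev (flat_map (fun xr => [fst xr; snd xr]) s) ++ rev [L; B]).
  rewrite <- rev_app_distr.
  change ([L; B] ++ flat_map (fun xr => [fst xr; snd xr]) s)
    with (flat_map (fun xr => [fst xr; snd xr]) ((L, B) :: s)).
  rewrite fold_pair, app_nil_r. reflexivity.
Qed.

Lemma bin_symbols n : Forall (fun a => 1 <= a <= 3) (bin n).
Proof.
  unfold bin. destruct (N.of_nat n) as [|p]; [repeat constructor|].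
  induction p; simpl; try apply Forall_app; repeat constructor; auto.
Qed.

Lemma encode_symbols s L B : Forall (fun a => 1 <= a <= 3) (encode s L B).
Proof.
  unfold encode. repeat (apply Forall_app; split); auto using bin_symbols.
  induction s as [|[x r] s IH]; [constructor|]. simpl. constructor; [lia|].
  rewrite <- app_assoc. apply Forall_app; split; [apply bin_symbols|].
  constructor; [lia|]. apply Forall_app; auto using bin_symbols.
Qed.

Lemma decide_correct s L B :
  decide (map symbol (encode s L B)) = true <-> BarrierCoverage s L B.
Proof.
  unfold decide, input_L, input_B, input_s. rewrite parse_encode. cbn [hd tl fst snd].
  rewrite existsb_exists. unfold accepting. destruct (Nat.eqb_spec L 0) as [->|HL].
  - rewrite barrier_zero. split.
    + intros (_ & _ & H). apply existsb_exists in H. destruct H as (xr & Hin & Hle).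
      exists xr. rewrite Nat.leb_le in Hle. auto.
    + intros (xr & Hin & Hle).
      (* The test for [L = 0] ignores the state, but [existsb] still needs some state in the
         list. *)
      destruct (proj2 (search_correct s 0 B)) as (st & Hst & _).
      { apply barrier_solvable, barrier_zero. eauto. }
      exists st; split; auto. apply existsb_exists. exists xr. rewrite Nat.leb_le. auto.
  - transitivity (solvable s [] B L).
    + rewrite <- search_correct. setoid_rewrite Nat.leb_le. reflexivity.
    + split; [apply solvable_barrier; lia|apply barrier_solvable].
Qed.

(** * The final time bound *)

Lemma sz_symbols w : sz (map symbol w) <= 8 * length w + 1.
Proof.
  induction w as [|a w IH]; [cbn; lia|]. cbn [map length]. rewrite sz_cons.
  destruct (symbol a) as [u v]. rewrite sz_mkpair. pose proof (sz_bool u); pose proof (sz_bool v). lia.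
Qed.

(** Since 201 <= 2^8 and B (3 B + 1) <= 4 B^2, the exponent is at most 32 e B^2. For B >= 16 e this
    is at most 2 B^3; for smaller B it is bounded by the constant factor. *)
Lemma pow_absorb e B : 201 ^ (e * (B * (3 * B + 1))) <= 2 ^ (32 * e * (16 * e * (16 * e))) * 2 ^ (2 * B ^ 2 * (B + 1)).
Proof.
  apply Nat.le_trans with ((2 ^ 8) ^ (e * (B * (3 * B + 1)))).
  { apply Nat.pow_le_mono_l. simpl; lia. }
  rewrite <- Nat.pow_mul_r, <- Nat.pow_add_r. apply Nat.pow_le_mono_r; [lia|].
  assert (B * (3 * B + 1) <= 4 * (B * B)) by nia.
  assert (e * (B * (3 * B + 1)) <= e * (4 * (B * B))) by (apply Nat.mul_le_mono_l; auto).
  apply Nat.le_trans with (32 * e * (B * B)); [lia|].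
  replace (2 * B ^ 2 * (B + 1)) with (2 * (B * B) * (B + 1)) by (simpl; lia).
  destruct (le_lt_dec (16 * e) B) as [He|He].
  - assert (16 * e * (B * B) <= B * (B * B)) by (apply Nat.mul_le_mono_r; auto). lia.
  - assert (B * B <= (16 * e) * (16 * e)) by (apply Nat.mul_le_mono; lia).
    assert (e * (B * B) <= e * ((16 * e) * (16 * e))) by (apply Nat.mul_le_mono_l; auto). lia.
Qed.

Lemma time_bound c0 : exists c, forall N B T,
  T <= (8 * N + 1 + B + 201 ^ (B * (3 * B + 1)) + 2) ^ c0 ->
  (300 * (N + T + 1)) ^ 2 <= c * 2 ^ (2 * B ^ 2 * (B + 1)) * (N + 1) ^ c.
Proof.
  (* One more power than [c0] makes room for [N + T + 1], and the simulation squares. *)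
  set (e := 2 * (c0 + 1)).
  set (D := 600 ^ 2 * 16 ^ e * 2 ^ (32 * e * (16 * e * (16 * e)))).
  exists (D + e). intros N B T HT.
  set (Q := 201 ^ (B * (3 * B + 1))) in *.
  set (F := 2 ^ (2 * B ^ 2 * (B + 1))).
  assert (HQ : B + 1 <= Q).
  { unfold Q. apply Nat.le_trans with (2 ^ B); [rewrite Nat.add_1_r; apply Nat.pow_gt_lin_r; lia|].
    apply Nat.le_trans with (2 ^ (B * (3 * B + 1))).
    - apply Nat.pow_le_mono_r; [lia|]. nia.
    - apply Nat.pow_le_mono_l. lia. }
  (* The sum is replaced by a product, whose powers split into a constant, a polynomial in [N] and a
     power of 201; [HQ] lets [Q] absorb [B]. *)
  set (Y := 16 * (N + 1) * Q).
  assert (HY : 8 * N + 1 + B + Q + 2 <= Y) by (unfold Y; nia).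
  assert (HT' : T <= Y ^ c0) by (eapply Nat.le_trans; [exact HT|apply Nat.pow_le_mono_l; auto]).
  assert (HY1 : 1 <= Y ^ c0) by (pose proof (Nat.pow_nonzero Y c0); lia).
  assert (HNT : N + T + 1 <= 2 * Y ^ (c0 + 1)).
  { rewrite Nat.pow_add_r, Nat.pow_1_r. assert (N + 1 <= Y) by lia. nia. }
  apply Nat.le_trans with ((600 * Y ^ (c0 + 1)) ^ 2).
  { apply Nat.pow_le_mono_l. lia. }
  rewrite Nat.pow_mul_l, <- Nat.pow_mul_r.
  replace ((c0 + 1) * 2) with e by (unfold e; lia).
  unfold Y. rewrite !Nat.pow_mul_l. unfold Q. rewrite <- Nat.pow_mul_r.
  rewrite (Nat.mul_comm _ e). pose proof (pow_absorb e B) as Ha. fold F in Ha.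
  apply Nat.le_trans with (D * F * (N + 1) ^ e).
  - unfold D. revert Ha. generalize (201 ^ (e * (B * (3 * B + 1)))) (2 ^ (32 * e * (16 * e * (16 * e)))) (16 ^ e) (600 ^ 2) ((N + 1) ^ e).
    clear. intros q d s h x Ha.
    replace (h * s * d * F * x) with ((h * s * x) * (d * F)) by lia.
    replace (h * (s * x * q)) with ((h * s * x) * q) by lia.
    apply Nat.mul_le_mono_l; auto.
  - apply Nat.mul_le_mono.
    + apply Nat.mul_le_mono_r. lia.
    + apply Nat.pow_le_mono_r; lia.
Qed.

Theorem theorem3 :
  exists M : TM, wf_TM M /\
    exists c : nat,
      forall (s : list (nat * nat)) (L B : nat),
        decides_within M (encode s L B)
          (c * 2 ^ (2 * B ^ 2 * (B + 1)) * (length (encode s L B) + 1) ^ c)%nat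
          (BarrierCoverage s L B).
Proof.
  destruct CT_decide as [_ (p & T & [c0 HT] & Hp)].
  exists (tm_of (decider p)). split; [apply tm_of_wf|].
  destruct (time_bound c0) as [c Hc]. exists c. intros s L B.
  set (w := encode s L B).
  assert (Etree : forall l, enc l = tree_of_symbols l) by (induction l; auto).
  eapply decider_decides with (b := decide (map symbol w)) (t := T (map symbol w)).
  - apply encode_symbols.
  - rewrite <- Etree. apply Hp.
  - apply decide_correct.
  - apply Hc. eapply Nat.le_trans; [apply HT|]. apply Nat.pow_le_mono_l.
    unfold work, input_B, w. rewrite parse_encode. cbn [hd snd].
    pose proof (sz_symbols (encode s L B)). lia.
Qed.
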